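(* Let $F$ be a field of characteristic $p>0$ with $F^{p-1}=F$. \begin{enumerate} \item[(a)] Let $S_1,\ldots,S_{r+1}\subset F$ be nonempty with $\mathrm{pdeg}(S_i)=1$ for $i=1,\ldots,r$ and $\mathrm{d} S_1\wedge\cdots\wedge\mathrm{d} S_r\wedge\mathrm{d} S_{r+1}\neq\{0\}$. Write $\mathrm{pdeg}(S_1\cup\cdots\cup S_{r+1})=r+\ell$ with $\ell\in\mathbb Z$. Then $\ell\geq1$, and for any $p$-independent set $\{a_1,\ldots,a_r,e_1,\ldots,e_\ell\}\subset F$ with $F^p(S_i)=F^p(a_i)$ for $i=1,\ldots,r$ and $F^p(a_1,\ldots,a_r)(S_{r+1})=F^p(a_1,\ldots,a_r)(e_1,\ldots,e_\ell)$ we have $$\operatorname{ann}\nu^n_F(\mathrm{d} S_1\wedge\cdots\wedge\mathrm{d} S_r\wedge\mathrm{d} S_{r+1})=\Big[\tfrac{\mathrm{d} x}{x}\;\Big|\; x\in F^p(a_1,\ldots,a_r)^*\Big]\wedge\nu_{n-1}(F)+\Big[\tfrac{\mathrm{d} y_1}{y_1}\wedge\cdots\wedge\tfrac{\mathrm{d} y_\ell}{y_\ell}\;\Big|\;y_1,\ldots,y_\ell\in F^p(a_1,\ldots,a_r,e_1,\ldots,e_\ell)^*\Big]\wedge\nu_{n-\ell}(F).$$ \item[(b)] Let $S\subset F$ be nonempty with $\mathrm{pdeg}(S)=k\in\mathbb N$ and let $\{a_1,\ldots,a_k\}$ be a $p$-basis of $F^p(S)$. For $r\in\{1,\ldots,k\}$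 put $t=k-r+1$. Then $$\operatorname{ann}\nu^n_F\Big(\textstyle\bigwedge^r\mathrm{d} S\Big)=\Big[\tfrac{\mathrm{d} y_1}{y_1}\wedge\cdots\wedge\tfrac{\mathrm{d} y_t}{y_t}\;\Big|\;y_1,\ldots,y_t\in F^p(a_1,\ldots,a_k)^*\Big]\wedge\nu_{n-t}(F),$$ and for $r>k$ we have $\operatorname{ann}\nu^n_F(\bigwedge^r\mathrm{d} S)=\nu_n(F)$. \end{enumerate}
   Context: $F$ is a field of characteristic $p>0$. $\Omega^1(F)$ is the $F$-vector space generated by symbols $\mathrm{d} a$ ($a\in F$) with $\mathrm{d}(a+b)=\mathrm{d} a+\mathrm{d} b$, $\mathrm{d}(ab)=a\,\mathrm{d} b+b\,\mathrm{d} a$; $\Omega^n(F)=\bigwedge^n_F\Omega^1(F)$, $\Omega^0(F)=F$, $\Omega^n(F)=0$ for $n<0$; $\mathrm{d}:\Omega^{n-1}(F)\to\Omega^n(F)$, $x\,\mathrm{d} a_1\wedge\cdots\mapsto\mathrm{d} x\wedge\mathrm{d} a_1\wedge\cdots$. A subset $A\subset F$ is $p$-independent if $[F^p(a_1,\ldots,a_k):F^p]=p^k$ for all finite $\{a_1,\ldots,a_k\}\subset A$; for $C\subset F$, $\mathrm{pdeg}(C)=\log_p[F^p(C):F^p]$ ($\infty$ if infinite); for a field $L$ with $F^p\subseteq L\subseteq F$, a $p$-basis of $L$ is a $p$-independent $A\subset L$ with $F^p(A)=L$. $\wp:\Omega^n(F)\to\Omega^n(F)/\mathrm{d}\Omega^{n-1}(F)$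 is the additive map $x\frac{\mathrm{d} a_1}{a_1}\wedge\cdots\wedge\frac{\mathrm{d} a_n}{a_n}\mapsto(x^p-x)\frac{\mathrm{d} a_1}{a_1}\wedge\cdots\wedge\frac{\mathrm{d} a_n}{a_n}\bmod\mathrm{d}\Omega^{n-1}(F)$, $\nu_n(F)=\ker\wp$ (additively generated by logarithmic forms $\frac{\mathrm{d} a_1}{a_1}\wedge\cdots\wedge\frac{\mathrm{d} a_n}{a_n}$, $a_i\in F^*$; $\nu_0(F)=\mathbb F_p$, $\nu_m(F)=0$ for $m<0$). For nonempty $S_1,\ldots,S_k\subset F$, $\mathrm{d} S_1\wedge\cdots\wedge\mathrm{d} S_k=\{\mathrm{d} s_1\wedge\cdots\wedge\mathrm{d} s_k\mid s_i\in S_i\}$ and $\bigwedge^k\mathrm{d} S=\mathrm{d} S\wedge\cdots\wedge\mathrm{d} S$ ($k$ factors). For nonempty $U\subset\Omega^k(F)$, $\operatorname{ann}\Omega^n_F(U)=\{\omega\in\Omega^n(F)\mid\omega\wedge u=0\ \forall u\in U\}$ and $\operatorname{ann}\nu^n_F(U)=\operatorname{ann}\Omega^n_F(U)\cap\nu_n(F)$. $[\,\cdots]$ denotes the additive subgroup generated; $X\wedge Y$ denotes the additive subgroup generated by all $x\wedge y$, $x\in X$, $y\in Y$. *)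

(* Defs.v *)
(* Concrete model of the Kähler differential forms Omega^n(F)
   of a field F as a free F-module on symbols [a_1;...;a_n] (= da_1/\.../\da_n)
   modulo the relations (additivity, Leibniz rule in each slot, alternation). *)
From HB Require Import structures.
From mathcomp Require Import all_boot all_order all_algebra.
Set Implicit Arguments. Unset Strict Implicit. Unset Printing Implicit Defensive.
Import Order.TTheory GRing.Theory Num.Theory.
Local Open Scope ring_scope.

(* A formal (representative of a) differential o_form: a finite list of
   terms (x, [a_1;...;a_n]) standing for x da_1 /\ ... /\ da_n. *)
Definition o_form (F : fieldType) := seq (F * seq F).

Definition o_hom {F : fieldType} (n : nat) (w : o_form F) : bool :=
  all (fun u => size u.2 == n) w.

Definition o_fcoef {F : fieldType} (w : o_form F) (t : seq F) : F :=
  \sum_(u <- w) (if u.2 == t then u.1 else 0).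

Definition o_fscale {F : fieldType} (c : F) (w : o_form F) : o_form F :=
  [seq (c * u.1, u.2) | u <- w].
Definition o_fneg {F : fieldType} (w : o_form F) : o_form F := o_fscale (-1) w.
Definition o_fwedge {F : fieldType} (w1 w2 : o_form F) : o_form F :=
  [seq (u.1 * v.1, u.2 ++ v.2) | u <- w1, v <- w2].
Definition o_fd {F : fieldType} (w : o_form F) : o_form F :=
  [seq (1, u.1 :: u.2) | u <- w].

Inductive o_relgen {F : fieldType} : o_form F -> Prop :=
| relgen_add (l r : seq F) (a b : F) :
    o_relgen [:: (1, l ++ (a + b) :: r); (-1, l ++ a :: r); (-1, l ++ b :: r)]
| relgen_mul (l r : seq F) (a b : F) :
    o_relgen [:: (1, l ++ (a * b) :: r); (-a, l ++ b :: r); (-b, l ++ a :: r)]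
| relgen_alt (l m r : seq F) (a : F) :
    o_relgen [:: (1, l ++ a :: m ++ a :: r)].

Definition o_ozero {F : fieldType} (w : o_form F) : Prop :=
  exists cs : seq (F * o_form F), (forall c, c \in cs -> o_relgen c.2) /\
    forall t, o_fcoef w t = \sum_(c <- cs) c.1 * o_fcoef c.2 t.

Definition o_oeq {F : fieldType} (w1 w2 : o_form F) : Prop := o_ozero (w1 ++ o_fneg w2).

Definition o_dlogf {F : fieldType} (x : F) (a : seq F) : o_form F :=
  [:: (x / \prod_(ai <- a) ai, a)].

(* w lies in d Omega^{n-1}(F)  (which is 0 for n = 0) *)
Definition o_exactf {F : fieldType} (n : nat) (w : o_form F) : Prop :=
  o_ozero w \/ exists (m : nat) (v : o_form F), n = m.+1 /\ o_hom m v /\ o_oeq w (o_fd v).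

(* nu_n(F) = ker wp, where wp (x dlog a_1../\..dlog a_n)
   = (x^p - x) dlog a_1 ... mod d Omega^{n-1}(F) *)
Definition o_nu {F : fieldType} (p n : nat) (w : o_form F) : Prop :=
  o_hom n w /\
  exists xs : seq (F * seq F),
    (forall u, u \in xs -> (size u.2 == n) && all (fun a => a != 0) u.2) /\
    o_oeq w (flatten [seq o_dlogf u.1 u.2 | u <- xs]) /\
    o_exactf n (flatten [seq o_dlogf (u.1 ^+ p - u.1) u.2 | u <- xs]).

Definition o_nuZ {F : fieldType} (p : nat) (m : int) (w : o_form F) : Prop :=
  match m with
  | Posz k => o_nu p k w
  | Negz _ => w = [::]
  end.

Definition o_addgen {F : fieldType} (P : o_form F -> Prop) (w : o_form F) : Prop :=
  exists us : seq (bool * o_form F), (forall u, u \in us -> P u.2) /\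
    o_oeq w (flatten [seq if u.1 then o_fneg u.2 else u.2 | u <- us]).

Definition o_wedgeS {F : fieldType} (X Y : o_form F -> Prop) : o_form F -> Prop :=
  o_addgen (fun w => exists x y, X x /\ Y y /\ w = o_fwedge x y).

Definition o_annnu {F : fieldType} (p n : nat) (U : o_form F -> Prop) (w : o_form F)
  : Prop := o_nu p n w /\ forall u, U u -> o_ozero (o_fwedge w u).

Definition o_is_subfield {F : fieldType} (K : F -> Prop) : Prop :=
  K 0 /\ K 1 /\ (forall x y, K x -> K y -> K (x + y)) /\ (forall x, K x -> K (- x))
  /\ (forall x y, K x -> K y -> K (x * y)) /\ (forall x, K x -> x != 0 -> K x^-1).

Definition o_genfield {F : fieldType} (K C : F -> Prop) (x : F) : Prop :=
  forall L, o_is_subfield L -> (forall y, K y -> L y) -> (forall c, C c -> L c) -> L x.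

Definition o_Fpow {F : fieldType} (p : nat) (x : F) : Prop := exists y, x = y ^+ p.

Definition o_FpC {F : fieldType} (p : nat) (C : F -> Prop) : F -> Prop :=
  o_genfield (o_Fpow p) C.

Definition o_degFp {F : fieldType} (p : nat) (L : F -> Prop) (m : nat) : Prop :=
  exists b : seq F, size b = m /\ (forall x, x \in b -> L x) /\
    (forall cs : seq F, size cs = m -> (forall c, c \in cs -> o_Fpow p c) ->
       \sum_(i < m) cs`_i * b`_i = 0 -> forall i, (i < m)%N -> cs`_i = 0) /\
    (forall x, L x -> exists cs : seq F, size cs = m /\
       (forall c, c \in cs -> o_Fpow p c) /\ x = \sum_(i < m) cs`_i * b`_i).

Definition o_pdeg {F : fieldType} (p : nat) (C : F -> Prop) (k : nat) : Prop :=
  o_degFp p (o_FpC p C) (p ^ k)%N.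

Definition o_pindep {F : fieldType} (p : nat) (A : F -> Prop) : Prop :=
  forall s : seq F, uniq s -> (forall x, x \in s -> A x) ->
    o_degFp p (o_FpC p (fun x => x \in s)) (p ^ size s)%N.

(* Main.v *)
(** Fix finitely many elements of F containing all those involved in a given form of
nu_n(F), together with a finite p-independent sequence b_1, .., b_N, starting with the
prescribed p-basis, such that they lie in F^p(b_1, .., b_N). The derivations D_i with
D_i(b_j) = delta_ij b_j (extended to F by Zorn's lemma) give coordinates x_A with respect
to the forms dlog b_A. Membership in nu_n says that x_A^p is the weight-zero part of x_A
and that the form is closed; membership in the annihilator restricts the sets A that
occur. Let A = (i_1 < .. < i_n) be a set of maximal weight with x_A <> 0. Closedness
constrains D_j(x_A) for j outside A, and this makes x_A factor, up to an element of the
prime field, as the product of the D_{i_k}(y_k) / y_k with y_k in F^p(b_1, .., b_{i_k}):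
one splits off the largest index, the remaining factor z being determined by
z^(p-1) = x_A^p / x' for the part x' of x_A of weight zero at that index (this is where
F^(p-1) = F is used), and Jacobson's formula shows that x_A / z is a logarithmic
derivative. Subtracting dlog y_1 /\ .. /\ dlog y_n only affects smaller sets, and one
concludes by induction (Kato's filtration argument). *)
Require Import Defs.
From HB Require Import structures.
From mathcomp Require Import boolp classical_sets.
From mathcomp Require Import all_boot all_order all_algebra all_fingroup.
From mathcomp Require Import ring zify.
Set Implicit Arguments. Unset Strict Implicit. Unset Printing Implicit Defensive.
Import Order.TTheory GRing.Theory Num.Theory.
Local Open Scope ring_scope.

(** * Subfields containing F^p and derivations *)

Section FrobeniusSubfields.

Variables (F : fieldType) (p : nat).
Hypothesis pF : p \in [pchar F].

(** A form is a list modulo relations, so neither a quotient space nor a basis is given at the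
    outset. Everything is tested by duality: a form is zero iff every alternating multiderivation
    ([amd]) vanishes on it, and the determinants [dmx] of the dual derivations serve as coordinate
    functionals. Identities of forms thereby become identities in F.

    The delicate point is that subtracting a leading term creates new nonzero coordinates, which
    must again satisfy the restriction imposed by the annihilator. The restriction is therefore
    phrased as a count: at least k indices of A lie below M. Since y_k only involves b_1, ..,
    b_{i_k}, the coordinates of dlog y_1 /\ .. /\ dlog y_n live on sets obtained by lowering the
    indices of A, and lowering can only increase such a count. This is also why the prescribed
    p-basis comes first in the ordering. The count finally puts the first k factors of every product
    split off into F^p(b_1, .., b_M), which is the shape of the right-hand side.

    The derivations are only known to commute and to be diagonalizable on F^p(b), hence the constant
    bookkeeping of membership in [adjoin p b]. *)

Definition adjoin (b : seq F) : F -> Prop := o_FpC p (fun y => y \in b).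

Lemma p_prime : prime p. Proof. exact: pcharf_prime pF. Qed.

Lemma p_gt0 : (0 < p)%N. Proof. exact: prime_gt0 p_prime. Qed.

Lemma expp_add (x y : F) : (x + y) ^+ p = x ^+ p + y ^+ p.
Proof. by rewrite exprDn_pchar // pnatE ?p_prime. Qed.

Lemma expp_opp (x : F) : (- x) ^+ p = - x ^+ p.
Proof. by rewrite exprNn_pchar // pnatE ?p_prime. Qed.

Lemma expp_sum (I : Type) (r : seq I) (P : pred I) (f : I -> F) :
  (\sum_(i <- r | P i) f i) ^+ p = \sum_(i <- r | P i) f i ^+ p.
Proof.
elim/big_rec2: _ => [|i x y _ <-]; first by rewrite expr0n gtn_eqF ?p_gt0.
by rewrite expp_add.
Qed.

Lemma expp_sub (x y : F) : (x - y) ^+ p = x ^+ p - y ^+ p.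
Proof. by rewrite expp_add expp_opp. Qed.

Lemma expp_inj (x y : F) : x ^+ p = y ^+ p -> x = y.
Proof.
move=> e; have : (x - y) ^+ p == 0 by rewrite expp_sub e subrr.
by rewrite expf_eq0 p_gt0 subr_eq0 => /eqP.
Qed.

Lemma expp_nat n : (n%:R : F) ^+ p = n%:R.
Proof.
elim: n => [|n IH]; first by rewrite expr0n gtn_eqF ?p_gt0.
by rewrite -natr1 expp_add IH expr1n.
Qed.

Lemma expp_int (z : int) : (z%:~R : F) ^+ p = z%:~R.
Proof. by case: z => n; rewrite ?NegzE ?mulrNz ?expp_opp -pmulrn expp_nat. Qed.

Lemma genfield_subfield (K C : F -> Prop) : o_is_subfield (o_genfield K C).
Proof.
do !split.
- by move=> L [L0 _] _ _.
- by move=> L [_ [L1 _]] _ _.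
- move=> x y hx hy L LF KL CL; case: (LF) => _ [_ [h _]].
  by apply: h; [apply: hx|apply: hy].
- move=> x hx L LF KL CL; case: (LF) => _ [_ [_ [h _]]].
  by apply: h; apply: hx.
- move=> x y hx hy L LF KL CL; case: (LF) => _ [_ [_ [_ [h _]]]].
  by apply: h; [apply: hx|apply: hy].
- move=> x hx x0 L LF KL CL; case: (LF) => _ [_ [_ [_ [_ h]]]].
  by apply: h => //; apply: hx.
Qed.

Section Closure.
Variable L : F -> Prop.
Hypothesis LF : o_is_subfield L.

Lemma subfield0 : L 0. Proof. by case: LF. Qed.
Lemma subfield1 : L 1. Proof. by case: LF => _ []. Qed.
Lemma subfieldD x y : L x -> L y -> L (x + y).
Proof. by case: LF => _ [_ [h _]]; exact: h. Qed.
Lemma subfieldN x : L x -> L (- x).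
Proof. by case: LF => _ [_ [_ [h _]]]; exact: h. Qed.
Lemma subfieldB x y : L x -> L y -> L (x - y).
Proof. by move=> hx hy; apply: subfieldD => //; apply: subfieldN. Qed.
Lemma subfieldM x y : L x -> L y -> L (x * y).
Proof. by case: LF => _ [_ [_ [_ [h _]]]]; exact: h. Qed.
Lemma subfieldV x : L x -> L x^-1.
Proof.
case: LF => _ [_ [_ [_ [_ h]]]].
by have [-> |/eqP x0 /h] := eqVneq x 0; [rewrite invr0 | apply; exact/eqP].
Qed.
Lemma subfieldX x n : L x -> L (x ^+ n).
Proof.
move=> hx; elim: n => [|n IH]; first exact: subfield1.
by rewrite exprS; apply: subfieldM.
Qed.
Lemma subfield_sum (I : Type) (r : seq I) (P : pred I) (f : I -> F) :
  (forall i, P i -> L (f i)) -> L (\sum_(i <- r | P i) f i).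
Proof. by move=> h; elim/big_ind: _ => //; [exact: subfield0|exact: subfieldD]. Qed.
Lemma subfield_prod (I : Type) (r : seq I) (P : pred I) (f : I -> F) :
  (forall i, P i -> L (f i)) -> L (\prod_(i <- r | P i) f i).
Proof. by move=> h; elim/big_ind: _ => //; [exact: subfield1|exact: subfieldM]. Qed.
Lemma subfield_prod_seq (r : seq F) : (forall x, x \in r -> L x) -> L (\prod_(x <- r) x).
Proof.
move=> h; rewrite big_seq_cond; apply: subfield_prod => x /andP[xr _]; exact: h.
Qed.
Lemma subfield_nat n : L n%:R.
Proof.
elim: n => [|n IH]; first exact: subfield0.
by rewrite -natr1; apply: subfieldD => //; exact: subfield1.
Qed.
Lemma subfield_int (z : int) : L z%:~R.
Proof.
case: z => n; first by rewrite -pmulrn; exact: subfield_nat.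
by rewrite NegzE mulrNz -pmulrn; apply: subfieldN; exact: subfield_nat.
Qed.
End Closure.

Lemma FpC_subfield (C : F -> Prop) : o_is_subfield (o_FpC p C).
Proof. exact: genfield_subfield. Qed.

Lemma genfield_base (K C : F -> Prop) y : K y -> o_genfield K C y.
Proof. by move=> Ky L _ KL _; exact: KL. Qed.

Lemma genfield_gen (K C : F -> Prop) y : C y -> o_genfield K C y.
Proof. by move=> Cy L _ _; apply. Qed.

Lemma FpC_pow (C : F -> Prop) y : o_FpC p C (y ^+ p).
Proof. by apply: genfield_base; exists y. Qed.

Lemma FpC_gen (C : F -> Prop) y : C y -> o_FpC p C y.
Proof. exact: genfield_gen. Qed.

(* Inverses come for free because 1/x = x^(p-1) * (1/x)^p. *)
Lemma genfield_ind (K C P : F -> Prop) :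
  (forall y, P (y ^+ p)) -> (forall y, K y -> P y) -> (forall y, C y -> P y) ->
  (forall x y, P x -> P y -> P (x + y)) ->
  (forall x y, P x -> P y -> P (x * y)) ->
  forall x, o_genfield K C x -> P x.
Proof.
move=> Pp PK PC PD PM x; apply => //.
have P0 : P 0 by have := Pp 0; rewrite expr0n gtn_eqF ?p_gt0.
have P1 : P 1 by have := Pp 1; rewrite expr1n.
have PX y n : P y -> P (y ^+ n).
  by move=> Py; elim: n => // n IH; rewrite exprS; apply: PM.
do !split => //.
  move=> y Py; rewrite -[- y]mulN1r; apply: PM => //.
  by have := Pp (-1); rewrite expp_opp expr1n.
move=> y Py y0; have -> : y^-1 = y ^+ p.-1 * y^-1 ^+ p.
  rewrite -{2}(prednK p_gt0) exprS mulrCA -exprMn_comm ?mulfV // ?expr1n ?mulr1 //.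
  exact: mulrC.
by apply: PM => //; apply: PX.
Qed.

Lemma FpC_ind (C P : F -> Prop) :
  (forall y, P (y ^+ p)) -> (forall y, C y -> P y) ->
  (forall x y, P x -> P y -> P (x + y)) ->
  (forall x y, P x -> P y -> P (x * y)) ->
  forall x, o_FpC p C x -> P x.
Proof.
by move=> Pp PC PD PM x; apply: genfield_ind => // y [z ->].
Qed.

Lemma FpC_min (C L : F -> Prop) : o_is_subfield L -> (forall y, L (y ^+ p)) ->
  (forall y, C y -> L y) -> forall x, o_FpC p C x -> L x.
Proof. by move=> LF Lp CL x; apply => // _ [y ->]. Qed.

Lemma FpC_sub (C C' : F -> Prop) : (forall y, C y -> o_FpC p C' y) ->
  forall x, o_FpC p C x -> o_FpC p C' x.
Proof. by move=> h; apply: FpC_min => //; [exact: FpC_subfield|exact: FpC_pow]. Qed.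

Lemma adjoin_sub (b b' : seq F) : {subset b <= b'} ->
  forall x, adjoin b x -> adjoin b' x.
Proof. by move=> h; apply: FpC_sub => y /h; exact: FpC_gen. Qed.

Lemma adjoin_mem (b : seq F) x : x \in b -> adjoin b x.
Proof. exact: FpC_gen. Qed.

Lemma adjoin_subfield b : o_is_subfield (adjoin b).
Proof. exact: FpC_subfield. Qed.

Definition der (d : F -> F) :=
  (forall x y, d (x + y) = d x + d y) /\ (forall x y, d (x * y) = x * d y + y * d x).

Section Derivations.
Variable d : F -> F.
Hypothesis dd : der d.

Lemma derD x y : d (x + y) = d x + d y. Proof. by case: dd. Qed.
Lemma derM x y : d (x * y) = x * d y + y * d x. Proof. by case: dd. Qed.
Lemma der0 : d 0 = 0.
Proof. by apply: (@addrI _ (d 0)); rewrite -derD !addr0. Qed.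
Lemma der1 : d 1 = 0.
Proof. by apply: (@addrI _ (d 1)); rewrite -{3}[1]mulr1 derM !mul1r addr0. Qed.
Lemma derN x : d (- x) = - d x.
Proof. by apply: (@addrI _ (d x)); rewrite -derD !subrr der0. Qed.
Lemma derB x y : d (x - y) = d x - d y. Proof. by rewrite derD derN. Qed.
Lemma der_sum (I : Type) (r : seq I) (P : pred I) (f : I -> F) :
  d (\sum_(i <- r | P i) f i) = \sum_(i <- r | P i) d (f i).
Proof. by apply: (big_morph d); [exact: derD|exact: der0]. Qed.
Lemma derX x n : d (x ^+ n) = n%:R * x ^+ n.-1 * d x.
Proof.
elim: n => [|n IH]; first by rewrite expr0 der1 !mul0r.
rewrite exprS derM IH -natr1; case: n {IH} => [|n]; first by rewrite /= expr0; ring.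
by rewrite /= exprS; ring.
Qed.
Lemma derp x : d (x ^+ p) = 0.
Proof. by rewrite derX (pcharf0 pF) !mul0r. Qed.
Lemma der_pM c x : d (c ^+ p * x) = c ^+ p * d x.
Proof. by rewrite derM derp mulr0 addr0. Qed.
Lemma derMc x y : d x = 0 -> d (x * y) = x * d y.
Proof. by move=> h; rewrite derM h mulr0 addr0. Qed.
Lemma derV x : d (x^-1) = - d x / x ^+ 2.
Proof.
have [->|x0] := eqVneq x 0; first by rewrite invr0 der0 oppr0 mul0r.
apply: (mulfI x0); have := derM x x^-1; rewrite mulfV // der1.
move/eqP; rewrite eq_sym addr_eq0 => /eqP ->; by field.
Qed.
Lemma der_nat n : d n%:R = 0.
Proof. by elim: n => [|n IH]; rewrite ?der0 // -natr1 derD IH der1 addr0. Qed.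
Lemma der_int (z : int) : d z%:~R = 0.
Proof.
by case: z => n; rewrite ?NegzE ?mulrNz -pmulrn ?derN der_nat ?oppr0.
Qed.
Lemma der_prod_eq0 (I : Type) (r : seq I) (P : pred I) (f : I -> F) :
  (forall i, P i -> d (f i) = 0) -> d (\prod_(i <- r | P i) f i) = 0.
Proof.
move=> h; elim/big_ind: _ => //; first exact: der1.
by move=> x y hx hy; rewrite derM hx hy !mulr0 addr0.
Qed.
Lemma der_prodV_seq (r : seq F) :
  (forall x, x \in r -> d x = 0) -> d (\prod_(x <- r) x)^-1 = 0.
Proof.
move=> h; rewrite derV big_seq_cond der_prod_eq0 ?oppr0 ?mul0r // => x /andP[xr _].
exact: h.
Qed.
Lemma der_stable (C : F -> Prop) : (forall y, C y -> o_FpC p C (d y)) ->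
  forall x, o_FpC p C x -> o_FpC p C (d x).
Proof.
move=> h; pose P x := o_FpC p C x /\ o_FpC p C (d x).
have FC := FpC_subfield C.
suff hP x : o_FpC p C x -> P x by move=> x /hP [].
apply: FpC_ind => {x}.
- by move=> y; split; [exact: FpC_pow|rewrite derp; exact: (subfield0 FC)].
- by move=> y Cy; split; [exact: FpC_gen|exact: h].
- move=> x y [x1 x2] [y1 y2]; split; first exact: (subfieldD FC).
  by rewrite derD; apply: (subfieldD FC).
- move=> x y [x1 x2] [y1 y2]; split; first exact: (subfieldM FC).
  by rewrite derM; apply: (subfieldD FC); apply: (subfieldM FC).
Qed.
End Derivations.

Lemma der_eq_on (C : F -> Prop) (d1 d2 : F -> F) : der d1 -> der d2 ->
  (forall y, C y -> d1 y = d2 y) -> forall x, o_FpC p C x -> d1 x = d2 x.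
Proof.
move=> h1 h2 hC; apply: FpC_ind => [y|//|x y ex ey|x y ex ey].
- by rewrite (derp h1) (derp h2).
- by rewrite (derD h1) (derD h2) ex ey.
- by rewrite (derM h1) (derM h2) ex ey.
Qed.

Lemma der_eq0_on (C : F -> Prop) (d : F -> F) : der d ->
  (forall y, C y -> d y = 0) -> forall x, o_FpC p C x -> d x = 0.
Proof.
move=> h hC; apply: FpC_ind => [y|//|x y ex ey|x y ex ey].
- exact: derp.
- by rewrite (derD h) ex ey addr0.
- by rewrite (derM h) ex ey !mulr0 addr0.
Qed.

(** In terms of forms, dx = u da with one factor u for all derivations. This is how the sets of
    p-degree 1 enter part (a). *)
Lemma adjoin1_der (a x : F) : o_FpC p (fun y => y = a) x ->
  exists u, forall d, der d -> d x = u * d a.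
Proof.
move: x; apply: FpC_ind => [y|_ ->|x y [u hu] [v hv]|x y [u hu] [v hv]].
- by exists 0 => d dd; rewrite (derp dd) mul0r.
- by exists 1 => d dd; rewrite mul1r.
- by exists (u + v) => d dd; rewrite (derD dd) hu // hv // mulrDl.
- by exists (x * v + y * u) => d dd; rewrite (derM dd) hu // hv //; ring.
Qed.

End FrobeniusSubfields.

(** * Extending derivations along purely inseparable extensions *)

Section ExtensionOfDerivations.

Variables (F : fieldType) (p : nat).
Hypothesis pF : p \in [pchar F].

Let pgt0 := p_gt0 pF.

(** The subfield L is a predicate, so the long division is redone in order to keep track of the
    coefficients of the remainder. *)
Lemma monic_division (L : F -> Prop) (c f : {poly F}) : o_is_subfield L ->
  c \is monic -> (forall i, L c`_i) -> (forall i, L f`_i) ->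
  exists q r : {poly F}, [/\ f = q * c + r, forall i, L r`_i & (size r < size c)%N].
Proof.
move=> LF cm Lc; move: {2}(size f).+1 (ltnSn (size f)) => n.
elim: n f => // n IH f fn Lf.
have [fc|cf] := ltnP (size f) (size c); first by exists 0, f; rewrite mul0r add0r.
pose k := (size f - size c)%N; pose f1 := f - lead_coef f *: 'X^k * c.
have Lf1 i : L f1`_i.
  rewrite coefB -scalerAl coefZ coefXnM; apply: (subfieldB LF) => //.
  apply: (subfieldM LF); first exact: Lf.
  by case: ifP => _; [exact: subfield0 LF|exact: Lc].
have c0 : (0 < size c)%N by rewrite size_poly_gt0 monic_neq0.
have sf1 : (size f1 < size f)%N.
  rewrite -(prednK (leq_trans c0 cf)) ltnS; apply/leq_sizeP => j jf.
  rewrite coefB -scalerAl coefZ coefXnM.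
  have [ej|nej] := eqVneq j (size f).-1.
    have /negbTE -> : ~~ (j < k)%N by rewrite /k; lia.
    have -> : (j - k = (size c).-1)%N by rewrite /k; lia.
    by rewrite -[c`__]/(lead_coef c) (monicP cm) mulr1 ej subrr.
  have fj : (size f <= j)%N by rewrite -(prednK (leq_trans c0 cf)) ltn_neqAle eq_sym nej.
  have cj : (size c <= j - k)%N by rewrite /k; move: fj cf; clear; lia.
  by rewrite (nth_default _ fj) (nth_default _ cj) if_same mulr0 subrr.
have [|q [r [e Lr sr]]] := IH f1 _ Lf1; first by lia.
by exists (q + lead_coef f *: 'X^k), r; split=> //; rewrite mulrDl addrAC -e subrK.
Qed.

(* The minimal polynomial of x divides ('X - x)^p; its derivative also vanishes
   at x unless it is 'X - x itself. *)
Lemma insep_size (L : F -> Prop) (x : F) (c : {poly F}) : o_is_subfield L ->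
  (forall y, L (y ^+ p)) -> ~ L x ->
  (forall i, L c`_i) -> c.[x] = 0 -> c != 0 -> (p < size c)%N.
Proof.
move=> LF Lp Lx; move: {2}(size c) (leqnn (size c)) => n.
elim/ltn_ind: n c => n IH c cn Lc cx c0; rewrite ltnNge; apply/negP => cp.
have cl0 : lead_coef c != 0 by rewrite lead_coef_eq0.
pose c1 := (lead_coef c)^-1 *: c.
have c1m : c1 \is monic by rewrite monicE lead_coefZ mulVf.
have Lc1 i : L c1`_i.
  by rewrite coefZ; apply: (subfieldM LF) => //; apply: (subfieldV LF); apply: Lc.
have sc1 : size c1 = size c by rewrite size_scale ?invr_eq0.
have c1x : c1.[x] = 0 by rewrite hornerZ cx mulr0.
have IHc (f : {poly F}) : (size f < size c)%N -> (forall i, L f`_i) -> f.[x] = 0 -> f = 0.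
  move=> fc Lf fx; apply/eqP/negP => /negP f0.
  by have := IH _ (leq_trans fc cn) f (leqnn _) Lf fx f0; lia.
have pFp : p \in [pchar {poly F}] by rewrite pchar_poly.
pose f : {poly F} := 'X^p - (x ^+ p)%:P.
have fE : f = ('X - x%:P) ^+ p.
  by rewrite /f exprDn_pchar ?pnatE ?(p_prime pF) // exprNn_pchar ?pnatE ?(p_prime pF) // polyC_exp.
have Lf i : L f`_i.
  rewrite /f coefB coefXn coefC; apply: (subfieldB LF); first exact: (subfield_nat LF).
  by case: ifP => _; [exact: Lp|exact: subfield0 LF].
have [q [r [e Lr sr]]] := monic_division LF c1m Lc1 Lf.
have r0 : r = 0.
  apply: IHc => //; first by rewrite -sc1.
  have := congr1 (fun g => g.[x]) e; rewrite /= [X in _ = X]hornerD hornerM c1x mulr0 add0r => <-.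
  by rewrite /f hornerD hornerN hornerXn hornerC subrr.
have : c1 %| ('X - x%:P) ^+ p by rewrite -fE e r0 addr0 dvdp_mulIr.
case/dvdp_exp_XsubCP => d dp; rewrite eqp_monic ?monic_exp ?monicXsubC // => /eqP h.
have sd : size c1 = d.+1 by rewrite h size_exp_XsubC.
case: d => [|[|d]] in dp h sd *.
- by move: c1x; rewrite h hornerC => /eqP; rewrite oner_eq0.
- apply: Lx; rewrite -[x]opprK; apply: (subfieldN LF).
  by have := Lc1 0%N; rewrite h expr1 coefB coefX coefC /= sub0r.
have c1' : c1^`() = ('X - x%:P) ^+ d.+1 *+ d.+2.
  by rewrite h deriv_exp derivXsubC mul1r.
have : c1^`() = 0.
  apply: IHc; first by rewrite -sc1; apply: lt_size_deriv; rewrite monic_neq0.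
    move=> i; rewrite coef_deriv -mulr_natr.
    by apply: (subfieldM LF) => //; exact: (subfield_nat LF).
  by rewrite c1' hornerMn horner_exp hornerXsubC subrr expr0n mul0rn.
rewrite c1' -scaler_nat => /eqP; rewrite scaler_eq0 expf_eq0 /= polyXsubC_eq0 orbF.
rewrite -(dvdn_pcharf pF) => /dvdn_leq -/(_ isT); lia.
Qed.

(** A derivation on a subfield containing F^p, given by its graph so that chains have unions.
    Single-valuedness is imposed at 0 only; additivity spreads it to all arguments. *)
Definition pder (G : F -> F -> Prop) :=
  [/\ forall a, G 0 a -> a = 0,
      forall x y a b, G x a -> G y b -> G (x + y) (a + b),
      forall x y a b, G x a -> G y b -> G (x * y) (x * b + y * a) &
      forall c, G (c ^+ p) 0].

Section PartialDerivation.
Variable G : F -> F -> Prop.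
Hypothesis Gd : pder G.

Lemma pder0 : G 0 0.
Proof. by case: Gd => _ _ _ /(_ 0); rewrite expr0n gtn_eqF. Qed.
Lemma pderD x y a b : G x a -> G y b -> G (x + y) (a + b).
Proof. by case: Gd => _ h _ _; exact: h. Qed.
Lemma pderM x y a b : G x a -> G y b -> G (x * y) (x * b + y * a).
Proof. by case: Gd => _ _ h _; exact: h. Qed.
Lemma pderp c : G (c ^+ p) 0.
Proof. by case: Gd. Qed.
Lemma pderN x a : G x a -> G (- x) (- a).
Proof.
move=> h; have := pderM (pderp (-1)) h.
by rewrite expp_opp // expr1n mulr0 addr0 !mulN1r.
Qed.
Lemma pderB x y a b : G x a -> G y b -> G (x - y) (a - b).
Proof. by move=> hx hy; apply: pderD => //; exact: pderN. Qed.
Lemma pder_fun x a b : G x a -> G x b -> a = b.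
Proof.
move=> ha hb; apply/eqP; rewrite -subr_eq0; apply/eqP.
by case: Gd => h _ _ _; apply: h; have := pderB ha hb; rewrite subrr.
Qed.
Lemma pder_sum (I : Type) (r : seq I) (f g : I -> F) :
  (forall i, G (f i) (g i)) -> G (\sum_(i <- r) f i) (\sum_(i <- r) g i).
Proof. by move=> h; elim/big_rec2: _ => [|i x y _]; [exact: pder0|exact: pderD]. Qed.
Lemma pder_dom : o_is_subfield (fun x => exists a, G x a).
Proof.
have D x y : (exists a, G x a) -> (exists a, G y a) -> exists a, G (x + y) a.
  by move=> [a ha] [b hb]; exists (a + b); exact: pderD.
have M x y : (exists a, G x a) -> (exists a, G y a) -> exists a, G (x * y) a.
  by move=> [a ha] [b hb]; exists (x * b + y * a); exact: pderM.
have P c : exists a, G (c ^+ p) a by exists 0; exact: pderp.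
(* The field generated by the domain is no larger than the domain, by [genfield_ind]; this is where
   closure under inverses comes from. *)
have h : forall x, o_genfield (fun x => exists a, G x a) (fun=> False) x ->
  exists a, G x a by apply: (genfield_ind pF).
have LF := genfield_subfield (fun x => exists a, G x a) (fun=> False).
have b x : (exists a, G x a) -> o_genfield (fun x => exists a, G x a) (fun=> False) x.
  exact: genfield_base.
split; first by apply: h; exact: (subfield0 LF).
split; first by apply: h; exact: (subfield1 LF).
split=> //; split; first by move=> x /b hx; apply: h; exact: (subfieldN LF).
by split=> // x /b hx _; apply: h; exact: (subfieldV LF).
Qed.

(** The extension sends c(x) to c^d(x) + c'(x) y, where c^d is c with its coefficients derived. The
    only relation to respect is that x^p lies in the domain, and both sides of it have derivative 0,
    so y is arbitrary. The last clause bounds the new domain, so that later elements can still be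
    adjoined. *)
Lemma pder_ext (x y : F) : ~ (exists a, G x a) ->
  exists G' : F -> F -> Prop,
    [/\ pder G', forall u a, G u a -> G' u a, G' x y &
        forall M : F -> Prop, o_is_subfield M -> (forall u a, G u a -> M u) -> M x ->
        forall u a, G' u a -> M u].
Proof.
move=> xG; pose T (c e : {poly F}) := forall i, G c`_i e`_i.
have TB c e c' e' : T c e -> T c' e' -> T (c - c') (e - e').
  by move=> h h' i; rewrite !coefB; exact: pderB.
have TD c e c' e' : T c e -> T c' e' -> T (c + c') (e + e').
  by move=> h h' i; rewrite !coefD; exact: pderD.
have T0 c e : T c e -> c.[x] = 0 -> e.[x] + c^`().[x] * y = 0.
  move: {2}(size c).+1 (ltnSn (size c)) => n; elim: n c e => // n IH c e cn ce cx.
  have [c0|c0] := eqVneq c 0.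
    have -> : e = 0.
      apply/polyP => i; have := ce i; rewrite c0 !coef0.
      by case: Gd => h _ _ _; exact: h.
    by rewrite c0 deriv0 !horner0 mul0r addr0.
  have pc : (p < size c)%N.
    apply: (insep_size pder_dom _ xG) => // [z|i]; first by exists 0; exact: pderp.
    by exists e`_i.
  pose k := (size c - p.+1)%N; pose l := (size c).-1.
  (* A multiple of X^p - x^p with leading term a X^(k+p), that of c when a is its leading
     coefficient. It vanishes at x together with its derivative, so subtracting it lowers the size
     of c without changing the value to be shown zero. *)
  pose s (a : F) : {poly F} := a *: 'X^(k + p) - (a * x ^+ p) *: 'X^k.
  have sT : T (s c`_l) (s e`_l).
    apply: (TB) => i; rewrite !coefZ !coefXn; case: eqP => _; rewrite ?mulr1 ?mulr0;
      try exact: pder0; first exact: ce.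
    by have := pderM (ce l) (pderp x); rewrite mulr0 add0r mulrC [_ * e`_l]mulrC.
  have sx a : (s a).[x] = 0.
    by rewrite /s hornerD hornerN !hornerZ !hornerXn exprD; ring.
  have s'x : (s c`_l)^`().[x] = 0.
    rewrite /s derivB !derivZ !derivXn hornerD hornerN !hornerZ !hornerMn !hornerXn.
    rewrite mulrnDr (mulrn_pchar pF) addr0.
    have [->|k0] := posnP k; first by rewrite !mulr0n !mulr0 subr0.
    have -> : (k + p).-1 = (k.-1 + p)%N by lia.
    by rewrite exprD; ring.
  have sz : (size (c - s c`_l)%R < size c)%N.
    rewrite -(prednK (leq_ltn_trans (leq0n p) pc)) ltnS; apply/leq_sizeP => j jc.
    rewrite coefB /s coefB !coefZ !coefXn.
    have -> : (j == k) = false by rewrite /k; lia.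
    have [ej|nej] := eqVneq j (k + p)%N.
      have -> : l = j by rewrite /l ej /k; lia.
      by rewrite mulr1 mulr0 subr0 subrr.
    have cj : (size c <= j)%N by move: jc pc nej; rewrite /k; clear; lia.
    by rewrite (nth_default _ cj) !mulr0 !subr0.
  have := IH _ _ _ (TB _ _ _ _ ce sT).
  rewrite derivB !hornerD !hornerN !sx s'x !subr0; apply=> //; first by lia.
exists (fun u a => exists c e, [/\ T c e, u = c.[x] & a = e.[x] + c^`().[x] * y]); split.
- split.
  + by move=> a [c [e [ce c0 ->]]]; apply: T0.
  + move=> u v a b [c [e [ce -> ->]]] [c' [e' [ce' -> ->]]].
    by exists (c + c'), (e + e'); split; [exact: TD|rewrite hornerD|rewrite derivD !hornerD; ring].
  + move=> u v a b [c [e [ce -> ->]]] [c' [e' [ce' -> ->]]].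
    exists (c * c'), (c * e' + e * c'); split.
    * move=> i; rewrite coefD !coefM -big_split /=.
      apply: pder_sum => j; rewrite [e`__ * _]mulrC; exact: pderM.
    * by rewrite hornerM.
    * by rewrite derivM !(hornerM, hornerD); ring.
  + move=> c; exists (c ^+ p)%:P, 0; split; last by rewrite derivC !horner0 mul0r addr0.
      by move=> i; rewrite coefC coef0; case: ifP => _; [exact: pderp|exact: pder0].
    by rewrite hornerC.
- move=> u a ua; exists u%:P, a%:P; split; last by rewrite derivC !hornerC mul0r addr0.
    by move=> i; rewrite !coefC; case: ifP => // _; exact: pder0.
  by rewrite hornerC.
- exists 'X, 0; split; last by rewrite derivX horner0 hornerC mul1r add0r.
    move=> i; rewrite coefX coef0; case: (i == 1)%N; last exact: pder0.
    by have := pderp 1; rewrite expr1n.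
  by rewrite hornerX.
- move=> M MF GM Mx u a [c [e [ce -> _]]]; rewrite horner_coef.
  apply: (subfield_sum MF) => i _; apply: (subfieldM MF); last exact: (subfieldX MF).
  exact: GM (ce i).
Qed.

End PartialDerivation.

Lemma pder_total (G : F -> F -> Prop) : pder G ->
  exists d, der d /\ forall x a, G x a -> d x = a.
Proof.
(* Joining G to every member of the chain handles the empty chain, whose union then stands for G
   itself. *)
move=> Gd; pose U (A : set (F * F)) x a := G x a \/ A (x, a).
pose P (A : set (F * F)) := pder (U A).
have [|A [PA Amax]] := @Zorn_bigcup _ P.
  move=> C CP Ct; pose W := (\bigcup_(X in C) X)%classic.
  have two x a y b : U W x a -> U W y b -> exists V : F -> F -> Prop,
    [/\ pder V, V x a, V y b & forall z c, V z c -> U W z c].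
    have UC X : C X -> forall z c, U X z c -> U W z c.
      by move=> CX z c [h|h]; [left|right; exists X].
    move=> [gx|[X CX Xx]] [gy|[Y CY Yy]].
    - by exists G; split=> // z c h; left.
    - by exists (U Y); split; [exact: CP|left|right|exact: UC].
    - by exists (U X); split; [exact: CP|right|left|exact: UC].
    have [XY|YX] := Ct _ _ CX CY.
    - by exists (U Y); split; [exact: CP|right; apply: XY|right|exact: UC].
    - by exists (U X); split; [exact: CP|right|right; apply: YX|exact: UC].
  split.
  - move=> a h; have [V [Vd V0 _ _]] := two _ _ _ _ h h.
    by case: Vd => h0 _ _ _; exact: h0.
  - move=> x y a b hx hy; have [V [Vd Vx Vy VU]] := two _ _ _ _ hx hy.
    by apply: VU; exact: pderD.
  - move=> x y a b hx hy; have [V [Vd Vx Vy VU]] := two _ _ _ _ hx hy.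
    by apply: VU; exact: pderM.
  - by move=> c; left; exact: pderp.
have tot x : exists a, U A x a.
  apply: contrapT => nx; have [G' [G'd GG' G'x _]] := pder_ext PA 0 nx.
  pose B : set (F * F) := fun u => G' u.1 u.2.
  apply: (Amax B).
    split; first by move=> [u a] h; apply: GG'; right.
    by move=> h; apply: nx; exists 0; right; apply: (h (x, 0)).
  have e u a : U B u a <-> G' u a.
    by split=> [[h|//]|h]; [apply: GG'; left|right].
  case: G'd => h1 h2 h3 h4; split.
  + by move=> a /e; exact: h1.
  + by move=> u v a b /e hu /e hv; apply/e; exact: h2.
  + by move=> u v a b /e hu /e hv; apply/e; exact: h3.
  + by move=> c; apply/e; exact: h4.
have [d hd] := choice tot; exists d; split; last first.
  by move=> x a h; apply: (pder_fun PA (hd x)); left.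
split=> x y; apply: (pder_fun PA (hd _)); first exact: (pderD PA).
exact: (pderM PA).
Qed.

(** The incremental form of p-independence: it can be extended one element at a time and passes to
    prefixes. *)
Definition pfree (b : seq F) :=
  forall i, (i < size b)%N -> ~ adjoin p (take i b) (nth 0 b i).

Lemma dual_derivation (b : seq F) (v : nat -> F) : pfree b ->
  exists d, der d /\ forall j, (j < size b)%N -> d (nth 0 b j) = v j.
Proof.
move=> bf.
(* The domain is kept inside F^p of the first k elements, so that p-freeness puts the next element
   outside it. *)
suff /(_ _ (leqnn _)) [G [Gd Gv _]] : forall k, (k <= size b)%N ->
    exists G, [/\ pder G, forall j, (j < k)%N -> G (nth 0 b j) (v j) &
                  forall u a, G u a -> adjoin p (take k b) u].
  have [d [dd dG]] := pder_total Gd; exists d; split=> // j jb; apply: dG; exact: Gv.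
elim=> [_|k IH kb].
  exists (fun u a => adjoin p [::] u /\ a = 0); split=> //; last by move=> u a []; rewrite take0.
  have AF := @adjoin_subfield F p [::]; split.
  - by move=> a [].
  - by move=> x y a b' [hx ->] [hy ->]; split; [exact: (subfieldD AF)|rewrite addr0].
  - by move=> x y a b' [hx ->] [hy ->]; split; [exact: (subfieldM AF)|rewrite !mulr0 addr0].
  - by move=> c; split=> //; exact: FpC_pow.
have [G [Gd Gv GA]] := IH (ltnW kb).
have [|G' [G'd GG' G'b G'A]] := pder_ext Gd (v k) (x := nth 0 b k).
  by move=> [a /GA]; exact: bf.
exists G'; split=> //.
  move=> j; rewrite ltnS leq_eqVlt => /orP[/eqP -> //|jk].
  by apply: GG'; exact: Gv.
rewrite (take_nth 0 kb); apply: G'A; first exact: adjoin_subfield.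
  move=> u a /GA; apply: adjoin_sub => y hy; by rewrite mem_rcons inE hy orbT.
by apply: adjoin_mem; rewrite mem_rcons mem_head.
Qed.

(** The value b_j instead of 1 makes every monomial in b an eigenvector of every D_i, with
    eigenvalue its exponent of b_i. *)
Lemma dual_derivations (b : seq F) : pfree b ->
  exists D : nat -> F -> F, forall i, der (D i) /\
    forall j, (j < size b)%N -> D i (nth 0 b j) = if i == j then nth 0 b j else 0.
Proof.
move=> bf; have h i := dual_derivation (fun j => if i == j then nth 0 b j else 0) bf.
by have [D hD] := choice h; exists D.
Qed.

Lemma pfree_extend (b c : seq F) : pfree b ->
  exists b', pfree (b ++ b') /\ forall x, x \in c -> adjoin p (b ++ b') x.
Proof.
move=> bf; elim: c => [|y c [b' [b'f b'c]]]; first by exists [::]; rewrite cats0.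
have [hy|hy] := pselect (adjoin p (b ++ b') y).
  by exists b'; split=> // x; rewrite inE => /orP[/eqP -> //|]; exact: b'c.
exists (rcons b' y); rewrite -rcons_cat; split.
  move=> i; rewrite size_rcons ltnS leq_eqVlt => /orP[/eqP ->|ib].
    by rewrite nth_rcons ltnn eqxx -cats1 take_size_cat.
  by rewrite nth_rcons ib -cats1 takel_cat ?(ltnW ib) //; exact: b'f.
move=> x; rewrite inE => /orP[/eqP ->|/b'c]; first by apply: adjoin_mem; rewrite mem_rcons mem_head.
by apply: adjoin_sub => z hz; rewrite mem_rcons inE hz orbT.
Qed.

End ExtensionOfDerivations.

(** * Monomials in a p-free sequence, weights and projections *)

Section Monomials.

Variables (F : fieldType) (p : nat).
Hypothesis pF : p \in [pchar F].

Let pgt0 := p_gt0 pF.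

Definition mon (b : seq F) (w : {ffun 'I_(size b) -> 'I_p}) : F :=
  \prod_(i < size b) b`_i ^+ w i.
Arguments mon b w : clear implicits.

Definition exp_mod (b : seq F) (e : 'I_(size b) -> nat) : {ffun 'I_(size b) -> 'I_p} :=
  [ffun i => Ordinal (ltn_pmod (e i) pgt0)].

Lemma mon_split (b : seq F) (e : 'I_(size b) -> nat) :
  \prod_(i < size b) b`_i ^+ e i =
  (\prod_(i < size b) b`_i ^+ (e i %/ p)) ^+ p * mon b (exp_mod e).
Proof.
rewrite -prodrXl -big_split /=; apply: eq_bigr => i _.
by rewrite ffunE /= -exprM -exprD -divn_eq.
Qed.

Lemma adjoin_mon (b : seq F) x : adjoin p b x ->
  exists c : {ffun 'I_(size b) -> 'I_p} -> F, x = \sum_w c w ^+ p * mon b w.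
Proof.
have mon1 y w : exists c : {ffun 'I_(size b) -> 'I_p} -> F,
    y ^+ p * mon b w = \sum_w' c w' ^+ p * mon b w'.
  exists (fun w' => if w' == w then y else 0); rewrite (bigD1 w) //= eqxx.
  rewrite big1 ?addr0 // => w' /negbTE ->.
  by rewrite expr0n gtn_eqF // mul0r.
have monn (e : 'I_(size b) -> nat) y : exists c : {ffun 'I_(size b) -> 'I_p} -> F,
    y ^+ p * \prod_(i < size b) b`_i ^+ e i = \sum_w c w ^+ p * mon b w.
  have [c hc] := mon1 (y * \prod_(i < size b) b`_i ^+ (e i %/ p)) (exp_mod e).
  by exists c; rewrite -hc mon_split exprMn mulrA.
pose P x := exists c : {ffun 'I_(size b) -> 'I_p} -> F, x = \sum_w c w ^+ p * mon b w.
have PD x' y : P x' -> P y -> P (x' + y).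
  move=> [c ->] [c' ->]; exists (fun w => c w + c' w).
  by rewrite -big_split; apply: eq_bigr => w _; rewrite expp_add // mulrDl.
have P0 : P 0.
  by exists (fun=> 0); rewrite big1 // => w _; rewrite expr0n gtn_eqF // mul0r.
rewrite -/(P x); move: x; apply: (FpC_ind pF) => //.
- move=> y; have [c hc] := monn (fun=> 0%N) y; exists c; rewrite -hc.
  by rewrite big1 ?mulr1.
- move=> y yb; have iy : (index y b < size b)%N by rewrite index_mem.
  have [c hc] := monn (fun i => nat_of_bool (i == index y b :> nat)) 1; exists c; rewrite -hc.
  rewrite (bigD1 (Ordinal iy)) //= eqxx nth_index // big1 ?expr1n ?mulr1 ?mul1r //.
  by move=> i /negbTE; rewrite -val_eqE /= => ->.
- move=> x y [c ->] [c' ->]; rewrite big_distrlr /=.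
  elim/big_ind: _ => // w _; elim/big_ind: _ => // w' _.
  have [d hd] := monn (fun i => (w i + w' i)%N) (c w * c' w'); exists d.
  rewrite -hd exprMn mulrACA; congr (_ * _); rewrite -big_split.
  by apply: eq_bigr => i _; rewrite exprD.
Qed.

Lemma mon_in (b : seq F) w : adjoin p b (mon b w).
Proof.
apply: (subfield_prod (adjoin_subfield p b)) => i _.
by apply: (subfieldX (adjoin_subfield p b)); apply: adjoin_mem; rewrite mem_nth.
Qed.

Lemma mon_ind (b : seq F) (P : F -> Prop) :
  P 0 -> (forall x y, P x -> P y -> P (x + y)) ->
  (forall c w, P (c ^+ p * mon b w)) -> forall x, adjoin p b x -> P x.
Proof. by move=> P0 PD Pm x /adjoin_mon [c ->]; elim/big_ind: _ => // w _. Qed.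

(** A comparison of dimensions over F^p carried out over F: the coefficients are replaced by their
    p-th roots, and a kernel vector of the resulting matrix is raised to the p-th power. *)
Lemma frob_dim (m : nat) (T : finType) (beta : 'I_m -> F) (g : T -> F) :
  (forall k, exists c : T -> F, beta k = \sum_t c t ^+ p * g t) ->
  (forall v : 'I_m -> F, \sum_k v k ^+ p * beta k = 0 -> forall k, v k = 0) ->
  (m <= #|T|)%N.
Proof.
move=> /choice [c hc] ind; rewrite leqNgt; apply/negP => Tm.
pose M : 'M[F]_(m, #|T|) := \matrix_(k, j) c k (enum_val j).
have : kermx M != 0.
  by rewrite -mxrank_eq0 mxrank_ker subn_eq0 -ltnNge (leq_ltn_trans (rank_leq_col M)).
case/rowV0Pn => v /sub_kermxP vM v0.
case/negP: v0; apply/eqP/rowP => k; rewrite mxE; apply: (ind (v 0)) => {k}.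
rewrite (eq_bigr (fun k => \sum_t (v 0 k * c k t) ^+ p * g t)); last first.
  by move=> k _; rewrite hc mulr_sumr; apply: eq_bigr => t _; rewrite exprMn mulrA.
rewrite exchange_big big1 //= => t _; rewrite -mulr_suml -expp_sum //.
have /matrixP /(_ 0 (enum_rank t)) := vM; rewrite !mxE => e.
rewrite (eq_bigr (fun k => v 0 k * M k (enum_rank t))) ?e.
  by rewrite expr0n gtn_eqF // mul0r.
by move=> k _; rewrite mxE enum_rankK.
Qed.

Lemma deg_le_span (L : F -> Prop) m (T : finType) (g : T -> F) : o_degFp p L m ->
  (forall x, L x -> exists c : T -> F, x = \sum_t c t ^+ p * g t) -> (m <= #|T|)%N.
Proof.
move=> [b [sb [bL [ind _]]]] span.
apply: (@frob_dim m T (fun i => b`_i) g).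
  by move=> k; apply/span/bL; rewrite mem_nth ?sb.
move=> v hv k; apply: (expp_inj pF); rewrite expr0n gtn_eqF //.
pose cs := [seq v i ^+ p | i <- enum 'I_m].
have csE (i : 'I_m) : cs`_i = v i ^+ p.
  by rewrite (nth_map i) ?size_enum_ord // nth_ord_enum.
rewrite -csE; apply: (ind cs) => //.
- by rewrite size_map size_enum_ord.
- by move=> c /mapP[i _ ->]; exists (v i).
- by rewrite -[RHS]hv; apply: eq_bigr => i _; rewrite csE.
Qed.

Lemma indep_le_deg (L : F -> Prop) m n (beta : 'I_n -> F) : o_degFp p L m ->
  (forall k, L (beta k)) ->
  (forall v : 'I_n -> F, \sum_k v k ^+ p * beta k = 0 -> forall k, v k = 0) ->
  (n <= m)%N.
Proof.
move=> [b [sb [bL [_ span]]]] hL ind; rewrite -(card_ord m).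
apply: (frob_dim (g := fun i : 'I_m => b`_i) _ ind) => k.
have [cs [scs [csp ->]]] := span _ (hL k).
have /choice [c hc] : forall i : 'I_m, exists y, cs`_i = y ^+ p.
  by move=> i; apply: csp; rewrite mem_nth ?scs.
by exists c; apply: eq_bigr => i _; rewrite hc.
Qed.

Lemma card_exponents n : #|{ffun 'I_n -> 'I_p}| = (p ^ n)%N.
Proof. by rewrite card_ffun !card_ord. Qed.

(** If b_i were in F^p of its i predecessors, the p^i monomials in these would span a space of
    dimension p^(i+1). *)
Lemma pindep_pfree (b : seq F) : o_pindep p (fun x => x \in b) -> uniq b -> pfree p b.
Proof.
move=> bi bu i ib hb; have := bi (take i.+1 b) (take_uniq _ bu) (fun x => @mem_take _ _ _ x).
rewrite size_takel // => hdeg.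
have := deg_le_span (g := mon (take i b)) hdeg.
rewrite card_exponents => h.
suff : (p ^ i.+1 <= p ^ size (take i b))%N.
  by rewrite leq_exp2l ?prime_gt1 ?(p_prime pF) // size_takel ?(ltnW ib) // ltnn.
apply: h => x hx; apply: adjoin_mon; apply: FpC_sub hx => y.
rewrite (take_nth 0 ib) mem_rcons inE => /orP[/eqP -> //|]; exact: adjoin_mem.
Qed.

Section DualDerivations.

Variables (b : seq F) (D : nat -> F -> F).
Hypothesis hD : forall i, der (D i) /\
  forall j, (j < size b)%N -> D i b`_j = if i == j then b`_j else 0.

Let N := size b.
Let Dd i : der (D i) := (hD i).1.
Let Db i j (hj : (j < N)%N) := (hD i).2 j hj.

(** Extended by 0 to indices beyond the sequence, for which D_i kills all monomials. *)
Definition wt (w : {ffun 'I_(size b) -> 'I_p}) (i : nat) : nat :=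
  if insub i is Some k then w k else 0.

Lemma wt_lt w i : (wt w i < p)%N.
Proof. by rewrite /wt; case: insubP. Qed.

Lemma D_mon i c w : D i (c ^+ p * mon b w) = (wt w i)%:R * (c ^+ p * mon b w).
Proof.
rewrite der_pM // mulrCA; congr (_ * _); rewrite /mon /wt.
have De j : (j < N)%N -> D i b`_j = (i == j)%:R * b`_j.
  by move=> /Db ->; case: eqP => _; rewrite ?mul1r ?mul0r.
have Dx (j : 'I_(size b)) n : D i (b`_j ^+ n) = (n * (i == j))%:R * b`_j ^+ n.
  rewrite derX // De //; case: n => [|n]; first by rewrite !mul0r.
  by rewrite /= exprS natrM; ring.
have [k _ kE|/negbTE iN] := insubP.
  rewrite (bigD1 k) //= derM // Dx kE eqxx muln1 der_prod_eq0 ?mulr0 ?add0r //.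
    by ring.
  by move=> j /negbTE jk; rewrite Dx -kE eq_sym val_eqE jk muln0 mul0r.
rewrite mul0r; apply: der_prod_eq0 => // j _.
by rewrite Dx; case: eqP iN => [->|_ _]; rewrite ?ltn_ord // muln0 mul0r.
Qed.

Lemma wt_nat0 w i : ((wt w i)%:R == 0 :> F) = (wt w i == 0)%N.
Proof.
rewrite -(dvdn_pcharf pF); case: (posnP (wt w i)) => [->|w0]; first by rewrite dvdn0.
by rewrite gtnNdvd ?wt_lt // gtn_eqF.
Qed.

(** On F^p(b) the eigenvalues e of D_i lie in the prime field, and 1 - e^(p-1) is 1 for e = 0 and 0
    otherwise: this is the projection onto weight zero at i. *)
Definition proj i x := x - iter p.-1 (D i) x.
Definition projs s x := foldr proj x s.

Let p1gt0 : (0 < p.-1)%N.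
Proof. by have := prime_gt1 (p_prime pF); case: p => [|[]]. Qed.

Lemma D_natM i n x : D i (n%:R * x) = n%:R * D i x.
Proof. by rewrite derMc // der_nat. Qed.

Lemma proj_mon i c w :
  proj i (c ^+ p * mon b w) = (wt w i == 0)%:R * (c ^+ p * mon b w).
Proof.
rewrite /proj; set T := c ^+ p * mon b w.
have -> : iter p.-1 (D i) T = (wt w i)%:R ^+ p.-1 * T.
  elim: p.-1 => [|k IH] /=; first by rewrite expr0 mul1r.
  by rewrite IH -natrX D_natM D_mon -/T natrX exprS -mulrA mulrCA.
case: eqP => [->|/eqP w0]; first by rewrite expr0n gtn_eqF // mul0r subr0 mul1r.
have -> : ((wt w i)%:R : F) ^+ p.-1 = 1; last by rewrite mul1r mul0r subrr.
have n0 : ((wt w i)%:R : F) != 0 by rewrite wt_nat0.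
by apply: (mulfI n0); rewrite -exprS prednK // expp_nat // mulr1.
Qed.

Lemma projD i x y : proj i (x + y) = proj i x + proj i y.
Proof.
have h k : iter k (D i) (x + y) = iter k (D i) x + iter k (D i) y.
  by elim: k => //= k ->; rewrite (derD (Dd _)).
by rewrite /proj h; ring.
Qed.

Lemma proj0 i : proj i 0 = 0.
Proof. by apply: (@addrI _ (proj i 0)); rewrite -projD !addr0. Qed.

Lemma projMc i c x : D i c = 0 -> proj i (c * x) = c * proj i x.
Proof.
move=> c0; rewrite /proj mulrBr; congr (_ - _).
by elim: p.-1 => //= k ->; rewrite derMc.
Qed.

Lemma proj_id i x : D i x = 0 -> proj i x = x.
Proof.
move=> h; suff : iter p.-1 (D i) x = 0 by rewrite /proj => ->; rewrite subr0.
rewrite -(prednK p1gt0) iterSr h.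
by elim: p.-1.-1 => //= k ->; rewrite der0.
Qed.

Lemma projsD s x y : projs s (x + y) = projs s x + projs s y.
Proof. by elim: s => //= i s ->; rewrite projD. Qed.

Lemma projs0 s : projs s 0 = 0.
Proof. by apply: (@addrI _ (projs s 0)); rewrite -projsD !addr0. Qed.

Lemma projs_sum s (I : Type) (r : seq I) (P : pred I) (f : I -> F) :
  projs s (\sum_(i <- r | P i) f i) = \sum_(i <- r | P i) projs s (f i).
Proof. by apply: (big_morph (projs s)); [exact: projsD|exact: projs0]. Qed.

Lemma projsMc s c x : (forall i, D i c = 0) -> projs s (c * x) = c * projs s x.
Proof. by move=> h; elim: s => //= i s ->; rewrite projMc. Qed.

Lemma projsMp s c x : projs s (c ^+ p * x) = c ^+ p * projs s x.
Proof. by rewrite projsMc // => i; rewrite derp. Qed.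

Lemma projs_id s x : (forall i, i \in s -> D i x = 0) -> projs s x = x.
Proof.
elim: s => //= i s IH h; rewrite IH; first by apply: proj_id; apply: h; rewrite mem_head.
by move=> j js; apply: h; rewrite inE js orbT.
Qed.

Lemma projs_p s c : projs s (c ^+ p) = c ^+ p.
Proof. by apply: projs_id => i _; rewrite derp. Qed.

Lemma projs_mon s c w : projs s (c ^+ p * mon b w) =
  (all (fun i => wt w i == 0)%N s)%:R * (c ^+ p * mon b w).
Proof.
elim: s => [|i s IH] /=; first by rewrite mul1r.
rewrite IH projMc ?der_nat // proj_mon mulrA -natrM mulnb andbC //.
Qed.

Lemma D_adjoin (c : seq F) i x : {subset c <= b} -> adjoin p c x -> adjoin p c (D i x).
Proof.
move=> cb; apply: der_stable => // y yc; have yb := cb _ yc.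
rewrite -(nth_index 0 yb) Db ?index_mem //.
case: ifP => _; last exact: subfield0 (adjoin_subfield p c).
by apply: adjoin_mem; rewrite nth_index.
Qed.

Lemma proj_adjoin (c : seq F) i x :
  {subset c <= b} -> adjoin p c x -> adjoin p c (proj i x).
Proof.
move=> cb cx; apply: (subfieldB (adjoin_subfield p c)) => //.
by elim: p.-1 => //= k; exact: D_adjoin.
Qed.

Lemma projs_adjoin (c : seq F) s x :
  {subset c <= b} -> adjoin p c x -> adjoin p c (projs s x).
Proof. by move=> cb cx; elim: s => //= i s; exact: proj_adjoin. Qed.

(** The monomials diagonalize all D_i simultaneously, but only on F^p(b); the extensions to F come
    from Zorn's lemma and are not known to commute. *)
Lemma D_proj i j x : adjoin p b x -> D i (proj j x) = proj j (D i x).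
Proof.
move: x; apply: mon_ind => [|x y ex ey|c w]; first by rewrite proj0 !(der0 (Dd i)) proj0.
  by rewrite projD (derD (Dd i) (proj j x)) ex ey (derD (Dd i) x) projD.
by rewrite proj_mon D_natM D_mon projMc ?der_nat // proj_mon mulrCA.
Qed.

Lemma D_projs i s x : adjoin p b x -> D i (projs s x) = projs s (D i x).
Proof.
by move=> bx; elim: s => //= j s IH; rewrite D_proj ?IH //; apply: projs_adjoin.
Qed.

Lemma projs_D s i x : adjoin p b x -> i \in s -> projs s (D i x) = 0.
Proof.
move=> bx si; move: x bx; apply: mon_ind => [|x y ex ey|c w].
- by rewrite (der0 (Dd i)) projs0.
- by rewrite (derD (Dd _)) projsD ex ey addr0.
rewrite D_mon projsMc ?projs_mon; last by move=> k; rewrite der_nat.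
rewrite mulrA -natrM; have [w0|w0] := eqVneq (wt w i) 0%N; first by rewrite w0 mul0r.
by rewrite (_ : all _ _ = false) ?muln0 ?mul0r //; apply/negP => /allP /(_ i si); apply/negP.
Qed.

Lemma projs_eqi s s' x : s =i s' -> adjoin p b x -> projs s x = projs s' x.
Proof.
move=> ss; move: x; apply: mon_ind => [|x y ex ey|c w]; first by rewrite !projs0.
  by rewrite !projsD ex ey.
by rewrite !projs_mon (eq_all_r ss).
Qed.

Lemma projs_cat s s' x : projs (s ++ s') x = projs s (projs s' x).
Proof. by rewrite /projs foldr_cat. Qed.

End DualDerivations.

Definition dual_to (b : seq F) (D : nat -> F -> F) := forall i, der (D i) /\
  forall j, (j < size b)%N -> D i b`_j = if i == j then b`_j else 0.

Lemma dual_to_take b D k : dual_to b D -> dual_to (take k b) D.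
Proof.
move=> hD i; split=> [|j]; first exact: (hD i).1.
rewrite size_take_min leq_min => /andP[jk jb]; rewrite nth_take //; exact: (hD i).2.
Qed.

(** The generators are dropped one at a time from the end: if D_i x = 0 then x is its own projection
    at i, and the projection keeps only the monomials free of b_i. *)
Lemma adjoin_take_D0 b D k x : dual_to b D -> (k <= size b)%N -> adjoin p b x ->
  (forall i, (k <= i < size b)%N -> D i x = 0) -> adjoin p (take k b) x.
Proof.
move=> hD kN bx h.
suff : forall n, (n <= size b - k)%N -> adjoin p (take (size b - n) b) x.
  by move/(_ _ (leqnn _)); rewrite subKn.
elim=> [_|n IH nk]; first by rewrite subn0 take_size.
pose i := (size b - n.+1)%N; have ib : (i < size b)%N by rewrite /i; lia.
have {IH} := IH (ltnW nk); have -> : (size b - n = i.+1)%N by rewrite /i; lia.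
move=> ix; have Dix : D i x = 0 by apply: h; rewrite ib andbT /i; lia.
have hDi := dual_to_take i.+1 hD.
rewrite -/i -(proj_id (D := D) hD Dix).
have Ai := adjoin_subfield p (take i b).
move: ix {Dix}; move: x {bx h}; apply: mon_ind => [|x y ex ey|c w].
- by rewrite (proj0 hD); exact: (subfield0 Ai).
- by rewrite (projD hD); exact: (subfieldD Ai).
rewrite (proj_mon hDi); have [w0|_] := eqVneq (wt w i) 0%N; last first.
  by rewrite mul0r; exact: (subfield0 Ai).
rewrite mul1r; apply: (subfieldM Ai); first exact: FpC_pow.
apply: (subfield_prod Ai) => j _; have [ji|ji] := eqVneq (j : nat) i.
  suff -> : w j = 0%N :> nat by rewrite expr0; exact: (subfield1 Ai).
  move: w0; rewrite /wt; case: insubP => [l _ li wl|]; last first.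
    by case/negP; apply: leq_ltn_trans (ltn_ord j); rewrite ji.
  by rewrite -wl; congr (nat_of_ord (w _)); apply: val_inj; exact: etrans ji (esym li).
have ji' : (j < i)%N.
  rewrite ltn_neqAle ji -ltnS; apply: leq_trans (ltn_ord j) _.
  by rewrite size_take_min geq_minl.
apply: (subfieldX Ai); apply: adjoin_mem; rewrite nth_take ?(ltn_trans ji') //.
by rewrite -(nth_take 0 ji') mem_nth // (size_takel (ltnW ib)).
Qed.

Lemma modn_shift_eq0 (m n d : nat) : (m < d)%N -> (n < d)%N ->
  ((m + (d - n)) %% d = 0)%N -> m = n.
Proof.
move=> md nd; have [lt|le] := ltnP (m + (d - n)) d; first by rewrite modn_small //; lia.
rewrite -(subnK le) modnDr modn_small; lia.
Qed.

Lemma pfree_indep b c : pfree p b -> \sum_w c w ^+ p * mon b w = 0 -> forall w, c w = 0.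
Proof.
move=> bf hc w0; have [D hD] := dual_derivations pF bf.
have b0 i : (i < size b)%N -> b`_i != 0.
  move=> ib; apply/eqP => e; apply: (bf _ ib); rewrite e.
  exact: subfield0 (adjoin_subfield p _).
have mon0 (e : 'I_(size b) -> nat) : \prod_(i < size b) b`_i ^+ e i != 0.
  by apply/prodf_neq0 => i _; rewrite expf_neq0 ?b0.
pose e (w : {ffun 'I_(size b) -> 'I_p}) (i : 'I_(size b)) := (w i + (p - w0 i))%N.
(* The monomial complementary to w0: after multiplication by it, w0 is the only exponent whose term
   has weight zero everywhere, so the projections isolate the coefficient of w0. *)
pose m0 := \prod_(i < size b) b`_i ^+ (p - w0 i).
have E w : c w ^+ p * mon b w * m0 =
    (c w * \prod_(i < size b) b`_i ^+ (e w i %/ p)) ^+ p * mon b (exp_mod (e w)).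
  rewrite exprMn -!mulrA -mon_split; congr (_ * _); rewrite -big_split /=.
  by apply: eq_bigr => i _; rewrite -exprD.
have : projs D (iota 0 (size b)) (\sum_w c w ^+ p * mon b w * m0) = 0.
  by rewrite -mulr_suml hc mul0r (projs0 hD).
rewrite (projs_sum hD) (bigD1 w0) //= big1 ?addr0; last first.
  move=> w ww0; rewrite E (projs_mon hD).
  case: allP => [h|_]; rewrite ?mul0r //; case/negP: ww0; apply/eqP/ffunP => i.
  have := h i; rewrite mem_iota ltn_ord => /(_ isT).
  rewrite /wt valK ffunE /= /e; move=> /eqP e0; apply: ord_inj.
  exact: modn_shift_eq0 (ltn_ord _) (ltn_ord _) e0.
rewrite E (projs_mon hD) -E; case: allP => [_|[]]; last first.
  move=> i; rewrite mem_iota add0n => ib; rewrite /wt insubT ffunE /= /e subnKC ?modnn //.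
  exact: ltnW.
rewrite mul1r => /eqP; rewrite !mulf_eq0 !(negbTE (mon0 _)) !orbF expf_eq0.
by rewrite pgt0 => /eqP.
Qed.

Lemma pfree_size_le (C : F -> Prop) (m : nat) b : o_pdeg p C m -> pfree p b ->
  (forall x, x \in b -> o_FpC p C x) -> (size b <= m)%N.
Proof.
move=> Cm bf bC; suff : (p ^ size b <= p ^ m)%N by rewrite leq_exp2l ?prime_gt1 ?(p_prime pF).
rewrite -[(p ^ size b)%N]card_exponents.
apply: (indep_le_deg (beta := fun i : 'I_#|{ffun 'I_(size b) -> 'I_p}| => mon b (enum_val i)) Cm).
  by move=> i; apply: (FpC_sub (C := fun y => y \in b)) => //; exact: mon_in.
move=> v hv i; have := pfree_indep (c := fun w => v (enum_rank w)) bf.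
move=> /(_ _ (enum_val i)); rewrite enum_valK; apply; rewrite -[RHS]hv.
rewrite big_enum_val /=.
by apply: eq_bigr => j _; rewrite enum_valK.
Qed.

End Monomials.
Arguments mon {F p} b w.

(** * Alternating multiderivations *)

Section Evaluation.

Variables (F : fieldType) (p : nat).
Hypothesis pF : p \in [pchar F].

Definition ev (phi : seq F -> F) (w : o_form F) : F := \sum_(u <- w) u.1 * phi u.2.

Lemma ev_cat phi w1 w2 : ev phi (w1 ++ w2) = ev phi w1 + ev phi w2.
Proof. by rewrite /ev big_cat. Qed.

Lemma ev_nil phi : ev phi [::] = 0.
Proof. by rewrite /ev big_nil. Qed.

Lemma ev1 phi x t : ev phi [:: (x, t)] = x * phi t.
Proof. by rewrite /ev big_seq1. Qed.

Lemma ev_scale phi c w : ev phi (o_fscale c w) = c * ev phi w.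
Proof. by rewrite /ev big_map mulr_sumr; apply: eq_bigr => u _; rewrite mulrA. Qed.

Lemma ev_neg phi w : ev phi (o_fneg w) = - ev phi w.
Proof. by rewrite ev_scale mulN1r. Qed.

Lemma ev_flatten (I : Type) phi (r : seq I) (f : I -> o_form F) :
  ev phi (flatten [seq f i | i <- r]) = \sum_(i <- r) ev phi (f i).
Proof.
elim: r => [|i r IH]; first by rewrite big_nil ev_nil.
by rewrite big_cons /= ev_cat IH.
Qed.

Lemma ev_dlog phi x a : ev phi (o_dlogf x a) = x / \prod_(y <- a) y * phi a.
Proof. by rewrite ev1. Qed.

Lemma ev_wedge phi w1 w2 :
  ev phi (o_fwedge w1 w2) = ev (fun s => ev (fun t => phi (s ++ t)) w2) w1.
Proof.
rewrite /ev big_allpairs_dep /=; apply: eq_bigr => u _; rewrite mulr_sumr.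
by apply: eq_bigr => v _; rewrite mulrA.
Qed.

Lemma ev_fd phi w : ev phi (o_fd w) = \sum_(u <- w) phi (u.1 :: u.2).
Proof. by rewrite /ev big_map; apply: eq_bigr => u _; rewrite mul1r. Qed.

Lemma eq_ev phi psi w : (forall u, u \in w -> phi u.2 = psi u.2) -> ev phi w = ev psi w.
Proof. by move=> h; rewrite /ev !big_seq; apply: eq_bigr => u /h ->. Qed.

(** Only additivity in the coefficient is assumed, because the exterior derivative, where [f x t] is
    [phi (x :: t)], is not F-linear. *)
Lemma fcoef_sum (w : o_form F) (f : F -> seq F -> F) (T : seq (seq F)) :
  (forall t x y, f (x + y) t = f x t + f y t) -> uniq T ->
  (forall u, u \in w -> u.2 \in T) ->
  \sum_(u <- w) f u.1 u.2 = \sum_(t <- T) f (o_fcoef w t) t.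
Proof.
move=> fD Tu; have f0 t : f 0 t = 0.
  by apply: (@addrI _ (f 0 t)); rewrite -fD !addr0.
elim: w => [|u w IH] h.
  by rewrite big_nil big1 // => t _; rewrite /o_fcoef big_nil f0.
rewrite big_cons IH; last by move=> v vw; apply: h; rewrite inE vw orbT.
have uT : u.2 \in T by apply: h; rewrite mem_head.
rewrite [RHS](eq_bigr (fun t => f (if u.2 == t then u.1 else 0) t + f (o_fcoef w t) t)).
  rewrite big_split /= [X in _ = X + _](bigD1_seq u.2) //= eqxx.
  rewrite [X in _ = _ + X + _]big1 ?addr0 // => t ut.
  by rewrite eq_sym (negbTE ut) f0.
by move=> t _; rewrite /o_fcoef big_cons fD.
Qed.

(* Alternating multiderivations: the F-linear functionals on the exterior algebra of
   the differentials, evaluated on da_1 /\ .. /\ da_n. *)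
Definition amd (phi : seq F -> F) :=
  [/\ forall l r a b, phi (l ++ (a + b) :: r) = phi (l ++ a :: r) + phi (l ++ b :: r),
      forall l r a b,
        phi (l ++ (a * b) :: r) = a * phi (l ++ b :: r) + b * phi (l ++ a :: r) &
      forall l m r a, phi (l ++ a :: m ++ a :: r) = 0].

(* The same axioms modulo a space Z of functions; instantiated with Z = 0 and with the
   span of the relations defining differential forms. *)
Definition zspace (Z : (seq F -> F) -> Prop) :=
  [/\ forall f g, f =1 g -> Z f -> Z g, Z (fun=> 0) &
      forall c f g, Z f -> Z g -> Z (fun t => c * f t + g t)].

Definition zamd (Z : (seq F -> F) -> Prop) (g : seq F -> seq F -> F) :=
  [/\ forall l r a b,
        Z (fun t => g (l ++ (a + b) :: r) t - g (l ++ a :: r) t - g (l ++ b :: r) t),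
      forall l r a b,
        Z (fun t => g (l ++ (a * b) :: r) t - a * g (l ++ b :: r) t - b * g (l ++ a :: r) t) &
      forall l m r a, Z (g (l ++ a :: m ++ a :: r))].

Section Vanishing.
Variables (Z : (seq F -> F) -> Prop) (g : seq F -> seq F -> F).
Hypotheses (ZZ : zspace Z) (gz : zamd Z g).

Let Zext f h : f =1 h -> Z f -> Z h. Proof. by case: ZZ => e _ _; exact: e. Qed.
Let Z0 : Z (fun=> 0). Proof. by case: ZZ. Qed.
Let Zlin c f h : Z f -> Z h -> Z (fun t => c * f t + h t).
Proof. by case: ZZ => _ _; apply. Qed.
Let ZD f h : Z f -> Z h -> Z (fun t => f t + h t).
Proof. by move=> hf hh; apply: Zext (Zlin 1 hf hh) => t; rewrite mul1r. Qed.
Let ZM c f : Z f -> Z (fun t => c * f t).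
Proof. by move=> hf; apply: Zext (Zlin c hf Z0) => t; rewrite addr0. Qed.
Let gD l r a b : Z (fun t => g (l ++ (a + b) :: r) t - g (l ++ a :: r) t - g (l ++ b :: r) t).
Proof. by case: gz. Qed.
Let gM l r a b :
  Z (fun t => g (l ++ (a * b) :: r) t - a * g (l ++ b :: r) t - b * g (l ++ a :: r) t).
Proof. by case: gz. Qed.
Let gA l m r a : Z (g (l ++ a :: m ++ a :: r)).
Proof. by case: gz. Qed.

Lemma zamd_swap l r a b : Z (g (l ++ a :: b :: r)) -> Z (g (l ++ b :: a :: r)).
Proof.
move=> hab; have haa := gA l [::] r a; have hbb := gA l [::] r b.
have h0 := gA l [::] r (a + b); have h1 := gD l ((a + b) :: r) a b.
have h2 := gD (rcons l a) r a b; have h3 := gD (rcons l b) r a b.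
rewrite !cat_rcons /= in h0 h1 h2 h3 haa hbb.
have := ZD h0 (ZD (ZM (-1) h1) (ZD (ZM (-1) h2) (ZD (ZM (-1) h3)
  (ZD (ZM (-1) haa) (ZD (ZM (-1) hbb) (ZM (-1) hab)))))).
by apply: Zext => t; ring.
Qed.

Lemma zamd_move l m r a : Z (g (l ++ m ++ a :: r)) <-> Z (g (l ++ a :: m ++ r)).
Proof.
elim: m l => //= x m IH l; rewrite -[l ++ x :: m ++ _]cat_rcons IH cat_rcons.
by split; exact: zamd_swap.
Qed.

Lemma zamd_perm l t t' : perm_eq t t' -> Z (g (l ++ t)) -> Z (g (l ++ t')).
Proof.
elim: t t' l => [|x t IH] t' l tt'.
  by move: (perm_size tt') => /esym /size0nil ->.
have : x \in t' by rewrite -(perm_mem tt') mem_head.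
move=> xt'; case/splitPr: xt' tt' => m r tt'.
have {}tt' : perm_eq t (m ++ r).
  by rewrite -(perm_cons x) (perm_trans tt') // perm_catC /= perm_cons perm_catC.
rewrite -cat_rcons => /(IH _ _ tt'); rewrite cat_rcons => h.
exact/zamd_move.
Qed.

(** The Leibniz rule reduces every slot to elements of b, p-th powers contributing nothing;
    alternation then reduces to strictly increasing index sequences. *)
Lemma zamd_vanish (b : seq F) (t : seq F) :
  (forall s, sorted ltn s -> all (fun i => i < size b)%N s -> size s = size t ->
     Z (g [seq b`_i | i <- s])) ->
  (forall x, x \in t -> adjoin p b x) -> Z (g t).
Proof.
move=> hs; have hf (f : seq nat) : all (fun i => i < size b)%N f -> size f = size t ->
    Z (g [seq b`_i | i <- f]).
  move=> fb ft; have [fu|/(uniqPn 0%N)] := boolP (uniq f).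
    have pf : perm_eq (sort leq f) f by rewrite perm_sort.
    rewrite -[[seq _ | i <- f]]cat0s; apply: zamd_perm (perm_map _ pf) _.
    apply: hs.
      by rewrite ltn_sorted_uniq_leq sort_uniq fu (sort_sorted leq_total).
      by rewrite (perm_all _ pf).
      by rewrite size_sort.
  case=> i [j [ij jf e]].
  rewrite -(cat_take_drop i f) map_cat (drop_nth 0%N (ltn_trans ij jf)) /=.
  set f' := drop i.+1 f.
  have jf' : (j - i.+1 < size f')%N by rewrite size_drop ltn_sub2r // (leq_ltn_trans ij).
  rewrite -(cat_take_drop (j - i.+1) f') map_cat (drop_nth 0%N jf') /=.
  by rewrite [nth _ f' _]nth_drop subnKC // -e; exact: gA.
move: hf; rewrite -[size t]/(0 + size t)%N => hf th.
(* The slots are treated from left to right; [f] lists the indices of the basis elements already put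
   in place. *)
suff : forall f, all (fun i => i < size b)%N f ->
    (forall f', all (fun i => i < size b)%N f' -> size f' = (size f + size t)%N ->
      Z (g [seq b`_i | i <- f'])) -> Z (g ([seq b`_i | i <- f] ++ t)).
  by move=> /(_ [::]); apply.
elim: t th {hf hs} => [|x t IH] th f fb hf.
  by rewrite cats0; apply: hf => //; rewrite addn0.
have xb : adjoin p b x by apply: th; rewrite mem_head.
have {}IH i : (i < size b)%N -> Z (g ([seq b`_i | i <- f] ++ b`_i :: t)).
  move=> ib; rewrite -cat_rcons -map_rcons; apply: IH.
  - by move=> y yt; apply: th; rewrite inE yt orbT.
  - by rewrite all_rcons ib.
  - by move=> f' f'b sf'; apply: hf => //; rewrite sf' size_rcons /=; lia.
move: x xb {th hf}; set l := [seq _ | i <- f].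
apply: (FpC_ind pF).
- move=> y.
  (* The power rule modulo Z; for n = p its factor n vanishes in F. *)
  have hX' n : Z (fun t' => g (l ++ (y ^+ n) :: t) t' - n%:R * y ^+ n.-1 * g (l ++ y :: t) t').
    elim: n => [|n IHn].
      have h := gM l t 1 1; rewrite mulr1 in h.
      by apply: Zext (ZM (-1) h) => t'; rewrite expr0; ring.
    rewrite exprS; apply: Zext (ZD (gM l t y (y ^+ n)) (ZM y IHn)) => t'.
    case: n {IHn} => [|n] /=; first by rewrite expr0; ring.
    by rewrite -[n.+2%:R]natr1 exprS; ring.
  by apply: Zext (hX' p) => t'; rewrite (pcharf0 pF) !mul0r subr0.
- by move=> y yb; rewrite -(nth_index 0 yb); apply: IH; rewrite index_mem.
- move=> x y hx hy; apply: Zext (ZD (gD l t x y) (ZD hx hy)) => t'; ring.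
- move=> x y hx hy; apply: Zext (ZD (gM l t x y) (ZD (ZM x hy) (ZM y hx))) => t'; ring.
Qed.

End Vanishing.

End Evaluation.

Section MultiDerivations.

Variables (F : fieldType) (p : nat).
Hypothesis pF : p \in [pchar F].

Section OneMultiDerivation.
Variable phi : seq F -> F.
Hypothesis pa : amd phi.

Lemma amd_der l r : der (fun x => phi (l ++ x :: r)).
Proof. by case: pa => hD hM _; split=> x y; [exact: hD|exact: hM]. Qed.

Lemma amd_der_hd r : der (fun x => phi (x :: r)).
Proof. exact: (amd_der [::] r). Qed.

Lemma amdA l m r a : phi (l ++ a :: m ++ a :: r) = 0.
Proof. by case: pa. Qed.

Lemma amd_dup l : phi l != 0 -> uniq l.
Proof.
apply: contraR => /(uniqPn 0) [i [j [ij jl e]]]; apply/eqP.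
rewrite -(cat_take_drop i l) (drop_nth 0 (ltn_trans ij jl)).
set l' := drop i.+1 l.
have jl' : (j - i.+1 < size l')%N by rewrite size_drop ltn_sub2r // (leq_ltn_trans ij).
rewrite -(cat_take_drop (j - i.+1) l') (drop_nth 0 jl').
by rewrite [nth _ l' _]nth_drop subnKC // -e; exact: amdA.
Qed.

Lemma amd_mem_dup x l : x \in l -> phi (x :: l) = 0.
Proof.
move=> xl; apply/eqP/negP => /negP /amd_dup /=; by rewrite xl.
Qed.

Lemma amd_swap l m r a b : phi (l ++ a :: m ++ b :: r) = - phi (l ++ b :: m ++ a :: r).
Proof.
apply/eqP; rewrite -addr_eq0; apply/eqP.
have h0 := amdA l m r (a + b); have ha := amdA l m r a; have hb := amdA l m r b.
have e1 := derD (amd_der l (m ++ (a + b) :: r)) a b.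
have e2 x : phi (l ++ x :: m ++ (a + b) :: r) =
    phi (l ++ x :: m ++ a :: r) + phi (l ++ x :: m ++ b :: r).
  by have := derD (amd_der (l ++ x :: m) r) a b; rewrite /= -!catA !cat_cons.
by rewrite h0 !e2 ha hb add0r addr0 in e1.
Qed.

Lemma amd_move l m r a : phi (l ++ m ++ a :: r) = (-1) ^+ size m * phi (l ++ a :: m ++ r).
Proof.
elim: m l => [|x m IH] l /=; first by rewrite expr0 mul1r.
rewrite -[l ++ x :: m ++ _]cat_rcons IH cat_rcons exprS mulN1r mulNr -mulrN.
by congr (_ * _); have := amd_swap l [::] (m ++ r) x a.
Qed.

Let Z0 (f : seq F -> F) := forall t, f t = 0.

Lemma zspace0 : zspace Z0.
Proof.
split=> [f g fg hf t|//|c f g hf hg t]; first by rewrite -fg.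
by rewrite hf hg mulr0 addr0.
Qed.

Lemma amd_zamd : zamd Z0 (fun t _ => phi t).
Proof.
split=> [l r a b t|l r a b t|l m r a t]; last exact: amdA.
  by rewrite (derD (amd_der l r)); ring.
by rewrite (derM (amd_der l r)); ring.
Qed.

Lemma amd_perm0 l t t' : perm_eq t t' -> phi (l ++ t) = 0 -> phi (l ++ t') = 0.
Proof.
move=> tt' h; exact: (zamd_perm zspace0 amd_zamd tt' (fun=> h)) [::].
Qed.

Lemma amd_vanish (b : seq F) (t : seq F) :
  (forall s, sorted ltn s -> all (fun i => i < size b)%N s -> size s = size t ->
     phi [seq b`_i | i <- s] = 0) ->
  (forall x, x \in t -> adjoin p b x) -> phi t = 0.
Proof.
by move=> hs ht; apply: (zamd_vanish pF zspace0 amd_zamd _ ht) [::] => s s1 s2 s3 t'; exact: hs.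
Qed.

(** There is no strictly increasing sequence of indices longer than b. *)
Lemma amd_pigeon (b t : seq F) :
  (forall x, x \in t -> adjoin p b x) -> (size b < size t)%N -> phi t = 0.
Proof.
move=> ht bt; apply: amd_vanish ht => s ss sb st; exfalso.
have : (size s <= size (iota 0 (size b)))%N.
  apply: uniq_leq_size; first by move: ss; rewrite ltn_sorted_uniq_leq => /andP[].
  by move=> i /(allP sb); rewrite mem_iota.
by rewrite size_iota st leqNgt bt.
Qed.

End OneMultiDerivation.

Lemma amd_prepend s (phi : seq F -> F) : amd phi -> amd (fun t => phi (s ++ t)).
Proof.
case=> hD hM hA; split=> [l r a b|l r a b|l m r a]; rewrite !catA //.
Qed.

Lemma amd_append s (phi : seq F -> F) : amd phi -> amd (fun t => phi (t ++ s)).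
Proof.
case=> hD hM hA; split=> [l r a b|l r a b|l m r a]; rewrite -!catA //=.
by rewrite -catA /=.
Qed.

Lemma amd_zero : amd (fun _ : seq F => 0 : F).
Proof. by split=> *; rewrite ?mulr0 ?addr0. Qed.

Lemma amd_lin c (phi psi : seq F -> F) : amd phi -> amd psi -> amd (fun t => c * phi t + psi t).
Proof.
case=> D M A [D' M' A']; split=> [l r a b|l r a b|l m r a].
- by rewrite D D'; ring.
- by rewrite M M'; ring.
- by rewrite A A' mulr0 addr0.
Qed.

Lemma amd_sum (I : Type) (r : seq I) (c : I -> F) (phi : I -> seq F -> F) :
  (forall i, amd (phi i)) -> amd (fun t => \sum_(i <- r) c i * phi i t).
Proof.
move=> h; elim: r => [|i r IH].
  rewrite (_ : (fun t => _) = fun=> 0); first exact: amd_zero.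
  by apply/funext => t; rewrite big_nil.
rewrite (_ : (fun t => _) = fun t => c i * phi i t + \sum_(i <- r) c i * phi i t).
  exact: amd_lin.
by apply/funext => t; rewrite big_cons.
Qed.

Lemma amd_ev_append w (phi : seq F -> F) : amd phi -> amd (fun s => ev (fun t => phi (s ++ t)) w).
Proof.
move=> h; apply: (amd_sum w (fun u => u.1) (phi := fun u s => phi (s ++ u.2))) => u.
exact: amd_append.
Qed.

Lemma ev_ozero w (phi : seq F -> F) : amd phi -> o_ozero w -> ev phi w = 0.
Proof.
move=> pa [cs [hcs hw]].
pose T := undup ([seq u.2 | u <- w] ++ flatten [seq [seq u.2 | u <- c.2] | c <- cs]).
pose f (x : F) t := x * phi t.
have fD t x y : f (x + y) t = f x t + f y t by rewrite /f mulrDl.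
have evE v : (forall u, u \in v -> u.2 \in T) -> ev phi v = \sum_(t <- T) f (o_fcoef v t) t.
  by move=> h; rewrite -(fcoef_sum fD) ?undup_uniq.
rewrite evE; last by move=> u uw; rewrite mem_undup mem_cat map_f.
rewrite (eq_bigr (fun t => \sum_(c <- cs) c.1 * f (o_fcoef c.2 t) t)); last first.
  by move=> t _; rewrite hw /f mulr_suml; apply: eq_bigr => c _; rewrite mulrA.
rewrite exchange_big big_seq big1 //= => c ccs; rewrite -mulr_sumr -evE; last first.
  move=> u uc; rewrite mem_undup mem_cat; apply/orP; right; apply/flattenP.
  by exists [seq u.2 | u <- c.2]; [exact: map_f|exact: map_f].
suff -> : ev phi c.2 = 0 by rewrite mulr0.
case: (hcs c ccs) => [l r a b|l r a b|l m r a]; rewrite /ev !big_cons big_nil /=.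
- by rewrite (derD (amd_der pa l r)); ring.
- by rewrite (derM (amd_der pa l r)); ring.
- by rewrite amdA //; ring.
Qed.

(** The exterior derivative is well defined on forms. The coefficients of the relations get
    differentiated too, so this does not follow from [ev_ozero]. *)
Lemma evd_ozero w (phi : seq F -> F) : amd phi -> o_ozero w -> \sum_(u <- w) phi (u.1 :: u.2) = 0.
Proof.
move=> pa [cs [hcs hw]].
pose T := undup ([seq u.2 | u <- w] ++ flatten [seq [seq u.2 | u <- c.2] | c <- cs]).
pose f (x : F) t := phi (x :: t).
have fD t x y : f (x + y) t = f x t + f y t by rewrite /f (derD (amd_der_hd pa t)).
have evE v : (forall u, u \in v -> u.2 \in T) ->
    \sum_(u <- v) f u.1 u.2 = \sum_(t <- T) f (o_fcoef v t) t.
  by move=> h; rewrite (fcoef_sum fD (undup_uniq _) h).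
rewrite -[LHS]/(\sum_(u <- w) f u.1 u.2) evE; last first.
  by move=> u uw; rewrite mem_undup mem_cat map_f.
rewrite (eq_bigr (fun t => \sum_(c <- cs) f (o_fcoef (o_fscale c.1 c.2) t) t)); last first.
  move=> t _; rewrite hw /f (der_sum (amd_der_hd pa t)); apply: eq_bigr => c _.
  congr (phi (_ :: _)); rewrite /o_fcoef big_map mulr_sumr; apply: eq_bigr => u _ /=.
  by case: ifP; rewrite ?mulr0.
rewrite exchange_big big_seq big1 //= => c ccs; rewrite -evE; last first.
  move=> _ /mapP[u uc ->]; rewrite mem_undup mem_cat; apply/orP; right; apply/flattenP.
  exists [seq u.2 | u <- c.2]; first exact: (map_f (fun c : F * o_form F => [seq u.2 | u <- c.2])).
  exact: (map_f (fun u : F * seq F => u.2) uc).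
have pN x t : phi (- x :: t) = - phi (x :: t) := derN (amd_der_hd pa t) x.
rewrite /f; case: (hcs c ccs) => [l r a b|l r a b|l m r a]; rewrite !big_cons big_nil /=.
- by rewrite mulrN1 !pN mulr1 -cat_cons (derD (amd_der pa (c.1 :: l) r)) /=; ring.
- rewrite !mulrN !pN mulr1 -cat_cons (derM (amd_der pa (c.1 :: l) r)) /=.
  rewrite !(derM (amd_der_hd pa _)).
  (* The terms c da /\ db and c db /\ da left over from the Leibniz relation with coefficient c
     cancel by antisymmetry. *)
  have := amd_swap pa [::] l r a b; rewrite /= => ->; ring.
- by rewrite -cat_cons amdA //; ring.
Qed.

Lemma ev_oeq w1 w2 (phi : seq F -> F) : amd phi -> o_oeq w1 w2 -> ev phi w1 = ev phi w2.
Proof.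
move=> pa /(ev_ozero pa); rewrite ev_cat ev_neg => /eqP; rewrite subr_eq0 => /eqP //.
Qed.

End MultiDerivations.

(** * Determinants of derivations as coordinate functionals *)

Section Determinants.

Variables (F : fieldType) (D : nat -> F -> F).

(** The product D_{s_1} /\ .. /\ D_{s_n}, set to 0 on tuples of any other length since an [amd] is
    defined on tuples of all lengths. *)
Definition dmx (s : seq nat) (t : seq F) : F :=
  if size t == size s
  then \det (\matrix_(i < size s, j < size s) D (nth 0%N s j) t`_i) else 0.

Lemma dmxE n s t : size s = n -> size t = n ->
  dmx s t = \det (\matrix_(i < n, j < n) D (nth 0%N s j) t`_i).
Proof. by move=> sn tn; rewrite /dmx tn sn eqxx; case: n / sn tn. Qed.

Lemma dmx_size s t : size t != size s -> dmx s t = 0.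
Proof. by rewrite /dmx => /negbTE ->. Qed.

Hypothesis Dd : forall i, der (D i).

(** Laplace expansion along the row of x, whose cofactors do not involve x. *)
Lemma dmx_slot s l r : exists c : 'I_(size s) -> F,
  forall x, dmx s (l ++ x :: r) = \sum_(j < size s) D (nth 0%N s j) x * c j.
Proof.
have [sz|sz] := eqVneq (size (l ++ 0 :: r)) (size s); last first.
  exists (fun=> 0) => x; rewrite dmx_size; last by move: sz; rewrite !size_cat.
  by rewrite big1 // => j _; rewrite mulr0.
have ls : (size l < size s)%N by rewrite -sz size_cat /= addnS ltnS leq_addr.
pose M x : 'M[F]_(size s) := \matrix_(i, j) D (nth 0%N s j) (l ++ x :: r)`_i.
exists (fun j => cofactor (M 0) (Ordinal ls) j) => x.
rewrite (dmxE (n := size s)) //; last by rewrite -sz !size_cat.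
rewrite (expand_det_row _ (Ordinal ls)); apply: eq_bigr => j _; rewrite !mxE.
rewrite /= nth_cat ltnn subnn /=; congr (_ * (_ * \det _)).
apply/matrixP => i k; rewrite !mxE !nth_cat.
case: ltnP => // h; case e: (_ - _)%N => //.
have := neq_lift (Ordinal ls) i; rewrite -val_eqE /= => /eqP []; move: h e => /=; lia.
Qed.

Lemma dmx_amd s : amd (dmx s).
Proof.
split=> [l r a b|l r a b|l m r a].
- have [c hc] := dmx_slot s l r; rewrite !hc -big_split; apply: eq_bigr => j _.
  by rewrite (derD (Dd _)) mulrDl.
- have [c hc] := dmx_slot s l r; rewrite !hc !mulr_sumr -big_split; apply: eq_bigr => j _.
  by rewrite (derM (Dd _)) /=; ring.
have [sz|sz] := eqVneq (size (l ++ a :: m ++ a :: r)) (size s); last exact: dmx_size.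
rewrite (dmxE (n := size s)) //.
have i1 : (size l < size s)%N by rewrite -sz size_cat /= addnS ltnS leq_addr.
have i2 : (size l + (size m).+1 < size s)%N.
  by rewrite -sz !size_cat /= ltn_add2l ltnS size_cat /= addnS ltnS leq_addr.
apply: (determinant_alternate (i1 := Ordinal i1) (i2 := Ordinal i2)).
  by rewrite -val_eqE /= -{1}[size l]addn0 eqn_add2l.
move=> j; rewrite !mxE /= !nth_cat ltnn subnn /= ltnNge leq_addr /= addKn /=.
by rewrite nth_cat ltnn subnn.
Qed.

Definition delnth k (s : seq nat) := take k s ++ drop k.+1 s.

Lemma size_delnth k s : (k < size s)%N -> size (delnth k s) = (size s).-1.
Proof. by move=> ks; rewrite size_cat size_drop size_takel ?(ltnW ks) //; lia. Qed.

Lemma nth_delnth k s i : (k < size s)%N -> nth 0%N (delnth k s) i = nth 0%N s (bump k i).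
Proof.
move=> ks; rewrite nth_cat size_takel ?(ltnW ks) // /bump.
case: (ltnP i k) => ik /=; first by rewrite nth_take.
by rewrite nth_drop addSn subnKC // add1n.
Qed.

Lemma dmx_hd s x t : dmx s (x :: t) =
  \sum_(k < size s) (-1) ^+ k * D (nth 0%N s k) x * dmx (delnth k s) t.
Proof.
have [/= sz|sz] := eqVneq (size (x :: t)) (size s); last first.
  rewrite dmx_size // big1 // => k _; rewrite dmx_size ?mulr0 //.
  by rewrite size_delnth //; move: sz (ltn_ord k) => /=; lia.
have sd (k : 'I_(size s)) : size (delnth k s) = size t by rewrite size_delnth // -sz.
rewrite (dmxE (n := (size t).+1)) // (expand_det_row _ ord0).
rewrite [RHS](eq_bigr (fun k : 'I_(size s) => (-1) ^+ k * D (nth 0%N s k) x *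
   \det (\matrix_(i < size t, j < size t) D (nth 0%N (delnth k s) j) t`_i))); last first.
  by move=> k _; rewrite (dmxE (n := size t)).
have nd (k : 'I_(size s)) i : nth 0%N (delnth k s) i = nth 0%N s (bump k i).
  exact: nth_delnth.
case: (size s) / sz sd nd => _ nd; apply: eq_bigr => k _; rewrite !mxE /= /cofactor add0n.
rewrite mulrA [D _ _ * _]mulrC; congr (_ * _); congr (\det _).
by apply/matrixP => i j; rewrite !mxE /= nd.
Qed.

End Determinants.

Section DualDeterminants.

Variables (F : fieldType) (p : nat).
Hypothesis pF : p \in [pchar F].
Variables (b : seq F) (D : nat -> F -> F).
Hypothesis hD : dual_to b D.

Let Dd i : der (D i) := (hD i).1.
Let Db i j (hj : (j < size b)%N) := (hD i).2 j hj.

Lemma dmx_rcons s k t : (k < size b)%N -> k \notin s ->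
  dmx D (rcons s k) (rcons t b`_k) = b`_k * dmx D s t.
Proof.
move=> kb ks; have [sz|sz] := eqVneq (size t) (size s); last first.
  by rewrite !dmx_size ?mulr0 // !size_rcons eqSS.
rewrite (@dmxE _ D (size s).+1) ?size_rcons ?sz // (@dmxE _ D (size s)) //.
rewrite (expand_det_row _ ord_max) (bigD1 ord_max) //= big1 ?addr0; last first.
  move=> j jm; rewrite !mxE !nth_rcons sz ltnn eqxx.
  have js : (j < size s)%N by rewrite ltn_neqAle -[X in X != _]/(val j) jm -ltnS ltn_ord.
  rewrite js Db //; case: eqP => [e|]; last by rewrite mul0r.
  by case/negP: ks; rewrite -e mem_nth.
rewrite !mxE !nth_rcons sz ltnn eqxx Db // eqxx /cofactor -signr_odd oddD addbb mul1r.
congr (_ * \det _); apply/matrixP => i j; rewrite !mxE !lift_max !nth_rcons.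
by rewrite sz !ltn_ord.
Qed.

(** For r disjoint from s, the coordinate of w at s is recovered from the coordinate of w /\ db_r at
    [s ++ r]. This turns annihilation into the vanishing of coordinates. *)
Lemma dmx_cat s r t : all (fun i => i < size b)%N r -> uniq r ->
  (forall k, k \in r -> k \notin s) ->
  dmx D (s ++ r) (t ++ [seq b`_i | i <- r]) = \prod_(i <- r) b`_i * dmx D s t.
Proof.
elim: r s t => [|k r IH] s t /=; first by rewrite !cats0 big_nil mul1r.
move=> /andP[kb rb] /andP[kr ru] rs; rewrite -!cat_rcons IH //.
  rewrite dmx_rcons //; last by apply: rs; rewrite mem_head.
  by rewrite big_cons mulrA [_ * b`_k]mulrC.
move=> l lr; rewrite mem_rcons inE negb_or rs ?inE ?lr ?orbT ?andbT //.
by apply: contraNneq kr => <-.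
Qed.

(** The coordinate at s of dlog b_f. It is kept integral because an integer is killed by every
    derivation and fixed by Frobenius. *)
Definition incidence (s f : seq nat) : int :=
  if size f == size s
  then \det (\matrix_(i < size s, j < size s) (nth 0%N s j == nth 0%N f i)%:Z) else 0.

Lemma dmx_basis s f : all (fun i => i < size b)%N f ->
  dmx D s [seq b`_i | i <- f] = (incidence s f)%:~R * \prod_(i <- f) b`_i.
Proof.
move=> fb; rewrite /dmx /incidence size_map; case: eqP => [sz|_]; last by rewrite mul0r.
pose d : 'rV[F]_(size s) := \row_i b`_(nth 0%N f i).
pose M : 'M[int]_(size s) := \matrix_(i, j) (nth 0%N s j == nth 0%N f i)%:Z.
rewrite (_ : (\matrix_(i, j) _) = diag_mx d *m map_mx intr M); last first.
  apply/matrixP => i j; rewrite mul_diag_mx !mxE.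
  have fi : (i < size f)%N by rewrite sz.
  rewrite (nth_map 0%N) // Db; last by apply: (allP fb); rewrite mem_nth.
  by case: eqP => _; rewrite ?mulr1 ?mulr0.
rewrite det_mulmx det_diag -det_map_mx mulrC; congr (_ * _).
rewrite (eq_bigr (fun i : 'I_(size s) => b`_(nth 0%N f i))); last by move=> i; rewrite mxE.
by rewrite -(big_mkord xpredT (fun i => b`_(nth 0%N f i))) -sz [RHS](big_nth 0%N).
Qed.

Lemma incidence_sorted s f : sorted ltn s -> sorted ltn f -> incidence s f = (s == f)%:Z.
Proof.
move=> ss fs; have su : uniq s by move: ss; rewrite ltn_sorted_uniq_leq => /andP[].
have fu : uniq f by move: fs; rewrite ltn_sorted_uniq_leq => /andP[].
rewrite /incidence; have [sz|] := eqVneq (size f) (size s); last first.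
  by case: (s =P f) => // ->; rewrite eqxx.
have [->|sf] := eqVneq s f.
  rewrite (_ : (\matrix_(i, j) _) = 1%:M) ?det1 //; apply/matrixP => i j; rewrite !mxE.
  by rewrite nth_uniq ?ltn_ord // natz eq_sym.
have [fsub|/allPn [k kf ks]] := boolP (all (mem s) f).
  case/eqP: sf; apply: (irr_sorted_eq ltn_trans ltnn ss fs) => k.
  by have [_ ->] := uniq_min_size fu (allP fsub) (eq_leq (esym sz)).
have kif : (index k f < size s)%N by rewrite -sz index_mem.
rewrite (expand_det_row _ (Ordinal kif)) big1 // => j _; rewrite !mxE /= nth_index //.
case: eqP => [e|_]; last by rewrite mul0r.
by case/negP: ks; rewrite /= -e mem_nth.
Qed.

Definition elems (A : {set 'I_(size b)}) : seq nat := [seq val i | i <- enum A].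

Lemma elems_lt A : all (fun i => i < size b)%N (elems A).
Proof. by apply/allP => _ /mapP[i _ ->]; exact: (ltn_ord i). Qed.

Lemma size_elems A : size (elems A) = #|A|.
Proof. by rewrite size_map -cardE. Qed.

Lemma elems_sorted A : sorted ltn (elems A).
Proof.
apply: (subseq_sorted ltn_trans _ (iota_ltn_sorted 0 (size b))).
rewrite -val_enum_ord; apply: map_subseq.
by rewrite {1}/enum_mem -enumT; exact: filter_subseq.
Qed.

Lemma elems_uniq A : uniq (elems A).
Proof. by have := elems_sorted A; rewrite ltn_sorted_uniq_leq => /andP[]. Qed.

Lemma mem_elems A (i : 'I_(size b)) : (val i \in elems A) = (i \in A).
Proof. by rewrite mem_map ?mem_enum //; exact: val_inj. Qed.

Lemma elems_inj : injective elems.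
Proof. by move=> A B e; apply/setP => i; rewrite -!mem_elems e. Qed.

Lemma elems_onto s : sorted ltn s -> all (fun i => i < size b)%N s ->
  exists A, elems A = s.
Proof.
move=> ss sb; exists [set i : 'I_(size b) | val i \in s].
apply: (irr_sorted_eq ltn_trans ltnn (elems_sorted _) ss) => k.
apply/mapP/idP => [[i]|ks]; first by rewrite mem_enum inE => ? ->.
by exists (Ordinal (allP sb _ ks)) => //; rewrite mem_enum inE.
Qed.

Definition dlogb (A : {set 'I_(size b)}) := o_dlogf 1 [seq b`_i | i <- elems A].

Hypothesis b0 : forall i, (i < size b)%N -> b`_i != 0.

Lemma prod_basis_neq0 s : all (fun i => i < size b)%N s -> \prod_(i <- s) b`_i != 0.
Proof.
move=> /allP sb; rewrite prodf_seq_neq0; apply/allP => i /sb ib.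
by apply/implyP => _; exact: b0.
Qed.

(** Both sides satisfy the same axioms in t and agree on increasing tuples of basis elements, so
    [zamd_vanish] applies to their difference. *)
Lemma zamd_expand Z g : zspace Z -> zamd Z g -> forall t, (forall x, x \in t -> adjoin p b x) ->
  Z (fun t' => g t t' - \sum_A (\prod_(i <- elems A) b`_i)^-1 *
       g [seq b`_i | i <- elems A] t' * dmx D (elems A) t).
Proof.
move=> ZZ gz t tb.
pose S t t' := \sum_A ((\prod_(i <- elems A) b`_i)^-1 *
       g [seq b`_i | i <- elems A] t') * dmx D (elems A) t.
have [Zext Z0 _] := ZZ; have [gD gM gA] := gz.
have Sa t' : amd (S^~ t').
  by apply: (amd_sum _ _ (phi := fun A => dmx D (elems A))) => A; exact: dmx_amd.
apply: (zamd_vanish (g := fun t t' => g t t' - S t t') pF ZZ) tb.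
  split=> [l r x y|l r x y|l m r x].
  - by apply: Zext (gD l r x y) => t'; rewrite (derD (amd_der (Sa t') l r)); ring.
  - by apply: Zext (gM l r x y) => t'; rewrite (derM (amd_der (Sa t') l r)); ring.
  - by apply: Zext (gA l m r x) => t'; rewrite (amdA (Sa t')) subr0.
move=> s ss sb _; have [A As] := elems_onto ss sb.
apply: Zext Z0 => t'; rewrite /S (bigD1 A) //= [X in _ - (_ + X)]big1 ?addr0; last first.
  move=> B BA; rewrite dmx_basis // incidence_sorted ?elems_sorted // -As.
  by rewrite (inj_eq elems_inj) (negbTE BA) mul0r mulr0.
rewrite dmx_basis // incidence_sorted ?elems_sorted // As eqxx mul1r.
by rewrite mulrAC mulVf ?mul1r ?subrr // prod_basis_neq0.
Qed.

Lemma amd_expand phi : amd phi -> forall t, (forall x, x \in t -> adjoin p b x) ->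
  phi t = \sum_A dmx D (elems A) t * ev phi (dlogb A).
Proof.
move=> pa t tb; have := zamd_expand (zspace0 F) (amd_zamd pa) tb.
move=> /(_ [::]) /eqP; rewrite subr_eq0 => /eqP ->; apply: eq_bigr => A _.
by rewrite ev_dlog div1r [in RHS]big_map [RHS]mulrC.
Qed.

Lemma ev_expand phi (w : o_form F) : amd phi ->
  (forall u x, u \in w -> x \in u.2 -> adjoin p b x) ->
  ev phi w = \sum_A ev (dmx D (elems A)) w * ev phi (dlogb A).
Proof.
move=> pa wb; rewrite {1}/ev big_seq.
rewrite (eq_bigr (fun u => \sum_A (u.1 * dmx D (elems A) u.2) * ev phi (dlogb A))).
  by rewrite -big_seq exchange_big; apply: eq_bigr => A _; rewrite mulr_suml.
move=> u uw; rewrite (amd_expand pa) ?mulr_sumr; last by move=> x; exact: wb.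
by apply: eq_bigr => A _; rewrite mulrA.
Qed.

End DualDeterminants.

(** * Duality between forms and multiderivations *)

Section Duality.

Variables (F : fieldType) (p : nat).
Hypothesis pF : p \in [pchar F].

Lemma pfree_neq0 (b : seq F) i : pfree p b -> (i < size b)%N -> b`_i != 0.
Proof.
move=> bf ib; apply/eqP => e; apply: (bf _ ib); rewrite e.
exact: subfield0 (adjoin_subfield p _).
Qed.

Definition relspan (f : seq F -> F) := exists cs : seq (F * o_form F),
  (forall c, c \in cs -> o_relgen c.2) /\
  forall t, f t = \sum_(c <- cs) c.1 * o_fcoef c.2 t.

Lemma relspan_zspace : zspace relspan.
Proof.
split.
- by move=> f g fg [cs [h e]]; exists cs; split=> // t; rewrite -fg.
- by exists [::]; split=> // t; rewrite big_nil.
- move=> c f g [cs [h e]] [cs' [h' e']]; exists ([seq (c * x.1, x.2) | x <- cs] ++ cs').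
  split=> [x|t]; first by rewrite mem_cat => /orP[/mapP[y /h hy ->]|/h'].
  rewrite big_cat big_map e e' mulr_sumr /=; congr (_ + _).
  by apply: eq_bigr => x _; rewrite mulrA.
Qed.

(** The symbol t as an indicator function; modulo [relspan] it is the universal alternating
    multiderivation, t |-> dt_1 /\ .. /\ dt_n. *)
Definition universal (t : seq F) (t' : seq F) : F := o_fcoef [:: (1, t)] t'.

Lemma universalE t t' : universal t t' = (t == t')%:R.
Proof. by rewrite /universal /o_fcoef big_seq1 /=; case: eqP. Qed.

Lemma universal_zamd : zamd relspan universal.
Proof.
have rel r f : o_relgen r -> (forall t, f t = o_fcoef r t) -> relspan f.
  move=> hr e; exists [:: (1, r)]; split=> [c|t]; first by rewrite inE => /eqP ->.
  by rewrite big_seq1 mul1r.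
split=> [l r a b|l r a b|l m r a].
- apply: rel (relgen_add l r a b) _ => t.
  by rewrite /universal /o_fcoef !big_cons !big_nil /=; do 3 case: ifP => _; ring.
- apply: rel (relgen_mul l r a b) _ => t.
  by rewrite /universal /o_fcoef !big_cons !big_nil /=; do 3 case: ifP => _; ring.
- exact: rel (relgen_alt l m r a) _.
Qed.

Lemma fcoef_universal (w : o_form F) t : o_fcoef w t = \sum_(u <- w) u.1 * universal u.2 t.
Proof.
by apply: eq_bigr => u _; rewrite universalE; case: eqP; rewrite ?mulr1 ?mulr0.
Qed.

(** The entries of w lie in F^p(b) for a finite p-free b. Expanding the universal multiderivation in
    b writes w, modulo relations, as a combination of the db_A with multiples of the [dmx]
    coordinates of w as coefficients, and these coordinates vanish. *)
Lemma ozero_of_ev (w : o_form F) : (forall phi, amd phi -> ev phi w = 0) -> o_ozero w.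
Proof.
move=> hw; have nf : pfree p ([::] : seq F) by [].
have [b [/= bf hb]] := pfree_extend (flatten [seq u.2 | u <- w]) nf.
have [D hD] := dual_derivations pF bf.
have wb u x : u \in w -> x \in u.2 -> adjoin p b x.
  by move=> uw xu; apply: hb; apply/flattenP; exists u.2 => //; exact: map_f.
have ZZ := relspan_zspace; have [Zext Z0 Zlin] := ZZ.
have b0 i (ib : (i < size b)%N) := pfree_neq0 bf ib.
pose S (t t' : seq F) := \sum_(A : {set 'I_(size b)}) (\prod_(i <- elems A) b`_i)^-1 *
       universal [seq b`_i | i <- elems A] t' * dmx D (elems A) t.
have : relspan (fun t' => \sum_(u <- w) u.1 * (universal u.2 t' - S u.2 t')).
  elim: {hw hb} w wb => [|u w IH] wb; first by apply: Zext Z0 => t'; rewrite big_nil.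
  have /(Zlin u.1) h := zamd_expand pF hD b0 ZZ universal_zamd (t := u.2)
    (fun x => wb u x (mem_head _ _)).
  have /h : relspan (fun t' => \sum_(u <- w) u.1 * (universal u.2 t' - S u.2 t')).
    by apply: IH => v x vw; apply: wb; rewrite inE vw orbT.
  by apply: Zext => t'; rewrite big_cons.
apply: Zext => t'; rewrite [RHS]fcoef_universal -[RHS]subr0.
under eq_bigr => u _ do rewrite mulrBr.
rewrite sumrB; congr (_ - _); rewrite /S.
under eq_bigr => u _ do rewrite mulr_sumr.
rewrite exchange_big big1 //= => A _.
under eq_bigr => u _ do rewrite mulrCA.
rewrite -mulr_sumr -/(ev (dmx D (elems A)) w) (hw (dmx D (elems A))) ?mulr0 //.
by apply: dmx_amd => i; exact: (hD i).1.
Qed.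

Lemma ozeroP (w : o_form F) : o_ozero w <-> forall phi, amd phi -> ev phi w = 0.
Proof. by split=> [h phi pa|]; [exact: ev_ozero|exact: ozero_of_ev]. Qed.

Lemma oeqP (w1 w2 : o_form F) :
  o_oeq w1 w2 <-> forall phi, amd phi -> ev phi w1 = ev phi w2.
Proof.
rewrite /o_oeq ozeroP; split=> h phi pa; have := h phi pa; rewrite ev_cat ev_neg.
  by move/eqP; rewrite subr_eq0 => /eqP.
by move=> ->; rewrite subrr.
Qed.

End Duality.

(** * Logarithmic derivatives *)

Section Jacobson.

Variables (F : fieldType) (p : nat).
Hypothesis pF : p \in [pchar F].

Variables (d : F -> F) (f : F).
Hypothesis dd : der d.

(* [jac n k] is the coefficient of t^k in (d + t f)^n (1). *)
Fixpoint jac (n k : nat) : F :=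
  if n is m.+1 then (if k is l.+1 then f * jac m l else 0) + d (jac m k)
  else (k == 0)%:R.

(** The derivative in t of the operator (d + t f)^n, applied to 1: moving each factor f to the left
    produces iterated commutators with d + t f, which are the d^j f. *)
Lemma jac_deriv n k : k.+1%:R * jac n k.+1 =
  \sum_(j < n) 'C(n, j.+1)%:R * iter j d f * jac (n - j.+1) k.
Proof.
elim: n k => [|n IH] k; first by rewrite big_ord0 mulr0.
have -> : k.+1%:R * jac n.+1 k.+1 =
    f * jac n k + (f * (k%:R * jac n k) + d (k.+1%:R * jac n k.+1)).
  by rewrite (derM dd) (der_nat dd) /= -natr1; ring.
have -> : f * (k%:R * jac n k) + d (k.+1%:R * jac n k.+1) =
    \sum_(j < n) 'C(n, j.+1)%:R * iter j.+1 d f * jac (n - j.+1) k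
    + \sum_(j < n) 'C(n, j.+1)%:R * iter j d f * jac (n - j) k.
  rewrite IH (der_sum dd) -big_split /=.
  have -> : f * (k%:R * jac n k) = \sum_(j < n) 'C(n, j.+1)%:R * iter j d f *
      (if k is l.+1 then f * jac (n - j.+1) l else 0).
    case: k => [|k]; first by rewrite mul0r mulr0 big1 // => j _; rewrite mulr0.
    by rewrite IH mulr_sumr; apply: eq_bigr => j _; ring.
  rewrite -big_split; apply: eq_bigr => j _; rewrite /= !(derM dd) (der_nat dd).
  have -> : (n - j = (n - j.+1).+1)%N by rewrite -subSn ?subSS.
  by rewrite /=; ring.
rewrite addrA; have -> : f * jac n k +
    \sum_(j < n) 'C(n, j.+1)%:R * iter j.+1 d f * jac (n - j.+1) k =
    \sum_(j < n.+1) 'C(n, j)%:R * iter j d f * jac (n - j) k.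
  by rewrite big_ord_recl /= bin0 subn0 mul1r.
have -> : \sum_(j < n) 'C(n, j.+1)%:R * iter j d f * jac (n - j) k =
    \sum_(j < n.+1) 'C(n, j.+1)%:R * iter j d f * jac (n - j) k.
  by rewrite big_ord_recr /= bin_small // !mul0r addr0.
rewrite -big_split; apply: eq_bigr => j _ /=.
by rewrite subSS binS natrD; ring.
Qed.

Lemma jac_gt n k : (n < k)%N -> jac n k = 0.
Proof.
elim: n k => [|n IH] [|k] //= h.
by rewrite (IH _ h) (IH _ (ltnW h)) (der0 dd) mulr0 addr0.
Qed.

Lemma jac_diag n : jac n n = f ^+ n.
Proof.
by elim: n => [|n IH] //=; rewrite IH jac_gt // (der0 dd) addr0 exprS.
Qed.

Lemma jac_sum n : iter n (fun y => f * y + d y) 1 = \sum_(k < n.+1) jac n k.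
Proof.
elim: n => [|n IH]; first by rewrite big_ord1.
rewrite iterS IH mulr_sumr (der_sum dd).
rewrite (eq_bigr (fun k : 'I_n.+2 => (if k : nat is l.+1 then f * jac n l else 0) + d (jac n k))
  (fun _ _ => erefl)).
rewrite big_split /=; congr (_ + _).
  by rewrite [RHS]big_ord_recl add0r.
by rewrite [RHS]big_ord_recr /= jac_gt // (der0 dd) addr0.
Qed.

Lemma jacobson : iter p (fun y => f * y + d y) 1 = f ^+ p + iter p.-1 d f.
Proof.
have p1 := prime_gt1 (p_prime pF).
(* For n = p all binomials but the last vanish in F, so only the coefficients of t and t^p can be
   nonzero. *)
have H k : k.+1%:R * jac p k.+1 = (k == 0)%:R * iter p.-1 d f.
  have lp : (p.-1 < p)%N by rewrite prednK ?(ltnW p1).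
  rewrite jac_deriv (bigD1 (Ordinal lp)) //= big1 ?addr0.
    by rewrite prednK ?(ltnW p1) // binn subnn mul1r mulrC.
  move=> j; rewrite -val_eqE /= => jp; rewrite (bin_lt_pcharf_0 pF) ?mul0r //=.
  by rewrite -[X in (_ < X)%N](prednK (ltnW p1)) ltnS ltn_neqAle jp -ltnS
    prednK ?(ltnW p1) ?ltn_ord.
rewrite jac_sum big_ord_recr /= jac_diag addrC; congr (_ + _).
rewrite -(big_mkord xpredT (jac p)) big_ltn ?(ltnW p1) // big_ltn //.
have -> : jac p 0 = 0.
  have h n : jac n.+1 0 = 0.
    by elim: n => [|n IH] /=; rewrite add0r ?(der1 dd) // -[X in d X]/(jac n.+1 0) IH (der0 dd).
  by rewrite -(prednK (ltnW p1)).
have := H 0%N; rewrite !mul1r => ->; rewrite add0r big_nat_cond big1 ?addr0 // => k.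
rewrite andbT => /andP[k1 kp]; apply/eqP; have := H k.-1.
rewrite prednK ?(ltnW k1) // (_ : (k.-1 == 0)%N = false); last by case: (k) k1 => [|[]].
move/eqP; rewrite mul0r mulf_eq0 -(dvdn_pcharf pF) gtnNdvd //; exact: ltnW.
Qed.

End Jacobson.

(** * The prime field, the equation dy = f y and the factorization of leading coefficients *)

Section PrimeField.

Variables (F : fieldType) (p : nat).
Hypothesis pF : p \in [pchar F].

Lemma natr_inj_small i j : (i < p)%N -> (j < p)%N -> i%:R = j%:R :> F -> i = j.
Proof.
wlog ij : i j / (i <= j)%N.
  by move=> h; case: (leqP i j) => [|/ltnW] ij ip jp e; [|symmetry]; apply: h.
move=> ip jp e; have : ((j - i)%:R == 0 :> F) by rewrite natrB // e subrr.
rewrite -(dvdn_pcharf pF); case: (posnP (j - i)) => [/eqP|h].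
  by rewrite subn_eq0 => ji _; apply/eqP; rewrite eqn_leq ij.
by rewrite gtnNdvd // (leq_ltn_trans (leq_subr i j)).
Qed.

Lemma prime_field_poly :
  'X^p - 'X = \prod_(j <- iota 0 p) ('X - (j%:R)%:P) :> {poly F}.
Proof.
have p1 := prime_gt1 (p_prime pF).
have sX : size ('X^p - 'X : {poly F}) = p.+1.
  by rewrite size_polyDl ?size_polyXn // size_polyN size_polyX ltnS.
have := @all_roots_prod_XsubC F ('X^p - 'X) [seq j%:R | j <- iota 0 p].
rewrite sX size_map size_iota big_map => /(_ erefl) -> //.
- rewrite lead_coefDl ?size_polyXn ?size_polyN ?size_polyX ?ltnS //.
  by rewrite lead_coefXn scale1r.
- by apply/allP => _ /mapP[j _ ->]; rewrite rootE !hornerE expp_nat // subrr.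
rewrite uniq_rootsE map_inj_in_uniq ?iota_uniq // => i j.
by rewrite !mem_iota; exact: natr_inj_small.
Qed.

Lemma prime_field (x : F) : x ^+ p = x -> exists c : nat, x = c%:R.
Proof.
move=> xp; have := congr1 (fun q : {poly F} => q.[x]) prime_field_poly.
rewrite /= !hornerE xp subrr horner_prod => /esym/eqP.
rewrite prodf_seq_eq0 => /hasP[j _]; rewrite /= !hornerE subr_eq0 => /eqP ->.
by exists j.
Qed.

(** By Jacobson's formula the hypothesis says that T = d - f satisfies T^p(1) = T(1). Since X^p - X
    is the product of the X - j over the prime field, applying the T - j successively to 1 reaches
    0, and the last nonzero vector is an eigenvector of T with eigenvalue some j. The power of b
    removes this j. The final clause locates y in each d-stable subfield containing f and b. *)
Lemma log_derivative (d : F -> F) (f b : F) : der d -> b != 0 -> d b = b ->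
  f ^+ p = f - iter p.-1 d f ->
  exists y, [/\ y != 0, d y = f * y & forall M : F -> Prop, o_is_subfield M ->
    (forall x, M x -> M (d x)) -> M f -> M b -> M y].
Proof.
move=> dd b0 db hf; pose T y := - f * y + d y.
have TD x y : T (x + y) = T x + T y by rewrite /T (derD dd); ring.
have Tc c x : d c = 0 -> T (c * x) = c * T x by move=> dc; rewrite /T (derMc dd) //; ring.
have Tp : iter p T 1 = T 1.
  rewrite (jacobson pF _ dd) expp_opp // hf /T (der1 dd).
  have -> : forall k, iter k d (- f) = - iter k d f.
    by elim=> //= k ->; rewrite (derN dd).
  by ring.
pose P m : {poly F} := \prod_(j <- iota 0 m) ('X - (j%:R)%:P).
have PS m : P m.+1 = P m * ('X - (m%:R)%:P).
  by rewrite /P -addn1 iotaD big_cat big_seq1.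
have dP m k : d (P m)`_k = 0.
  elim: m k => [|m IH] k; first by rewrite /P big_nil coef1 (der_nat dd).
  rewrite PS mulrBr coefB coefMX coefMC (derB dd) (derM dd) (der_nat dd) IH !mulr0 addr0 subr0.
  by case: ifP => _; rewrite ?(der0 dd).
pose v m := \sum_(k < m.+1) (P m)`_k * iter k T 1.
have sP m : size (P m) = m.+1 by rewrite size_prod_XsubC size_iota.
have vS m : v m.+1 = T (v m) - m%:R * v m.
  rewrite /v PS.
  rewrite (eq_bigr (fun k : 'I_m.+2 => (if k == 0 :> nat then 0 else (P m)`_k.-1) * iter k T 1
     - m%:R * ((P m)`_k * iter k T 1))); last first.
    by move=> k _; rewrite mulrBr coefB coefMX coefMC; case: ifP => _; ring.
  rewrite sumrB; congr (_ - _).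
    rewrite big_ord_recl /= mul0r add0r (big_morph T TD (_ : T 0 = 0)); last first.
      by rewrite /T (der0 dd) mulr0 addr0.
    by apply: eq_bigr => k _; rewrite Tc.
  by rewrite -mulr_sumr big_ord_recr /= (nth_default 0) ?sP // mul0r addr0.
have vp : v p = 0.
  have p1 := prime_gt1 (p_prime pF).
  rewrite /v /P -prime_field_poly big_ord_recr /= coefB coefXn eqxx coefX gtn_eqF //.
  rewrite subr0 mul1r Tp.
  rewrite (bigD1 (Ordinal p1)) //= coefB coefXn coefX /= ltn_eqF // sub0r mulN1r big1; last first.
    move=> k k1; rewrite coefB coefXn coefX ltn_eqF // (negbTE (_ : k != 1%N :> nat)).
      by rewrite subrr mul0r.
    by rewrite -val_eqE in k1.
  by rewrite addr0 addNr.
have v0 : v 0%N = 1 by rewrite /v big_ord1 /P big_nil coef1 mul1r.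
have [j [vj vj1]] : exists j, v j != 0 /\ v j.+1 = 0.
  apply: contrapT => no; suff : forall m, v m != 0 by move=> /(_ p); rewrite vp eqxx.
  elim=> [|m IH]; first by rewrite v0 oner_neq0.
  by apply/eqP => h; apply: no; exists m.
have dv : d (v j) = f * v j + j%:R * v j.
  by move/eqP: vj1; rewrite vS /T subr_eq0 => /eqP <-; ring.
(* The exponent is a natural number congruent to -j modulo p, and b^m has eigenvalue m. *)
exists (v j * b ^+ (p * j - j)); split.
- by rewrite mulf_neq0 // expf_neq0.
- have bX n : n%:R * b ^+ n.-1 * b = n%:R * b ^+ n.
    by case: n => [|n]; rewrite ?mul0r // -mulrA -exprSr.
  rewrite (derM dd) (derX dd) db dv bX.
  have -> : ((p * j - j)%:R : F) = - j%:R; last by ring.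
  rewrite natrB ?natrM ?(pcharf0 pF) ?mul0r ?sub0r //.
  by rewrite leq_pmull ?(p_gt0 pF).
- move=> M MF Md Mf Mb; apply: (subfieldM MF); last exact: (subfieldX MF).
  elim: j {vj vj1 dv} => [|m IH]; first by rewrite v0; exact: (subfield1 MF).
  rewrite vS; apply: (subfieldB MF).
    apply: (subfieldD MF); last exact: Md.
    by apply: (subfieldM MF) => //; apply: (subfieldN MF).
  by apply: (subfieldM MF) => //; exact: (subfield_nat MF).
Qed.

(** The condition for j outside s, with x first projected at the larger indices of s, is what
    closedness gives for a leading coefficient; in this form it passes from x to z when the largest
    index is split off. *)
Lemma log_factorization (b : seq F) (D : nat -> F -> F) :
  (forall x : F, exists y : F, x = y ^+ p.-1) -> pfree p b -> dual_to b D ->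
  forall s x, sorted ltn s -> all (fun i => i < size b)%N s ->
  adjoin p b x -> x != 0 -> x ^+ p = projs p D (iota 0 (size b)) x ->
  (forall j, (j < size b)%N -> j \notin s ->
     D j (projs p D [seq i <- s | (j < i)%N] x) = 0) ->
  exists (c : nat) (ys : seq F), [/\ size ys = size s,
    forall u, u \in zip s ys -> u.2 != 0 /\ adjoin p (take u.1.+1 b) u.2 &
    x = c%:R * \prod_(u <- zip s ys) (D u.1 u.2 / u.2)].
Proof.
move=> hroot bf hD; have Dd i : der (D i) := (hD i).1.
have Ab := adjoin_subfield p b.
elim/last_ind=> [|s n IH] x ss sb bx x0 xp xs.
  have [|c ->] := prime_field (x := x).
    by rewrite xp (projs_id pF hD) // => i; rewrite mem_iota => ib; apply: xs.
  by exists c, [::]; split=> //; rewrite big_nil mulr1.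
have lt_n i : i \in s -> (i < n)%N.
  move: ss; rewrite (sorted_pairwise ltn_trans) pairwise_rcons => /andP[/allP h _].
  exact: h.
have ss' : sorted ltn s.
  by move: ss; rewrite !(sorted_pairwise ltn_trans) pairwise_rcons => /andP[].
move: sb; rewrite all_rcons => /andP[nb sb].
have gt_nil j r : (n <= j)%N -> all (fun i => i <= n)%N r -> [seq i <- r | (j < i)%N] = [::].
  move=> nj /allP h; apply/eqP; rewrite -[_ == _]negbK -has_filter; apply/hasPn => i /h.
  by move=> i_n; rewrite -leqNgt (leq_trans i_n).
have s_le : all (fun i => i <= n)%N s by apply/allP => i /lt_n /ltnW.
have sn_le : all (fun i => i <= n)%N (rcons s n) by rewrite all_rcons leqnn.
have Dgt j : (n < j < size b)%N -> D j x = 0.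
  move=> /andP[nj jb]; have := xs j jb; rewrite (gt_nil _ _ (ltnW nj) sn_le); apply.
  rewrite mem_rcons inE negb_or gtn_eqF //=; apply/negP => /lt_n; by rewrite ltnNge ltnW.
have xn : adjoin p (take n.+1 b) x by apply: adjoin_take_D0 => // i; exact: Dgt.
have An := adjoin_subfield p (take n.+1 b).
have subn : {subset take n.+1 b <= b} by move=> y; exact: mem_take.
pose x' := proj p D n x.
have x'n : adjoin p (take n.+1 b) x' by exact: proj_adjoin.
have projx' : projs p D (iota 0 (size b)) x' = x ^+ p.
  rewrite xp -[x']/(projs p D [:: n] x) -projs_cat; apply: (projs_eqi pF hD) => // i.
  by rewrite mem_cat inE orbC; case: eqP => // ->; rewrite mem_iota.
have x'0 : x' != 0.
  apply/eqP => h; move: projx'; rewrite h (projs0 p hD) => /esym/eqP.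
  by rewrite expf_eq0 (negbTE x0) andbF.
have Dx' : D n x' = 0.
  rewrite (D_proj pF hD) // -[proj _ _ _ _]/(projs p D [:: n] (D n x)).
  by rewrite (projs_D pF hD) // mem_head.
have [z zE] := hroot (x ^+ p / x').
have z0 : z != 0.
  have : z ^+ p.-1 != 0 by rewrite -zE mulf_neq0 ?invr_eq0 ?expf_neq0.
  by apply: contraNneq => ->; rewrite expr0n -[_ == 0%N]negbK -lt0n -ltnS prednK
    ?(p_gt0 pF) // prime_gt1 // (p_prime pF).
have xpE : x ^+ p = z ^+ p.-1 * x' by rewrite -zE divfK.
(* Up to a p-th power z is x'. As p-th powers are constants for all derivations and projections, z
   inherits weight zero at n and every hypothesis needed for the induction. *)
have zx : z = (z / x) ^+ p * x'.
  rewrite expr_div_n xpE -[in z ^+ p](prednK (p_gt0 pF)) exprS.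
  by field; rewrite x'0 expf_neq0.
have Dz : D n z = 0 by rewrite zx (der_pM pF (Dd n)) Dx' mulr0.
have zn : adjoin p (take n.+1 b) z.
  by rewrite zx; apply: (subfieldM An) => //; exact: FpC_pow.
have zb : adjoin p b z := adjoin_sub subn zn.
pose f := x / z.
have projf : proj p D n f = x' / z.
  rewrite /f mulrC (projMc p hD) 1?mulrC //.
  by rewrite (derV (Dd n)) Dz oppr0 mul0r.
have fp : f ^+ p = f - iter p.-1 (D n) f.
  rewrite -[RHS]/(proj p D n f) projf /f expr_div_n xpE.
  rewrite -[in _ / z ^+ p](prednK (p_gt0 pF)) exprS; field.
  by rewrite z0 expf_neq0.
have bn0 : b`_n != 0.
  apply/eqP => e; apply: (bf _ nb); rewrite e; exact: subfield0 (adjoin_subfield p _).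
have Dbn : D n b`_n = b`_n by rewrite (hD n).2 // eqxx.
have [y [y0 Dy yM]] := log_derivative (Dd n) bn0 Dbn fp.
have yn : adjoin p (take n.+1 b) y.
  apply: (yM _ An).
  - by move=> u; apply: (D_adjoin pF hD).
  - by apply: (subfieldM An) => //; exact: (subfieldV An).
  - by apply: adjoin_mem; rewrite -(nth_take 0 (ltnSn n)) mem_nth // size_takel.
have [|j jb js|c [ys [sys hys zE']]] := IH z ss' sb zb z0.
- by rewrite {2}zx (projsMp pF hD) projx' expr_div_n divfK // expf_neq0.
- have [nj|jn] := leqP n j.
    rewrite gt_nil //=; move: nj; rewrite leq_eqVlt => /orP[/eqP <- //|nj].
    rewrite zx (der_pM pF (Dd j)) (D_proj pF hD) // Dgt ?nj // (proj0 p hD) ?mulr0 //.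
  have := xs j jb; rewrite mem_rcons inE negb_or ltn_eqF // js => /(_ isT).
  rewrite filter_rcons jn -cats1 projs_cat /= -/x' => h.
  by rewrite zx (projsMp pF hD) (der_pM pF (Dd j)) h mulr0.
exists c, (rcons ys y); split; first by rewrite !size_rcons sys.
  move=> u; rewrite zip_rcons // mem_rcons inE => /orP[/eqP -> //|]; exact: hys.
rewrite zip_rcons // big_rcons /= Dy mulfK //.
by rewrite -[LHS](divfK z0) -/f {1}zE'; ring.
Qed.

End PrimeField.

(** * Logarithmic forms in a p-basis *)

Section LogarithmicBasis.

Variables (F : fieldType) (p : nat).
Hypothesis pF : p \in [pchar F].

(* ((a + c)^p - a^p - c^p) / p, a polynomial with integral coefficients. *)
Definition frob_carry (a c : F) : F :=
  \sum_(j < p.-1) ('C(p, j.+1) %/ p)%:R * (a ^+ j.+1 * c ^+ (p.-1 - j)).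

(** Formally d(a^p / p) = a^(p-1) da. The identities [q1] and [q2] perform this division by p inside
    the binomial coefficients, before reduction modulo p. *)
Lemma frob_carry_der (d : F -> F) a c : der d ->
  d (frob_carry a c) =
  (a + c) ^+ p.-1 * d (a + c) - a ^+ p.-1 * d a - c ^+ p.-1 * d c.
Proof.
move=> dd; have pp := p_prime pF; have p0 := p_gt0 pF.
have dvd (j : 'I_p.-1) : (p %| 'C(p, j.+1))%N.
  by apply: prime_dvd_bin => //=; rewrite -{2}(prednK p0) ltnS ltn_ord.
have q1 (j : 'I_p.-1) : (j.+1 * ('C(p, j.+1) %/ p) = 'C(p.-1, j))%N.
  by rewrite muln_divA // -mul_bin_diag mulKn.
have q2 (j : 'I_p.-1) : ((p.-1 - j) * ('C(p, j.+1) %/ p) = 'C(p.-1, j.+1))%N.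
  rewrite muln_divA // (_ : (p.-1 - j = p - j.+1)%N); last by rewrite subnS; lia.
  by rewrite -mul_bin_down mulKn.
have -> : d (frob_carry a c) = \sum_(j < p.-1)
   ('C(p.-1, j)%:R * (a ^+ j * c ^+ (p.-1 - j)) * d a +
    'C(p.-1, j.+1)%:R * (a ^+ j.+1 * c ^+ (p.-1 - j.+1)) * d c).
  rewrite (der_sum dd); apply: eq_bigr => j _.
  rewrite (derMc dd) ?(der_nat dd) // (derM dd) !(derX dd) -q1 -q2 !natrM subnS /=.
  by ring.
rewrite big_split -!mulr_suml /=.
have -> : \sum_(j < p.-1) 'C(p.-1, j)%:R * (a ^+ j * c ^+ (p.-1 - j)) =
    (a + c) ^+ p.-1 - a ^+ p.-1.
  rewrite [a + c]addrC exprDn big_ord_recr /= subnn expr0 mul1r binn mulr1n addrK.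
  by apply: eq_bigr => j _; rewrite -[RHS]mulr_natl [c ^+ _ * _]mulrC.
have -> : \sum_(j < p.-1) 'C(p.-1, j.+1)%:R * (a ^+ j.+1 * c ^+ (p.-1 - j.+1)) =
    (a + c) ^+ p.-1 - c ^+ p.-1.
  rewrite [a + c]addrC exprDn big_ord_recl /= subn0 expr0 mulr1 bin0 mulr1n addrC addKr.
  by apply: eq_bigr => j _; rewrite -[RHS]mulr_natl [c ^+ _ * _]mulrC.
by rewrite (derD dd); ring.
Qed.

Variables (b : seq F) (D : nat -> F -> F).
Hypotheses (bf : pfree p b) (hD : dual_to b D).

Let N := size b.
Let Dd i : der (D i) := (hD i).1.
Let Ab := adjoin_subfield p b.
Let b0 i (ib : (i < N)%N) : b`_i != 0 := pfree_neq0 bf ib.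

(* The inverse Cartier operator on da/a, made explicit. *)
Lemma cartier_potential a : adjoin p b a ->
  exists g, adjoin p b g /\ forall d, der d ->
    a ^+ p.-1 * d a = \sum_(i < N) D i a ^+ p * (d b`_i / b`_i) + d g.
Proof.
have p0 := p_gt0 pF.
pose Q a g := adjoin p b g /\ forall d, der d ->
    a ^+ p.-1 * d a = \sum_(i < N) D i a ^+ p * (d b`_i / b`_i) + d g.
suff h : adjoin p b a -> adjoin p b a /\ exists g, Q a g by move/h => [].
move: a; apply: (FpC_ind pF) => [y|y yb|x y [xb [g [gb hg]]] [yb [h [hb hh]]]|
                                 x y [xb [g [gb hg]]] [yb [h [hb hh]]]].
- split; first exact: FpC_pow.
  exists 0; split=> [|d dd]; first exact: (subfield0 Ab).
  rewrite (derp pF dd) mulr0 (der0 dd) addr0 big1 // => i _.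
  by rewrite (derp pF (Dd i)) expr0n gtn_eqF // mul0r.
- split; first exact: adjoin_mem.
  exists 0; split=> [|d dd]; first exact: (subfield0 Ab).
  have yi : (index y b < N)%N by rewrite index_mem.
  have Dy i : D i y = if i == index y b then y else 0 by have := (hD i).2 _ yi; rewrite nth_index.
  rewrite (der0 dd) addr0 (bigD1 (Ordinal yi)) //= big1 ?addr0.
    rewrite Dy eqxx nth_index // -[in RHS](prednK p0) exprSr.
    have y0 : y != 0 by rewrite -(nth_index 0 yb) b0.
    by field.
  move=> i; rewrite -val_eqE /= => iy.
  rewrite Dy (negbTE iy).
  by rewrite expr0n gtn_eqF // mul0r.
- split; first exact: (subfieldD Ab).
  (* The map a |-> a^(p-1) da is additive only up to an exact form, the differential of the
     carry. *)
  exists (g + h + frob_carry x y); split=> [|d dd].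
    apply: (subfieldD Ab); first exact: (subfieldD Ab).
    apply: (subfield_sum Ab) => j _; apply: (subfieldM Ab); first exact: (subfield_nat Ab).
    by apply: (subfieldM Ab); exact: (subfieldX Ab).
  rewrite (derD dd (g + h)) (derD dd g) frob_carry_der //.
  rewrite (_ : \sum_(i < N) _ = \sum_(i < N) D i x ^+ p * (d b`_i / b`_i) +
     \sum_(i < N) D i y ^+ p * (d b`_i / b`_i)).
    by rewrite hg // hh //; ring.
  rewrite -big_split; apply: eq_bigr => i _.
  by rewrite (derD (Dd i)) expp_add // mulrDl.
- split; first exact: (subfieldM Ab).
  exists (y ^+ p * g + x ^+ p * h); split=> [|d dd].
    by apply: (subfieldD Ab); apply: (subfieldM Ab) => //; exact: FpC_pow.
  rewrite (derD dd) !(der_pM pF dd).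
  rewrite (_ : \sum_(i < N) _ = y ^+ p * (\sum_(i < N) D i x ^+ p * (d b`_i / b`_i)) +
     x ^+ p * (\sum_(i < N) D i y ^+ p * (d b`_i / b`_i))).
    have -> : forall S1 S2, y ^+ p * S1 + x ^+ p * S2 + (y ^+ p * d g + x ^+ p * d h) =
      y ^+ p * (S1 + d g) + x ^+ p * (S2 + d h) by move=> S1 S2; ring.
    have xpE u : u ^+ p = u * u ^+ p.-1 :> F by rewrite -exprS prednK.
    by rewrite -hg // -hh // (derM dd) exprMn (xpE x) (xpE y); ring.
  rewrite !mulr_sumr -big_split; apply: eq_bigr => i _.
  by rewrite (derM (Dd i)) expp_add // !exprMn /=; ring.
Qed.

Lemma der_expand a d : adjoin p b a -> der d ->
  d a = \sum_(i < N) D i a / b`_i * d b`_i.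
Proof.
move=> ab dd; pose d2 x := \sum_(i < N) D i x / b`_i * d b`_i.
have d2d : der d2.
  split=> x y.
    by rewrite -big_split; apply: eq_bigr => i _; rewrite (derD (Dd i)) !mulrDl.
  rewrite !mulr_sumr -big_split; apply: eq_bigr => i _.
  by rewrite (derM (Dd i)) /=; ring.
apply: (der_eq_on pF dd d2d) ab => y yb; rewrite /d2.
have yi : (index y b < N)%N by rewrite index_mem.
have Dy i : D i y = if i == index y b then y else 0 by have := (hD i).2 _ yi; rewrite nth_index.
have y0 : y != 0 by rewrite -(nth_index 0 yb) b0.
rewrite (bigD1 (Ordinal yi)) //= big1 ?addr0.
  by rewrite Dy eqxx nth_index // mulfV // mul1r.
move=> i; rewrite -val_eqE /= => iy.
by rewrite Dy (negbTE iy) !mul0r.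
Qed.

Definition in_adjoin (v : o_form F) :=
  forall u, u \in v -> adjoin p b u.1 /\ forall x, x \in u.2 -> adjoin p b x.

Lemma in_adjoin_cat v1 v2 : in_adjoin v1 -> in_adjoin v2 -> in_adjoin (v1 ++ v2).
Proof. by move=> h1 h2 u; rewrite mem_cat => /orP[/h1|/h2]. Qed.

Definition basis_log (y : F * seq nat) : o_form F := o_dlogf y.1 [seq b`_i | i <- y.2].
Definition basis_wp (y : F * seq nat) : o_form F :=
  o_dlogf (y.1 ^+ p - y.1) [seq b`_i | i <- y.2].

Definition in_basis n (ys : seq (F * seq nat)) := forall y, y \in ys ->
  [/\ adjoin p b y.1, size y.2 = n & all (fun i => i < N)%N y.2].

(** One factor da/a at a time is replaced by the sum of the m_i dlog b_i with m_i = D_i a / a. In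
    the image under wp this leaves x^p (da/a - sum of m_i^p dlog b_i), which is (x/a)^p dg by
    [cartier_potential] and hence contributes an exact form. *)
Lemma to_basis1 (t : seq F) (l : seq nat) (x : F) :
  adjoin p b x -> all (fun i => i < N)%N l ->
  (forall y, y \in t -> adjoin p b y /\ y != 0) ->
  let l' := [seq b`_i | i <- l] ++ t in
  exists (ys : seq (F * seq nat)) (v : o_form F),
  [/\ in_basis (size l + size t) ys, in_adjoin v,
      forall phi, amd phi -> ev phi (o_dlogf x l') = \sum_(y <- ys) ev phi (basis_log y) &
      forall phi, amd phi -> ev phi (o_dlogf (x ^+ p - x) l') =
        \sum_(y <- ys) ev phi (basis_wp y) + ev phi (o_fd v)].
Proof.
elim: t l x => [|a t IH] l x xb lb ht l'.
  exists [:: (x, l)], [::]; split=> //.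
  - by move=> y; rewrite inE => /eqP ->; rewrite addn0.
  - by move=> phi _; rewrite big_seq1 /l' cats0.
  - by move=> phi _; rewrite big_seq1 /l' cats0 ev_nil addr0.
have [ab a0] := ht a (mem_head _ _).
have tb y : y \in t -> adjoin p b y /\ y != 0 by move=> yt; apply: ht; rewrite inE yt orbT.
have [g [gb hg]] := cartier_potential ab.
pose m i := D i a / a.
have h (i : 'I_N) : exists u : seq (F * seq nat) * o_form F,
  [/\ in_basis (size l + size (a :: t)) u.1, in_adjoin u.2,
      forall phi, amd phi -> ev phi (o_dlogf (x * m i) ([seq b`_i | i <- rcons l i] ++ t)) =
        \sum_(y <- u.1) ev phi (basis_log y) &
      forall phi, amd phi ->
        ev phi (o_dlogf ((x * m i) ^+ p - x * m i) ([seq b`_i | i <- rcons l i] ++ t)) =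
        \sum_(y <- u.1) ev phi (basis_wp y) + ev phi (o_fd u.2)].
  have [||//|ys [v [h1 h2 h3 h4]]] := IH (rcons l i) (x * m i).
  - apply: (subfieldM Ab) => //; apply: (subfieldM Ab); last exact: (subfieldV Ab).
    exact: (D_adjoin pF hD).
  - by rewrite all_rcons ltn_ord lb.
  by exists (ys, v); split=> //; move: h1; rewrite size_rcons addSnnS.
have {h}[u hu] := choice h.
pose q := (\prod_(y <- [seq b`_i | i <- l] ++ t) y)^-1.
(* A primitive of (x/a)^p dg /\ the other logarithmic factors. The sign moves dg to its slot; q is
   constant here because dq is killed by the differentials of its own factors. *)
pose v0 : o_form F := [:: ((-1) ^+ size l * (x / a) ^+ p * (q * g), [seq b`_i | i <- l] ++ t)].
exists (flatten [seq (u i).1 | i <- enum 'I_N]), (v0 ++ flatten [seq (u i).2 | i <- enum 'I_N]).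
have bl y : y \in [seq b`_i | i <- l] -> adjoin p b y /\ y != 0.
  move=> /mapP[i /(allP lb) ib ->]; split; last exact: b0.
  by apply: adjoin_mem; rewrite mem_nth.
have qb : adjoin p b q.
  apply: (subfieldV Ab); apply: (subfield_prod_seq Ab) => y; rewrite mem_cat.
  by case/orP => [/bl|/tb] [].
have q0 : q != 0.
  rewrite invr_eq0 prodf_seq_neq0; apply/allP => y; rewrite mem_cat => yy.
  by apply/implyP => _; case/orP: yy => [/bl|/tb] [].
have qE c i : c / \prod_(y <- [seq b`_i | i <- rcons l i] ++ t) y = c * q / b`_i.
  rewrite map_rcons cat_rcons !big_cat big_cons /= /q big_cat /= !invfM; ring.
have qa c : c / \prod_(y <- l') y = c * q / a.
  by rewrite /l' !big_cat big_cons /= /q big_cat /= !invfM; ring.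
have sumE phi (f : F * seq nat -> o_form F) :
    \sum_(y <- flatten [seq (u i).1 | i <- enum 'I_N]) ev phi (f y) =
    \sum_(i < N) \sum_(y <- (u i).1) ev phi (f y).
  by rewrite big_flatten big_map big_enum.
have fdE phi : ev phi (o_fd (v0 ++ flatten [seq (u i).2 | i <- enum 'I_N])) =
    ev phi (o_fd v0) + \sum_(i < N) ev phi (o_fd (u i).2).
  rewrite !ev_fd big_cat big_flatten big_map big_enum /=; congr (_ + _).
  by apply: eq_bigr => i _; rewrite ev_fd.
have dm phi : amd phi -> der (fun y => phi ([seq b`_i | i <- l] ++ y :: t)).
  by move=> pa; exact: amd_der.
have phE (phi : seq F -> F) i : phi ([seq b`_i | i <- rcons l i] ++ t) =
    phi ([seq b`_i | i <- l] ++ b`_i :: t).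
  by rewrite map_rcons cat_rcons.
split.
- by move=> y /flattenP[_ /mapP[i _ ->]]; case: (hu i) => + _ _ _; apply.
- apply: in_adjoin_cat.
    move=> y; rewrite inE => /eqP -> /=; split.
      apply: (subfieldM Ab); last exact: (subfieldM Ab).
      apply: (subfieldM Ab); last exact: FpC_pow.
      by apply: (subfieldX Ab); apply: (subfieldN Ab); exact: (subfield1 Ab).
    by move=> z; rewrite mem_cat => /orP[/bl|/tb] [].
  by move=> y /flattenP[_ /mapP[i _ ->]]; case: (hu i) => _ + _ _; apply.
- move=> phi pa; rewrite sumE ev_dlog qa (der_expand ab (dm _ pa)) mulr_sumr.
  apply: eq_bigr => i _; have [_ _ e _] := hu i; rewrite -e //.
  by rewrite ev_dlog qE phE /m; ring.
move=> phi pa; have hdg := hg _ (dm _ pa).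
rewrite sumE fdE addrCA -big_split /=.
rewrite (eq_bigr (fun i : 'I_N => ((x * m i) ^+ p - x * m i) * q / b`_i *
   phi ([seq b`_i | i <- l] ++ b`_i :: t))); last first.
  by move=> i _; have [_ _ _ e] := hu i; rewrite -e // ev_dlog qE phE.
rewrite (eq_bigr (fun i : 'I_N =>
   x ^+ p * q / a ^+ p * (D i a ^+ p * (phi ([seq b`_i | i <- l] ++ b`_i :: t) / b`_i)) -
   x * q / a * (D i a / b`_i * phi ([seq b`_i | i <- l] ++ b`_i :: t)))); last first.
  by move=> i _; rewrite /m exprMn expr_div_n; ring.
rewrite sumrB -!mulr_sumr -(der_expand ab (dm _ pa)).
move/eqP: hdg; rewrite -subr_eq => /eqP <-.
have -> : ev phi (o_fd v0) = x ^+ p * q / a ^+ p * phi ([seq b`_i | i <- l] ++ g :: t).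
  rewrite ev_fd big_seq1 /=; have dh := amd_der_hd pa ([seq b`_i | i <- l] ++ t).
  have sgn : phi ([seq b`_i | i <- l] ++ g :: t) =
      (-1) ^+ size l * phi (g :: [seq b`_i | i <- l] ++ t).
    by have := amd_move pa [::] [seq b`_i | i <- l] t g; rewrite size_map.
  have c0 : phi ((-1) ^+ size l * (x / a) ^+ p :: [seq b`_i | i <- l] ++ t) = 0.
    rewrite (derM dh) (derp pF dh) mulr0 add0r -signr_odd -(rmorph_sign intr) //.
    by rewrite (der_int dh) mulr0.
  have dq : phi (q :: [seq b`_i | i <- l] ++ t) = 0.
    apply: (der_prodV_seq dh) => y yl; exact: amd_mem_dup.
  rewrite (derMc dh) // (derMc dh) // sgn expr_div_n; ring.
rewrite ev_dlog qa -[in a ^+ p](prednK (p_gt0 pF)) exprS; field.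
by rewrite a0 expf_neq0.
Qed.

End LogarithmicBasis.

(** * Coordinates of logarithmic forms: Cartier condition and closedness *)

Section Coefficients.

Variables (F : fieldType) (p : nat).
Hypothesis pF : p \in [pchar F].

Variables (b : seq F) (D : nat -> F -> F).
Hypotheses (bf : pfree p b) (hD : dual_to b D).

Let N := size b.
Let Dd i : der (D i) := (hD i).1.
Let Ab := adjoin_subfield p b.
Let b0 i (ib : (i < N)%N) : b`_i != 0 := pfree_neq0 bf ib.
Let prod0 s (sb : all (fun i => i < N)%N s) : \prod_(i <- s) b`_i != 0 :=
  prod_basis_neq0 b0 sb.

Definition dlog_sum (xs : seq (F * seq F)) : o_form F :=
  flatten [seq o_dlogf u.1 u.2 | u <- xs].
Definition wp_sum (xs : seq (F * seq F)) : o_form F :=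
  flatten [seq o_dlogf (u.1 ^+ p - u.1) u.2 | u <- xs].

Definition log_data n (xs : seq (F * seq F)) := forall u, u \in xs ->
  [/\ adjoin p b u.1, size u.2 = n & forall y, y \in u.2 -> adjoin p b y /\ y != 0].

Lemma to_basis n (xs : seq (F * seq F)) : log_data n xs ->
  exists (ys : seq (F * seq nat)) (v : o_form F),
  [/\ in_basis p b n ys, in_adjoin p b v,
      forall phi, amd phi -> ev phi (dlog_sum xs) = \sum_(y <- ys) ev phi (basis_log b y) &
      forall phi, amd phi -> ev phi (wp_sum xs) =
        \sum_(y <- ys) ev phi (basis_wp p b y) + ev phi (o_fd v)].
Proof.
elim: xs => [|u xs IH] h.
  exists [::], [::]; split=> // phi pa; first by rewrite big_nil ev_nil.
  by rewrite big_nil !ev_nil addr0.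
have [ub un ue] := h u (mem_head _ _).
have [|ys [v [h1 h2 h3 h4]]] := IH; first by move=> w hw; apply: h; rewrite inE hw orbT.
have [ys' [v' [h1' h2' h3' h4']]] := to_basis1 pF bf hD ub (l := [::]) isT ue.
exists (ys' ++ ys), (v' ++ v); split.
- by move=> y; rewrite mem_cat => /orP[/h1'|/h1 //]; rewrite un.
- exact: in_adjoin_cat.
- by move=> phi pa; rewrite big_cat -h3 // -h3' // ev_cat.
- move=> phi pa; rewrite big_cat /= ev_cat h4' // -/(wp_sum xs) h4 //.
  by rewrite [o_fd (v' ++ v)]map_cat ev_cat -/(o_fd v) -/(o_fd v'); ring.
Qed.

(** The coordinates of d(z dlog b_f) are integral combinations of the D_i z, and D_i z has no part
    of weight zero at i. General symbols are reduced to basis elements slot by slot. *)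
Lemma projs_exact s z t : all (fun i => i < N)%N s -> adjoin p b z ->
  (forall x, x \in t -> adjoin p b x) ->
  projs p D (iota 0 N) (dmx D s (z :: t)) = 0.
Proof.
move=> sb; set P := projs p D _; pose phi := dmx D s.
have pa : amd phi by exact: dmx_amd.
have PD x y : P (x + y) = P x + P y by exact: (projsD p hD).
have basis f z' : all (fun i => i < N)%N f -> adjoin p b z' ->
    P (phi (z' :: [seq b`_i | i <- f])) = 0.
  (* Passing from db_f to dlog b_f: only zz is differentiated, since dq is killed by the db_i. *)
  move=> fb zb; pose q := (\prod_(i <- f) b`_i)^-1; pose zz := z' * \prod_(i <- f) b`_i.
  have dh := amd_der_hd pa [seq b`_i | i <- f].
  have dq : phi (q :: [seq b`_i | i <- f]) = 0.
    rewrite /q -(big_map (fun i => b`_i) xpredT id).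
    by apply: (der_prodV_seq dh) => y yl; exact: amd_mem_dup.
  have zE : z' = q * zz by rewrite /q /zz mulrCA mulVf ?prod0 // mulr1.
  have zzb : adjoin p b zz.
    apply: (subfieldM Ab) => //; rewrite -(big_map (fun i => b`_i) xpredT id).
    apply: (subfield_prod_seq Ab) => _ /mapP[i /(allP fb) ib ->].
    by apply: adjoin_mem; rewrite mem_nth.
  rewrite zE (derMc dh _ dq) /phi dmx_hd // mulr_sumr.
  rewrite /P (projs_sum p hD) big1 // => k _; rewrite dmx_basis //.
  rewrite (_ : q * _ = (-1) ^+ k * (incidence (delnth k s) f)%:~R * D (nth 0%N s k) zz).
    rewrite (projsMc p hD); last first.
      move=> i; rewrite -[X in X * _](rmorph_sign intr) -signr_odd -rmorphM /=.
      exact: (der_int (Dd i)).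
    rewrite (projs_D pF hD) ?mulr0 // mem_iota add0n; apply: (allP sb); exact: mem_nth.
  have q0 : \prod_(i <- f) b`_i != 0 by exact: prod0.
  by rewrite /q; field.
suff : forall f, all (fun i => i < N)%N f -> forall z', adjoin p b z' ->
    (forall x, x \in t -> adjoin p b x) -> P (phi (z' :: [seq b`_i | i <- f] ++ t)) = 0.
  by move=> h zb tb; apply: (h [::]).
elim: t => [|a t IH] f fb z' zb tb; first by rewrite cats0; exact: basis.
have {}IH i : (i < N)%N -> forall z'', adjoin p b z'' ->
    P (phi (z'' :: [seq b`_i | i <- f] ++ b`_i :: t)) = 0.
  move=> ib z'' zb'; rewrite -cat_rcons -map_rcons; apply: IH => //.
    by rewrite all_rcons ib fb.
  by move=> x xt; apply: tb; rewrite inE xt orbT.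
have ab : adjoin p b a by apply: tb; rewrite mem_head.
set l := [seq b`_i | i <- f] in IH *.
have dl u := amd_der pa (u :: l) t; have dh u := amd_der_hd pa (l ++ u :: t).
suff h : adjoin p b a -> adjoin p b a /\ forall z'', adjoin p b z'' ->
    P (phi (z'' :: l ++ a :: t)) = 0 by have [_ h'] := h ab; exact: h'.
move: a {ab tb}; apply: (FpC_ind pF) => [y|y yb|x y [xb hx] [yb hy]|x y [xb hx] [yb hy]].
- split=> [|u ub]; first exact: FpC_pow.
  by rewrite -cat_cons (derp pF (dl u)) [P _](projs0 p hD).
- split=> [|u ub]; first exact: adjoin_mem.
  by rewrite -(nth_index 0 yb) IH // index_mem.
- split=> [|u ub]; first exact: (subfieldD Ab).
  by rewrite -cat_cons (derD (dl u)) PD /= hx // hy // addr0.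
- split=> [|u ub]; first exact: (subfieldM Ab).
  (* This is du /\ d(xy) = d(ux) /\ dy + d(uy) /\ dx, in which the terms u dx /\ dy and u dy /\ dx
     cancel. *)
  have -> : phi (u :: l ++ (x * y) :: t) =
      phi ((u * x) :: l ++ y :: t) + phi ((u * y) :: l ++ x :: t).
    rewrite -cat_cons (derM (dl u)) /= !(derM (dh _)).
    by have := amd_swap pa [::] l t x y; rewrite /= => ->; ring.
  by rewrite PD hx ?hy ?addr0 //; exact: (subfieldM Ab).
Qed.

Section Family.

Variables (n : nat) (w : o_form F) (xs : seq (F * seq F)) (v : o_form F).
Hypotheses (xsn : log_data n xs) (vb : in_adjoin p b v).
Hypothesis wE : forall phi, amd phi -> ev phi w = ev phi (dlog_sum xs).
Hypothesis wpE : forall phi, amd phi -> ev phi (wp_sum xs) = ev phi (o_fd v).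

(** With integral incidences, the coordinates of w and of its image under wp are the same
    combinations of the y and of the y^p - y. So x_A^p - x_A is a coordinate of an exact form. *)
Lemma coefficient_basis : exists (ys : seq (F * seq nat)) (v' : o_form F),
  [/\ in_basis p b n ys, in_adjoin p b v',
      forall s, ev (dmx D s) w = \sum_(y <- ys) y.1 * (incidence s y.2)%:~R,
      forall s, ev (dmx D s) (o_fd v') =
        \sum_(y <- ys) (y.1 ^+ p - y.1) * (incidence s y.2)%:~R &
      forall phi, amd phi -> \sum_(y <- ys) ev phi (basis_wp p b y) = ev phi (o_fd v')].
Proof.
have [ys [v1 [h1 h2 h3 h4]]] := to_basis xsn.
have evb s x f : all (fun i => i < N)%N f ->
    ev (dmx D s) (o_dlogf x [seq b`_i | i <- f]) = x * (incidence s f)%:~R.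
  move=> fb; rewrite ev_dlog dmx_basis // (big_map (fun i => b`_i) xpredT id).
  by field; exact: prod0.
have wp' phi : amd phi -> \sum_(y <- ys) ev phi (basis_wp p b y) = ev phi (o_fd (v ++ o_fneg v1)).
  move=> pa; have := h4 phi pa; rewrite wpE // => /eqP; rewrite -subr_eq => /eqP <-.
  rewrite [o_fd (v ++ _)]map_cat ev_cat -/(o_fd v) -/(o_fd (o_fneg v1)); congr (_ + _).
  rewrite !ev_fd big_map -sumrN; apply: eq_bigr => u _ /=.
  by rewrite mulN1r (derN (amd_der_hd pa u.2)).
exists ys, (v ++ o_fneg v1); split=> //.
- apply: in_adjoin_cat => // _ /mapP[u /h2 [u1 u2] ->] /=; split=> //.
  by rewrite mulN1r; exact: (subfieldN Ab).
- move=> s; rewrite wE ?h3; try exact: dmx_amd.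
  rewrite !big_seq; apply: eq_bigr => y /h1 [_ _ yb]; exact: evb.
- move=> s; rewrite -wp'; last exact: dmx_amd.
  rewrite !big_seq; apply: eq_bigr => y /h1 [_ _ yb]; exact: evb.
Qed.

Lemma coefficient_adjoin s : adjoin p b (ev (dmx D s) w).
Proof.
have [ys [v' [h1 _ -> _ _]]] := coefficient_basis.
rewrite big_seq; apply: (subfield_sum Ab) => y /h1 [yb _ _].
by apply: (subfieldM Ab) => //; exact: (subfield_int Ab).
Qed.

(** Project x_A^p - x_A, a coordinate of an exact form: the projection is 0, while x_A^p is left
    unchanged. *)
Lemma coefficient_cartier s : all (fun i => i < N)%N s ->
  ev (dmx D s) w ^+ p = projs p D (iota 0 N) (ev (dmx D s) w).
Proof.
move=> sb; have [ys [v' [_ h2 h3 h4 _]]] := coefficient_basis.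
have e : ev (dmx D s) w ^+ p - ev (dmx D s) w = ev (dmx D s) (o_fd v').
  rewrite h3 h4 expp_sum // -sumrB; apply: eq_bigr => y _.
  by rewrite exprMn expp_int // mulrBl.
have : projs p D (iota 0 N) (ev (dmx D s) (o_fd v')) = 0.
  rewrite ev_fd (projs_sum p hD) big_seq big1 // => u /h2 [u1 u2].
  exact: projs_exact.
rewrite -e (projsD p hD) (projs_p pF hD).
by rewrite -mulN1r (projsMc p hD) ?mulN1r => [/eqP|i];
  rewrite ?subr_eq0 ?(derN (Dd i)) ?(der1 (Dd i)) ?oppr0 // => /eqP.
Qed.

(** Apply d to wp(w) = dv': the terms y^p dlog b_f and dv' are closed, hence dw = 0. The sum is the
    coordinate of dw at s. *)
Lemma coefficient_closed s : all (fun i => i < N)%N s ->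
  \sum_(k < size s) (-1) ^+ k * D (nth 0%N s k) (ev (dmx D (delnth k s)) w) = 0.
Proof.
move=> sb; have [ys [v' [h1 _ h3 _ h5]]] := coefficient_basis.
pose phi := dmx D s; have pa : amd phi by exact: dmx_amd.
have : o_ozero (flatten [seq basis_wp p b y | y <- ys] ++ o_fneg (o_fd v')).
  apply/(ozeroP pF) => psi psia; rewrite ev_cat ev_neg ev_flatten h5 //; exact: subrr.
move/(evd_ozero pa); rewrite big_cat big_flatten big_map /=.
rewrite [X in _ + X]big1_seq ?addr0; last first.
  move=> _ /andP[_ /mapP[_ /mapP[u _ ->] ->]] /=; rewrite mulr1.
  by rewrite (derN (amd_der_hd pa _)) (der1 (amd_der_hd pa _)) oppr0.
rewrite big_seq (eq_bigr (fun y => - \sum_(k < size s) (-1) ^+ k *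
    D (nth 0%N s k) (y.1 * (incidence (delnth k s) y.2)%:~R))); last first.
  move=> y /h1 [yb _ fb]; rewrite big_seq1 /=.
  set q := _^-1; have dh := amd_der_hd pa [seq b`_i | i <- y.2].
  have dq : phi (q :: [seq b`_i | i <- y.2]) = 0.
    by apply: (der_prodV_seq dh) => z zl; exact: amd_mem_dup.
  rewrite mulrC (derMc dh _ dq) (derB dh) (derp pF dh) sub0r mulrN; congr (- _).
  rewrite /phi dmx_hd // mulr_sumr; apply: eq_bigr => k _.
  rewrite dmx_basis // [y.1 * _]mulrC (derMc (Dd _)) ?(der_int (Dd _)) //.
  rewrite /q (big_map (fun i => b`_i) xpredT id); field; exact: prod0.
move/eqP; rewrite -big_seq sumrN oppr_eq0 exchange_big => /eqP {2}<-.
apply: eq_bigr => k _; rewrite h3 (der_sum (Dd _)) mulr_sumr.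
by [].
Qed.

End Family.

End Coefficients.

Lemma sorted_count_nth (s : seq nat) M k i : sorted ltn s ->
  (k <= count (fun j => j < M)%N s)%N -> (i < k)%N -> (nth 0%N s i < M)%N.
Proof.
move=> ss ks ik; have is_ : (i < size s)%N.
  by rewrite (leq_trans ik) // (leq_trans ks) // count_size.
rewrite ltnNge; apply/negP => h; move: ks; rewrite leqNgt => /negP; apply.
apply: leq_ltn_trans ik; rewrite -{1}(cat_take_drop i s) count_cat.
rewrite [count _ (drop i s)](_ : _ = 0)%N ?addn0.
  by rewrite (leq_trans (count_size _ _)) // size_takel // ltnW.
apply/eqP; rewrite -leqn0 leqNgt -has_count; apply/hasPn => j jd.
rewrite -leqNgt (leq_trans h) // -(nth_index 0%N jd) nth_drop.
have jl : (i + index j (drop i s) < size s)%N.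
  by rewrite -ltn_subRL -size_drop index_mem.
by apply: (sorted_leq_nth leq_trans leqnn 0%N (sub_sorted ltnW ss)); rewrite ?inE // leq_addr.
Qed.

(** * Leading terms, domination of index sets and decomposition *)

Section LeadingTerms.

Variables (F : fieldType) (p : nat).
Hypothesis pF : p \in [pchar F].
Hypothesis hroot : forall x : F, exists y : F, x = y ^+ p.-1.

Variables (b : seq F) (D : nat -> F -> F).
Hypotheses (bf : pfree p b) (hD : dual_to b D).

Let N := size b.
Let Dd i : der (D i) := (hD i).1.
Let b0 i (ib : (i < N)%N) : b`_i != 0 := pfree_neq0 bf ib.

Lemma D_take0 k j x : (k <= j)%N -> adjoin p (take k b) x -> D j x = 0.
Proof.
move=> kj; apply: (der_eq0_on pF (Dd j)) => y yk.
have ik : (index y (take k b) < size (take k b))%N by rewrite index_mem.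
have ikk : (index y (take k b) < k)%N.
  by rewrite (leq_trans ik) // size_take_min geq_minl.
have ib : (index y (take k b) < N)%N.
  by rewrite (leq_trans ik) // size_take_min geq_minr.
rewrite -(nth_index 0 yk) nth_take // (hD j).2 //.
by case: eqP => // e; move: kj; rewrite e leqNgt ikk.
Qed.

(** Makes the matrix of the D_{s_j} y_i triangular for increasing s, because D_j kills F^p(b_0, ..,
    b_{j-1}). *)
Definition flag (s : seq nat) (ys : seq F) := size ys = size s /\
  forall i, (i < size s)%N -> ys`_i != 0 /\ adjoin p (take (nth 0%N s i).+1 b) ys`_i.

Lemma dmx_flag s ys : sorted ltn s -> flag s ys ->
  dmx D s ys = \prod_(u <- zip s ys) D u.1 u.2.
Proof.
move=> ss [sz h]; rewrite (@dmxE _ D (size s)) // det_trig.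
  rewrite (big_nth (0%N, 0)) size_zip sz minnn big_mkord; apply: eq_bigr => i _.
  by rewrite mxE nth_zip.
apply/is_trig_mxP => i j ij; rewrite mxE; apply: D_take0 (h i (ltn_ord i)).2.
by apply: (sorted_ltn_nth ltn_trans 0%N ss); rewrite ?inE.
Qed.

(** A nonzero determinant has a nonzero term, and a factor D_j y_i of it forces j to be at most
    s_i. *)
Lemma dmx_dominated s s' ys : size s' = size s -> flag s ys -> dmx D s' ys != 0 ->
  exists f : {perm 'I_(size s)}, forall i, (nth 0%N s' (f i) <= nth 0%N s i)%N.
Proof.
move=> ss' [sz h]; rewrite (@dmxE _ D (size s)) // => d0; apply: contrapT => no.
case/eqP: d0; rewrite /determinant big1 // => f _.
have [i hi] : exists i : 'I_(size s), (nth 0%N s i < nth 0%N s' (f i))%N.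
  apply: contrapT => no'; apply: no; exists f => i; rewrite leqNgt; apply/negP => hi.
  by apply: no'; exists i.
by rewrite (bigD1 i) //= mxE (D_take0 hi (h i (ltn_ord i)).2) mul0r mulr0.
Qed.

(** A numerical measure for domination: it drops strictly unless the two index sets agree. *)
Definition weight (s : seq nat) := (\sum_(i <- s) i)%N.

Lemma dominated_weight n (s s' : seq nat) (f : {perm 'I_n}) : size s = n -> size s' = n ->
  (forall i, (nth 0%N s' (f i) <= nth 0%N s i)%N) ->
  (weight s' <= weight s)%N /\ (weight s' = weight s -> perm_eq s' s).
Proof.
move=> sn s'n h.
have E (r : seq nat) : size r = n -> weight r = (\sum_(i < n) nth 0%N r i)%N.
  by move=> rn; rewrite /weight (big_nth 0%N) rn big_mkord.
have E' : weight s' = (\sum_(i < n) nth 0%N s' (f i))%N.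
  by rewrite E // (reindex_inj (@perm_inj _ f)).
have /leqif_sum L (i : 'I_n) (_ : true) := leqif_eq (h i).
rewrite E' (E s sn); split; first by have [] := L.
move/eqP; have [_ ->] := L => /forallP hh.
apply/seq.permP => P; rewrite -!sum1_count [LHS](big_nth 0%N) [RHS](big_nth 0%N).
rewrite sn s'n !big_mkord.
rewrite (reindex_inj (@perm_inj _ f)); apply: eq_bigl => i.
by have /= /eqP -> := hh i.
Qed.

(** Keeps the restriction coming from the annihilator alive on the new sets that appear when a
    leading term is subtracted. *)
Lemma dominated_count n (s s' : seq nat) (f : {perm 'I_n}) M : size s = n -> size s' = n ->
  (forall i, (nth 0%N s' (f i) <= nth 0%N s i)%N) ->
  (count (fun j => j < M)%N s <= count (fun j => j < M)%N s')%N.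
Proof.
move=> sn s'n h; rewrite -!sum1_count [X in (X <= _)%N](big_nth 0%N) [X in (_ <= X)%N](big_nth 0%N).
rewrite sn s'n !big_mkord [X in (_ <= X)%N](reindex_inj (@perm_inj _ f)).
rewrite big_mkcond [X in (_ <= X)%N]big_mkcond.
apply: leq_sum => i _; case: ifP => // iM; by rewrite (leq_ltn_trans (h i)).
Qed.

Definition nu_data n (w : o_form F) := exists (xs : seq (F * seq F)) (v : o_form F),
  [/\ log_data p b n xs, in_adjoin p b v,
      forall phi, amd phi -> ev phi w = ev phi (dlog_sum xs) &
      forall phi, amd phi -> ev phi (wp_sum p xs) = ev phi (o_fd v)].

Let coef (w : o_form F) (A : {set 'I_(size b)}) := ev (dmx D (elems A)) w.

(** Closedness is used at A with j added. Removing an index below j leaves a set heavier than A,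
    where w has no coordinate; removing an index i above j contributes a D_i, killed by the
    projection at i. Only the removal of j survives. *)
Lemma leading_condition n w (A : {set 'I_(size b)}) : nu_data n w -> #|A| = n ->
  (forall B : {set 'I_(size b)}, #|B| = n -> (weight (elems A) < weight (elems B))%N ->
    coef w B = 0) ->
  forall j, (j < N)%N -> j \notin elems A ->
    D j (projs p D [seq i <- elems A | (j < i)%N] (coef w A)) = 0.
Proof.
move=> [xs [v [h1 h2 h3 h4]]] An hmax j jN jA.
have Xb s : adjoin p b (ev (dmx D s) w) := coefficient_adjoin pF bf hD h1 h2 h3 h4 s.
pose s := sort leq (j :: elems A).
have ps : perm_eq s (j :: elems A) by rewrite perm_sort.
have us : uniq s by rewrite sort_uniq /= jA elems_uniq.
have ss : sorted ltn s by rewrite ltn_sorted_uniq_leq us sort_sorted //; exact: leq_total.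
have sb : all (fun i => i < N)%N s by rewrite (perm_all _ ps) /= jN elems_lt.
have js : j \in s by rewrite (perm_mem ps) mem_head.
have dels k : (k < size s)%N -> perm_eq (nth 0%N s k :: delnth k s) s.
  move=> ks; rewrite -[X in perm_eq _ X](cat_take_drop k s) (drop_nth 0%N ks).
  by rewrite perm_sym perm_catC /= perm_cons perm_catC.
have delS k : (k < size s)%N -> exists B : {set 'I_(size b)},
    elems B = delnth k s.
  move=> ks; apply: elems_onto.
    apply: (subseq_sorted ltn_trans _ ss); rewrite -[X in subseq _ X](cat_take_drop k s).
    rewrite (drop_nth 0%N ks); apply: cat_subseq => //; exact: subseq_cons.
  by have := sb; rewrite -(perm_all _ (dels k ks)) => /andP[].
have wdel k : (k < size s)%N ->
    (nth 0%N s k + weight (delnth k s) = j + weight (elems A))%N.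
  have pw r r' : perm_eq r r' -> weight r = weight r' by move=> h; exact: perm_big.
  by move=> ks; have := pw _ _ (dels k ks); rewrite (pw _ _ ps) /weight !big_cons.
have ij : (index j s < size s)%N by rewrite index_mem.
have := coefficient_closed pF bf hD h1 h2 h3 h4 sb.
rewrite (bigD1 (Ordinal ij)) //= nth_index // => hsum.
have delj : delnth (index j s) s = elems A.
  have [B eB] := delS _ ij; rewrite -eB.
  apply: (irr_sorted_eq ltn_trans ltnn (elems_sorted _) (elems_sorted _)) => i.
  apply: perm_mem; rewrite eB -(perm_cons j) (perm_trans _ ps) //.
  by have := dels _ ij; rewrite nth_index.
rewrite (D_projs pF hD _ _ (Xb (elems A))).
pose P := projs p D [seq i <- elems A | (j < i)%N]; rewrite -/(P _).
have PD x y : P (x + y) = P x + P y by exact: (projsD p hD).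
have Psgn k x : P ((-1) ^+ k * x) = (-1) ^+ k * P x.
  apply: (projsMc p hD) => i; rewrite -signr_odd -(rmorph_sign intr); exact: (der_int (Dd i)).
move/(congr1 P): hsum; rewrite PD [P 0](projs0 p hD) Psgn delj.
rewrite [P (\sum_(_ | _) _)](projs_sum p hD) big1 ?addr0.
  by move/eqP; rewrite mulf_eq0 signr_eq0 => /eqP.
move=> k; rewrite -val_eqE /= => kj; rewrite -/P Psgn.
have skj : nth 0%N s k != j.
  by apply: contra kj => /eqP <-; rewrite index_uniq.
(* An index below j has been traded for j, so the weight went up. *)
have [lt|le] := ltnP (nth 0%N s k) j.
  have [B eB] := delS k (ltn_ord k).
  have : coef w B = 0.
    apply: hmax.
      rewrite -size_elems eB size_delnth // size_sort /= size_elems An //.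
    have := wdel k (ltn_ord k); rewrite eB => e.
    by rewrite -(ltn_add2l (nth 0%N s k)) e ltn_add2r.
  rewrite /coef eB => ->; by rewrite (der0 (Dd _)) [P 0](projs0 p hD) mulr0.
rewrite /P (projs_D pF hD (Xb _)) ?mulr0 // mem_filter.
have lt : (j < nth 0%N s k)%N by rewrite ltn_neqAle eq_sym skj.
rewrite lt /=; have : nth 0%N s k \in s by rewrite mem_nth.
by rewrite (perm_mem ps) inE (negbTE skj).
Qed.

Lemma leading_term n w (A : {set 'I_(size b)}) : nu_data n w -> #|A| = n ->
  coef w A != 0 ->
  (forall B : {set 'I_(size b)}, #|B| = n -> (weight (elems A) < weight (elems B))%N ->
    coef w B = 0) ->
  exists (c : nat) (ys : seq F), flag (elems A) ys /\
    coef w A = c%:R * (dmx D (elems A) ys / \prod_(y <- ys) y).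
Proof.
move=> hw An A0 hmax; have [xs [v [h1 h2 h3 h4]]] := hw.
have [c [ys [sys hys e]]] := log_factorization pF hroot bf hD (elems_sorted A) (elems_lt A)
  (coefficient_adjoin pF bf hD h1 h2 h3 h4 _) A0
  (coefficient_cartier pF bf hD h1 h2 h3 h4 (elems_lt A)) (leading_condition hw An hmax).
have fl : flag (elems A) ys.
  split=> // i iA; have : (nth 0%N (elems A) i, ys`_i) \in zip (elems A) ys.
    by rewrite -nth_zip // mem_nth // size_zip sys minnn.
  by move/hys.
exists c, ys; split=> //; rewrite [LHS]e dmx_flag ?elems_sorted //; congr (_ * _).
rewrite big_split /= prodfV; congr (_ / _).
by rewrite -(big_map (fun u : nat * F => u.2) xpredT id) -/(unzip2 _) unzip2_zip ?sys.
Qed.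

Lemma nu_data_sub n w c ys s : nu_data n w -> size s = n -> flag s ys ->
  all (fun i => i < N)%N s -> nu_data n (w ++ o_dlogf (- c%:R) ys).
Proof.
move=> [xs [v [h1 h2 h3 h4]]] sn [sz h] sb.
exists (xs ++ [:: (- c%:R, ys)]), v; split=> //.
- move=> u; rewrite mem_cat inE => /orP[/h1 //|/eqP -> /=]; split.
  + by apply: (subfieldN (adjoin_subfield p b)); exact: (subfield_nat (adjoin_subfield p b)).
  + by rewrite sz.
  move=> y yys; have iy : (index y ys < size s)%N by rewrite -sz index_mem.
  have [] := h _ iy; rewrite nth_index // => y0 yb; split=> //.
  by apply: adjoin_sub yb => z; exact: mem_take.
- move=> phi pa; by rewrite ev_cat h3 // /dlog_sum map_cat flatten_cat ev_cat.
- move=> phi pa; rewrite /wp_sum map_cat flatten_cat ev_cat -/(wp_sum p xs) h4 //=.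
  (* The coefficient -c lies in the prime field, where x^p - x vanishes; the primitive v therefore
     stays the same. *)
  by rewrite ev1 expp_opp // expp_nat // subrr !mul0r addr0.
Qed.

Lemma nu_data_zero n w : nu_data n w -> (forall A, coef w A = 0) ->
  forall phi, amd phi -> ev phi w = 0.
Proof.
move=> [xs [v [h1 _ h3 _]]] w0 phi pa; rewrite h3 // (ev_expand pF hD b0 pa).
  rewrite big1 // => A _; rewrite -h3 ?[ev _ w]w0 ?mul0r //; exact: dmx_amd.
move=> u0 x /flattenP[_ /mapP[u uxs ->]]; have [_ _ hu] := h1 u uxs.
by rewrite inE => /eqP -> /hu [].
Qed.

Lemma nu_data_coef n w A : nu_data n w -> coef w A != 0 -> #|A| = n.
Proof.
move=> [xs [v [h1 _ h3 _]]]; rewrite /coef h3; last exact: dmx_amd.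
move=> h; apply/eqP; move: h; apply: contraR => An.
rewrite /ev big_seq big1 // => u0 /flattenP[_ /mapP[u uxs ->]].
have [_ un _] := h1 u uxs.
rewrite inE => /eqP -> /=; rewrite dmx_size ?mulr0 // size_elems un eq_sym //.
Qed.

(** [Q M k] lists the admissible alternatives: at least k indices of A below M. Part (a) needs two
    of them, part (b) one. For each product split off, the alternative valid for its leading set
    becomes membership of its first k factors in F^p(b_0, .., b_{M-1}). *)
Lemma nu_decomposition (Q : nat -> nat -> Prop) n w : nu_data n w ->
  (forall A, coef w A != 0 ->
     exists M k, Q M k /\ (k <= count (fun j => j < M)%N (elems A))%N) ->
  exists zs : seq (seq F),
    (forall z, z \in zs -> [/\ size z = n, forall y, y \in z -> y != 0 &
        exists M k, [/\ Q M k, (k <= n)%N & forall y, y \in take k z -> adjoin p (take M b) y]]) /\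
    forall phi, amd phi -> ev phi w = \sum_(z <- zs) ev phi (o_dlogf 1 z).
Proof.
move=> hw hQ.
have [R hR] : exists R, forall A, coef w A != 0 -> (weight (elems A) < R)%N.
  exists (\max_(A : {set 'I_(size b)}) weight (elems A)).+1 => A _.
  by rewrite ltnS; exact: (leq_bigmax A).
elim: R w hw hQ hR => [|R IHR] w hw hQ hR.
  exists [::]; split=> // phi pa; rewrite big_nil (nu_data_zero hw) // => A.
  by apply/eqP/negP => /negP /hR.
(* Inner induction on the number of sets of maximal weight R; the outer one lowers the bound on the
   weights. *)
pose top w := [set A | (coef w A != 0) && (weight (elems A) == R)].
move: {2}(#|top w|) (leqnn #|top w|) => m; elim: m w hw hQ hR => [|m IHm] w hw hQ hR.
  rewrite leqn0 cards_eq0 => /eqP t0; apply: IHR => // A A0.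
  have := hR A A0; rewrite ltnS leq_eqVlt => /orP[AR|//].
  by move/setP: t0 => /(_ A); rewrite !inE A0 AR.
have [t0|[A]] := set_0Vmem (top w).
  by move=> _; apply: IHm => //; rewrite t0 cards0.
rewrite inE => /andP[A0 /eqP AR] tm.
have An := nu_data_coef hw A0.
have [|c [ys [fl e]]] := leading_term hw An A0.
  move=> B _ AB; apply/eqP/negP => /negP /hR; rewrite ltnS leqNgt -AR AB //.
pose w' := w ++ o_dlogf (- c%:R) ys.
have w'E B : coef w' B = coef w B - c%:R * (dmx D (elems B) ys / \prod_(y <- ys) y).
  by rewrite /coef ev_cat ev_dlog; ring.
have sA : size (elems A) = n by rewrite size_elems.
have dom B : dmx D (elems B) ys != 0 -> [/\ (weight (elems B) <= R)%N,
    weight (elems B) = R -> B = A &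
    forall M, (count (fun j => j < M)%N (elems A) <= count (fun j => j < M)%N (elems B))%N].
  move=> dB; have sB : size (elems B) = size (elems A).
    apply/eqP; move: dB; apply: contraR => sB; rewrite dmx_size // fl.1 eq_sym //.
  have [f hf] := dmx_dominated sB fl dB.
  have [h1 h2] := dominated_weight erefl sB hf; rewrite -AR; split=> //.
    move=> /h2 /perm_mem h; apply: elems_inj.
    exact: (irr_sorted_eq ltn_trans ltnn (elems_sorted _) (elems_sorted _)).
  by move=> M; exact: dominated_count hf.
have w'A : coef w' A = 0 by rewrite w'E e subrr.
have w'B B : coef w' B != 0 -> coef w B = 0 -> dmx D (elems B) ys != 0.
  by move=> + B0; rewrite w'E B0; apply: contraNneq => ->; rewrite mul0r mulr0 subr0.
have w'top B : coef w' B != 0 -> weight (elems B) = R -> coef w B != 0.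
  move=> B0 BR; apply/eqP => B0'; have [_ /(_ BR) BA _] := dom _ (w'B _ B0 B0').
  by move: B0; rewrite BA w'A eqxx.
have [||||zs [hzs zsE]] := IHm w'.
- exact: nu_data_sub (elems_lt A).
- move=> B B0; have [B0'|B0'] := eqVneq (coef w B) 0; last exact: hQ.
  have [_ _ hc] := dom _ (w'B _ B0 B0'); have [M [k [hMk hk]]] := hQ _ A0.
  by exists M, k; split=> //; exact: leq_trans (hc M).
- move=> B B0; have [B0'|B0'] := eqVneq (coef w B) 0; last exact: hR.
  by have [] := dom _ (w'B _ B0 B0').
- rewrite -ltnS (leq_trans _ tm) // proper_card //; apply/properP; split.
    by apply/subsetP => B; rewrite !inE => /andP[B0 /eqP BR]; rewrite BR eqxx andbT w'top.
  by exists A; rewrite !inE ?A0 ?AR ?eqxx // w'A eqxx.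
(* The factor c is a natural number, so it is realized by c copies of the same product. *)
exists (nseq c ys ++ zs); split.
  move=> z; rewrite mem_cat => /orP[|/hzs //]; rewrite mem_nseq => /andP[_ /eqP ->].
  have [M [k [hMk hk]]] := hQ _ A0.
  have kn : (k <= n)%N by rewrite (leq_trans hk) // -sA count_size.
  have [fz ff] := fl; split; first by rewrite fz.
    move=> y yys; rewrite -(nth_index 0 yys); apply: (ff _ _).1.
    by rewrite -fz index_mem.
  exists M, k; split=> // y yk.
  have ik : (index y (take k ys) < k)%N.
    by rewrite -[X in (_ < X)%N](@size_takel k _ ys) ?index_mem // fz sA.
  rewrite -(nth_index 0 yk) nth_take //.
  have [_] := ff (index y (take k ys)) (leq_trans ik (leq_trans kn (eq_leq (esym sA)))).
  apply: adjoin_sub => u; have lt := sorted_count_nth (elems_sorted A) hk ik.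
  by rewrite -(subnKC lt) takeD mem_cat => ->.
move=> phi pa; rewrite big_cat -zsE //= ev_cat addrCA big_nseq.
have -> : forall x : F, iter c (+%R x) 0 = c%:R * x.
  by move=> x; rewrite mulr_natl; elim: (c) => //= m' ->; rewrite mulrS.
by rewrite !ev_dlog; ring.
Qed.

End LeadingTerms.

(** * Annihilators *)

Section LogarithmicForms.

Variables (F : fieldType) (p : nat).
Hypothesis pF : p \in [pchar F].

(* [o_nu] without the requirement that the representative itself be homogeneous. *)
Definition nu_class (n : nat) (w : o_form F) := exists xs : seq (F * seq F),
  [/\ forall u, u \in xs -> (size u.2 == n) && all (fun a => a != 0) u.2,
      forall phi, amd phi -> ev phi w = ev phi (dlog_sum xs) &
      o_exactf n (wp_sum p xs)].

Lemma nu_nu_class n (w : o_form F) : o_nu p n w -> nu_class n w.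
Proof. by move=> [_ [xs [h1 [/(oeqP pF) h2 h3]]]]; exists xs. Qed.

Lemma nu_class_nu n (w : o_form F) : o_hom n w -> nu_class n w -> o_nu p n w.
Proof.
move=> hw [xs [h1 h2 h3]]; split=> //; exists xs; split=> //; split=> //.
exact/(oeqP pF).
Qed.

Lemma exactf_oeq n (w w' : o_form F) : (forall phi, amd phi -> ev phi w = ev phi w') ->
  o_exactf n w -> o_exactf n w'.
Proof.
move=> e [h|[m [v [nm [vm h]]]]].
  by left; apply/(ozeroP pF) => phi pa; rewrite -e // (ev_ozero pa h).
right; exists m, v; split=> //; split=> //; apply/(oeqP pF) => phi pa.
by rewrite -e // (ev_oeq pa h).
Qed.

Lemma exactf_cat n (w w' : o_form F) : o_exactf n w -> o_exactf n w' -> o_exactf n (w ++ w').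
Proof.
move=> [h|[m [v [nm [vm h]]]]] h'.
  by apply: exactf_oeq h' => phi pa; rewrite ev_cat (ev_ozero pa h) add0r.
case: h' => [h'|[m' [v' [nm' [vm' h']]]]].
  right; exists m, v; split=> //; split=> //; apply/(oeqP pF) => phi pa.
  by rewrite ev_cat (ev_ozero pa h') addr0 (ev_oeq pa h).
right; exists m, (v ++ v'); split=> //; split.
  by rewrite /o_hom all_cat -!/(o_hom _ _) vm; move: vm'; rewrite (_ : m' = m) //; lia.
apply/(oeqP pF) => phi pa.
by rewrite [o_fd _]map_cat !ev_cat (ev_oeq pa h) (ev_oeq pa h').
Qed.

Lemma nu_class_cat n (w w' : o_form F) : nu_class n w -> nu_class n w' -> nu_class n (w ++ w').
Proof.
move=> [xs [h1 h2 h3]] [xs' [h1' h2' h3']]; exists (xs ++ xs'); split.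
- by move=> u; rewrite mem_cat => /orP[/h1|/h1'].
- by move=> phi pa; rewrite ev_cat h2 // h2' // /dlog_sum map_cat flatten_cat ev_cat.
- by rewrite /wp_sum map_cat flatten_cat; exact: exactf_cat.
Qed.

Lemma nu_class_eq n (w w' : o_form F) : (forall phi, amd phi -> ev phi w = ev phi w') ->
  nu_class n w -> nu_class n w'.
Proof. by move=> e [xs [h1 h2 h3]]; exists xs; split=> // phi pa; rewrite -e // h2. Qed.

Lemma nu_class_nil n : nu_class n [::].
Proof.
by exists [::]; split=> //; left; apply/(ozeroP pF) => phi _; rewrite ev_nil.
Qed.

Lemma nu_class_neg n (w : o_form F) : nu_class n w -> nu_class n (o_fneg w).
Proof.
move=> [xs [h1 h2 h3]]; exists [seq (- u.1, u.2) | u <- xs]; split.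
- by move=> _ /mapP[u /h1 hu ->].
- move=> phi pa; rewrite ev_neg h2 // /dlog_sum -map_comp !ev_flatten -sumrN.
  by apply: eq_bigr => u _; rewrite !ev_dlog !mulNr.
have E phi : ev phi (wp_sum p [seq (- u.1, u.2) | u <- xs]) = - ev phi (wp_sum p xs).
  rewrite /wp_sum -map_comp !ev_flatten -sumrN; apply: eq_bigr => u _ /=.
  by rewrite !ev_dlog expp_opp // -opprD !mulNr.
case: h3 => [h|[m [v [nm [vm h]]]]].
  by left; apply/(ozeroP pF) => phi pa; rewrite E (ev_ozero pa h) oppr0.
right; exists m, (o_fneg v); split=> //; split.
  by rewrite /o_hom all_map.
apply/(oeqP pF) => phi pa; rewrite E (ev_oeq pa h) !ev_fd big_map -sumrN.
by apply: eq_bigr => u _ /=; rewrite mulN1r (derN (amd_der_hd pa u.2)).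
Qed.

Lemma nu_class_addgen n (P : o_form F -> Prop) (w : o_form F) :
  (forall u, P u -> nu_class n u) -> o_addgen P w -> nu_class n w.
Proof.
move=> hP [us [hus /(oeqP pF) e]].
apply: nu_class_eq (fun phi pa => esym (e phi pa)) _.
elim: us hus {e} => [|u us IH] hus /=; first exact: nu_class_nil.
apply: nu_class_cat; last by apply: IH => v vu; apply: hus; rewrite inE vu orbT.
have := hP _ (hus u (mem_head _ _)).
by case: ifP => // _; exact: nu_class_neg.
Qed.

Lemma nu_class_wedge k (ys : seq F) (w : o_form F) : all (fun a => a != 0) ys ->
  nu_class k w -> nu_class (size ys + k) (o_fwedge (o_dlogf 1 ys) w).
Proof.
move=> ys0 [xs [h1 h2 h3]]; pose q := (\prod_(y <- ys) y)^-1.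
have wE phi v : ev phi (o_fwedge (o_dlogf 1 ys) v) = q * ev (fun t => phi (ys ++ t)) v.
  by rewrite ev_wedge ev_dlog div1r.
exists [seq (u.1, ys ++ u.2) | u <- xs].
have E (c : F -> F) phi : ev phi (flatten [seq o_dlogf (c u.1) (ys ++ u.2) | u <- xs]) =
    q * ev (fun t => phi (ys ++ t)) (flatten [seq o_dlogf (c u.1) u.2 | u <- xs]).
  rewrite !ev_flatten mulr_sumr; apply: eq_bigr => u _.
  by rewrite !ev_dlog big_cat /= invfM -/q; ring.
split.
- by move=> _ /mapP[u /h1 /andP[/eqP us u0] ->] /=; rewrite size_cat us eqxx all_cat ys0.
- move=> phi pa; rewrite wE /dlog_sum -map_comp (E id) h2 //; exact: amd_prepend.
have {}E phi := E (fun x => x ^+ p - x) phi.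
rewrite /wp_sum -map_comp; case: h3 => [h|[m [v [nm [vm h]]]]].
  left; apply/(ozeroP pF) => phi pa; rewrite [LHS]E.
  by rewrite (ev_ozero (amd_prepend ys pa) h) mulr0.
right; exists (size ys + m)%N, [seq ((-1) ^+ size ys * (q * u.1), ys ++ u.2) | u <- v].
split; first by rewrite nm addnS.
split.
  rewrite /o_hom all_map; apply: sub_all vm => u /= /eqP <-; by rewrite size_cat.
apply/(oeqP pF) => phi pa; rewrite [LHS]E (ev_oeq (amd_prepend ys pa) h) !ev_fd.
rewrite big_map mulr_sumr; apply: eq_bigr => u _ /=.
have dh := amd_der_hd pa (ys ++ u.2).
have dq : phi (q :: ys ++ u.2) = 0.
  by apply: (der_prodV_seq dh) => y yy; apply: amd_mem_dup => //; rewrite mem_cat yy.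
have ds : phi ((-1) ^+ size ys :: ys ++ u.2) = 0.
  by rewrite -signr_odd -(rmorph_sign intr); exact: (der_int dh).
have := amd_move pa [::] ys u.2 u.1; rewrite /= => ->.
by rewrite (derMc dh) // (derMc dh) //; ring.
Qed.

Definition log_products (t : nat) (b : seq F) (v : o_form F) := exists ys : seq F,
  [/\ size ys = t, forall y, y \in ys -> adjoin p b y /\ y != 0 & v = o_dlogf 1 ys].

Lemma ev_addgen_eq0 (P : o_form F -> Prop) phi w : amd phi -> o_addgen P w ->
  (forall u, P u -> ev phi u = 0) -> ev phi w = 0.
Proof.
move=> pa [us [hus /(oeqP pF) e]] h; rewrite e // ev_flatten big_seq big1 // => u /hus hu.
by case: ifP => _; rewrite ?ev_neg h // oppr0.
Qed.

Lemma wedge_logs_nu t n b w :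
  o_wedgeS (o_addgen (log_products t b)) (o_nuZ p (n%:Z - t%:Z)) w -> nu_class n w.
Proof.
apply: nu_class_addgen => _ [x [y [hx [hy ->]]]].
have [tn|nt] := leqP t n; last first.
  have {}hy : y = [::] by move: hy; case e: (n%:Z - t%:Z) => [k|k] //; move: e; lia.
  apply: nu_class_eq (nu_class_nil n) => phi pa; rewrite ev_nil ev_wedge hy /ev.
  by rewrite big1 // => u _; rewrite big_nil mulr0.
move: hy; rewrite subzn // => /nu_nu_class hy.
have [us [hus /(oeqP pF) e]] := hx.
apply: (@nu_class_addgen n (fun v => nu_class n v)) => //.
exists [seq (u.1, o_fwedge u.2 y) | u <- us]; split.
  move=> _ /mapP[u /hus [ys [st yb ->]] ->] /=.
  rewrite -(subnKC tn) -st; apply: nu_class_wedge => //; last by rewrite st.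
  by apply/allP => z /yb [].
apply/(oeqP pF) => phi pa; rewrite ev_wedge e; last exact: amd_ev_append.
rewrite -map_comp !ev_flatten; apply: eq_bigr => u _ /=.
by case: ifP => _; rewrite ?ev_neg ev_wedge.
Qed.

(** The easy inclusion: t factors and the entries of s all lie in F^p(b) and are more numerous than
    b, so the pigeonhole principle applies. *)
Lemma wedge_logs_ann t n b w s phi : amd phi ->
  o_wedgeS (o_addgen (log_products t b)) (o_nuZ p (n%:Z - t%:Z)) w ->
  (forall x, x \in s -> adjoin p b x) -> (size b < t + size s)%N ->
  ev (fun r => phi (r ++ s)) w = 0.
Proof.
move=> pa hw sb bts; apply: (ev_addgen_eq0 (amd_append s pa) hw) => _ [x [y [hx [_ ->]]]].
rewrite ev_wedge; apply: (ev_addgen_eq0 (amd_ev_append y (amd_append s pa)) hx).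
move=> _ [ys [st yb ->]]; rewrite ev_dlog [ev _ y]big1 ?mulr0 // => u _.
suff -> : phi ((ys ++ u.2) ++ s) = 0 by rewrite mulr0.
rewrite -catA; apply: (amd_perm0 pa (t := s ++ u.2)); first exact: permEl (perm_catC _ _).
rewrite catA; apply: (amd_pigeon pF (amd_append u.2 pa) (b := b)).
  by move=> z; rewrite mem_cat => /orP[/yb []|/sb].
by rewrite size_cat st.
Qed.

Lemma wedge_logs_intro t n b zs (w : o_form F) :
  (forall z, z \in zs -> [/\ size z = n, forall y, y \in z -> y != 0, (t <= n)%N &
     forall y, y \in take t z -> adjoin p b y]) ->
  (forall phi, amd phi -> ev phi w = \sum_(z <- zs) ev phi (o_dlogf 1 z)) ->
  o_wedgeS (o_addgen (log_products t b)) (o_nuZ p (n%:Z - t%:Z)) w.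
Proof.
move=> hz e; exists [seq (false, o_fwedge (o_dlogf 1 (take t z)) (o_dlogf 1 (drop t z))) | z <- zs].
split.
  move=> _ /mapP[z /hz [zn z0 tn zb] ->] /=.
  exists (o_dlogf 1 (take t z)), (o_dlogf 1 (drop t z)); split.
    exists [:: (false, o_dlogf 1 (take t z))]; split.
      move=> u; rewrite inE => /eqP -> /=; exists (take t z); split=> //.
        by rewrite size_takel // zn.
      by move=> y yt; split; [exact: zb|apply: z0; exact: mem_take yt].
    by apply/(oeqP pF).
  split=> //; rewrite subzn //; apply: nu_class_nu.
    by rewrite /o_hom /= andbT size_drop zn.
  exists [:: (1, drop t z)]; split.
  - move=> u; rewrite inE => /eqP -> /=; rewrite size_drop zn eqxx /=.
    by apply/allP => y yd; apply: z0; exact: mem_drop yd.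
  - by [].
  left; apply/(ozeroP pF) => phi pa; rewrite /wp_sum /= ev1.
  by rewrite expr1n subrr !mul0r.
apply/(oeqP pF) => phi pa; rewrite e // -map_comp ev_flatten !big_seq.
apply: eq_bigr => z /hz [zn z0 tn _] /=; rewrite ev_wedge ev_dlog !ev_dlog.
rewrite cat_take_drop -{1}(cat_take_drop t z) big_cat /= invfM; ring.
Qed.

(** The entries of the primitive of wp(w) are absorbed into F^p(b ++ b') as well, because the
    weight-zero projections of its differential are taken there. *)
Lemma nu_setup n (w : o_form F) (b : seq F) : o_nu p n w -> pfree p b ->
  exists (b' : seq F) (D : nat -> F -> F),
    [/\ pfree p (b ++ b'), dual_to (b ++ b') D & nu_data p (b ++ b') n w].
Proof.
move=> [_ [xs [h1 [/(oeqP pF) h2 h3]]]] bf.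
have [v hv] : exists v, forall phi, amd phi -> ev phi (wp_sum p xs) = ev phi (o_fd v).
  case: h3 => [h|[m [v [_ [_ /(oeqP pF) h]]]]]; last by exists v.
  by exists [::] => phi pa; rewrite (ev_ozero pa h) ev_nil.
pose support (f : o_form F) := flatten [seq u.1 :: u.2 | u <- f].
have inS (f : o_form F) u : u \in f -> {subset u.1 :: u.2 <= support f}.
  move=> uf x xu; apply/flattenP; exists (u.1 :: u.2) => //.
  exact: (map_f (fun u : F * seq F => u.1 :: u.2)).
have [b' [b'f b'c]] := pfree_extend (support xs ++ support v) bf.
have [D hD] := dual_derivations pF b'f.
exists b', D; split=> //; exists xs, v; split=> //.
- move=> u uxs; have hu x : x \in u.1 :: u.2 -> adjoin p (b ++ b') x.
    by move=> xu; apply: b'c; rewrite mem_cat (inS xs u).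
  have /andP[/eqP us u0] := h1 u uxs; split=> //; first by apply: hu; rewrite mem_head.
  by move=> y yu; split; [apply: hu; rewrite inE yu orbT|exact: (allP u0)].
- move=> u uv; have hu x : x \in u.1 :: u.2 -> adjoin p (b ++ b') x.
    by move=> xu; apply: b'c; rewrite mem_cat (inS v u) ?orbT.
  by split=> [|x xu]; apply: hu; rewrite inE ?eqxx // xu orbT.
Qed.

(** The coordinate of w /\ db_J at the disjoint union of A and J is a nonzero multiple of the
    coordinate of w at A. *)
Lemma annihilated_coef (b : seq F) (D : nat -> F -> F) (w : o_form F)
  (A : {set 'I_(size b)}) (J : seq nat) : pfree p b -> dual_to b D ->
  all (fun i => i < size b)%N J -> uniq J -> (forall k, k \in J -> k \notin elems A) ->
  (forall phi, amd phi -> ev (fun t => phi (t ++ [seq b`_i | i <- J])) w = 0) ->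
  ev (dmx D (elems A)) w = 0.
Proof.
move=> bf hD Jb Ju JA h; have Dd i : der (D i) := (hD i).1.
have := h _ (dmx_amd Dd (elems A ++ J)).
rewrite (_ : ev _ w = \prod_(i <- J) b`_i * ev (dmx D (elems A)) w).
  move/eqP; rewrite mulf_eq0 => /orP[|/eqP //].
  by rewrite (negbTE (prod_basis_neq0 (fun i ib => pfree_neq0 bf ib) Jb)).
by rewrite /ev mulr_sumr; apply: eq_bigr => u _; rewrite dmx_cat //; ring.
Qed.

Lemma count_complement (s : seq nat) k : uniq s ->
  (size [seq i <- iota 0 k | i \notin s] + count (fun j => j < k)%N s = k)%N.
Proof.
move=> us; rewrite size_filter -[in RHS](size_iota 0 k) -(count_predC (mem s)) addnC.
congr (_ + _)%N; rewrite -!size_filter; apply: perm_size.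
apply: uniq_perm; rewrite ?filter_uniq ?iota_uniq // => i.
by rewrite !mem_filter mem_iota add0n andbC.
Qed.

Lemma der_ev_slot (w : o_form F) (phi : seq F -> F) l r : amd phi ->
  der (fun x => ev (fun t => phi (t ++ l ++ x :: r)) w).
Proof.
move=> pa; have dd t : der (fun x => phi (t ++ l ++ x :: r)).
  have := amd_der pa (t ++ l) r; rewrite (_ : (fun x => _) = fun x => phi (t ++ l ++ x :: r)) //.
  by apply/funext => x; rewrite catA.
split=> x y.
  by rewrite /ev -big_split; apply: eq_bigr => u _; rewrite (derD (dd _)) mulrDr.
rewrite /ev !mulr_sumr -big_split; apply: eq_bigr => u _.
by rewrite (derM (dd _)) /=; ring.
Qed.

(** With the other slots fixed, the pairing is a derivation in the remaining slot; if it vanishes on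
    S it vanishes on F^p(S). The slots are enlarged one after another. *)
Lemma wedge_adjoin (S : F -> Prop) r (w : o_form F) :
  (forall s, size s = r -> (forall x, x \in s -> S x) ->
     forall phi, amd phi -> ev (fun t => phi (t ++ s)) w = 0) ->
  forall s, size s = r -> (forall x, x \in s -> o_FpC p S x) ->
     forall phi, amd phi -> ev (fun t => phi (t ++ s)) w = 0.
Proof.
move=> h s sr sS; suff : forall s2, (size s + size s2 = r)%N -> (forall x, x \in s2 -> S x) ->
    forall phi, amd phi -> ev (fun t => phi (t ++ s ++ s2)) w = 0.
  by move=> /(_ [::]); rewrite cats0 sr addn0; apply.
elim/last_ind: s {sr} sS => [|s x IH] sS s2 ss s2S phi pa; first exact: h.
have {}IH y : S y -> ev (fun t => phi (t ++ s ++ y :: s2)) w = 0.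
  move=> Sy; apply: IH => //.
  - by move=> z zs; apply: sS; rewrite mem_rcons inE zs orbT.
  - by move: ss; rewrite size_rcons /= addSnnS.
  - by move=> z; rewrite inE => /orP[/eqP ->|/s2S].
have dd := der_ev_slot w s s2 pa.
rewrite cat_rcons; have : o_FpC p S x by apply: sS; rewrite mem_rcons mem_head.
exact: (der_eq0_on pF dd IH).
Qed.

(** The factor u is the product of the ratios ds_i / da_i and does not depend on phi. *)
Lemma slot_subst (s a : seq F) : size s = size a ->
  (forall i, (i < size a)%N -> o_FpC p (fun y => y = a`_i) s`_i) ->
  exists u, forall phi, amd phi -> forall l r, phi (l ++ s ++ r) = u * phi (l ++ a ++ r).
Proof.
elim: s a => [|x s IH] [|y a] //= sa h.
  by exists 1 => phi _ l r; rewrite mul1r.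
have [|v hv] := IH a _ (fun i => h i.+1); first by case: sa.
have [u hu] := adjoin1_der pF (h 0%N isT).
exists (u * v) => phi pa l r; rewrite -cat_rcons hv // cat_rcons.
by rewrite (hu _ (amd_der pa l (a ++ r))) mulrA [v * u]mulrC.
Qed.

(** An entry lying in F^p of its predecessors would make the product vanish by the pigeonhole
    principle. *)
Lemma wedge_neq0_pfree (s : seq F) : ~ o_ozero [:: (1 : F, s)] -> pfree p s.
Proof.
move=> s0 i is_ hi; apply: s0; apply/(ozeroP pF) => phi pa; rewrite ev1 mul1r.
rewrite -(cat_take_drop i.+1 s).
apply: (amd_pigeon pF (amd_append (drop i.+1 s) pa) (b := take i s)).
  move=> x; rewrite (take_nth 0 is_) mem_rcons inE => /orP[/eqP -> //|]; exact: adjoin_mem.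
by rewrite (take_nth 0 is_) size_rcons.
Qed.

Lemma ann_ev (w : o_form F) s : o_ozero (o_fwedge w [:: (1, s)]) <->
  forall phi, amd phi -> ev (fun t => phi (t ++ s)) w = 0.
Proof.
split=> [h phi pa|h].
  rewrite -(ev_ozero pa h) ev_wedge; apply: eq_ev => u _; by rewrite ev1 mul1r.
apply/(ozeroP pF) => phi pa; rewrite -(h phi pa) ev_wedge.
by apply: eq_ev => u _; rewrite ev1 mul1r.
Qed.

End LogarithmicForms.

(** * Annihilators of products of differentials *)

Section Annihilators.

Variables (F : fieldType) (p : nat).
Hypothesis pF : p \in [pchar F].
Hypothesis hroot : forall x : F, exists y : F, x = y ^+ p.-1.

Lemma wedgeS_mono (P P' Y : o_form F -> Prop) w : (forall v, P v -> P' v) ->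
  o_wedgeS (o_addgen P) Y w -> o_wedgeS (o_addgen P') Y w.
Proof.
move=> h [us [hus e]]; exists us; split=> // u /hus [x [y [[vs [hvs ex]] [hy ->]]]].
exists x, y; split=> //; exists vs; split=> // v /hvs; exact: h.
Qed.

Lemma nth_map_iota_prefix (a c : seq F) : [seq (a ++ c)`_i | i <- iota 0 (size a)] = a.
Proof.
apply: (@eq_from_nth _ 0); rewrite size_map size_iota // => i ia.
by rewrite (nth_map 0%N) ?size_iota // nth_iota // nth_cat ia.
Qed.

Lemma ann_power n k (S : F -> Prop) (a : seq F) :
  size a = k -> uniq a -> o_pindep p (fun x => x \in a) ->
  (forall x, x \in a -> o_FpC p S x) -> (forall x, adjoin p a x <-> o_FpC p S x) ->
  forall r w, o_hom n w ->
  (o_annnu p n (fun u => exists s : seq F, size s = r /\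
                   (forall x, x \in s -> S x) /\ u = [:: (1, s)]) w <->
   if (r <= k)%N then
     o_wedgeS (o_addgen (log_products p (k - r).+1 a)) (o_nuZ p (n%:Z - (k - r).+1%:Z)) w
   else o_nu p n w).
Proof.
move=> ak ua ia aS Sa r w hw; have af := pindep_pfree pF ia ua.
case: (leqP r k) => [rk|kr]; last first.
  split=> [[]//|hn]; split=> // u [s [sr [sS ->]]]; apply/(ann_ev pF) => phi pa.
  rewrite /ev big1 // => v _; rewrite (amd_pigeon pF (amd_prepend v.2 pa) (b := a)) ?mulr0 //.
    by move=> x /sS Sx; apply/Sa; exact: FpC_gen.
  by rewrite ak sr.
split=> [[hn hann]|hR]; last first.
  split; first by apply: (nu_class_nu pF) => //; exact: (wedge_logs_nu pF hR).
  move=> u [s [sr [sS ->]]]; apply/(ann_ev pF) => phi pa.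
  apply: (wedge_logs_ann pF pa hR); first by move=> x /sS Sx; apply/Sa; exact: FpC_gen.
  by rewrite ak sr; lia.
have hS : forall s, size s = r -> (forall x, x \in s -> o_FpC p S x) ->
    forall phi, amd phi -> ev (fun t => phi (t ++ s)) w = 0.
  apply: (wedge_adjoin pF) => s sr sS phi pa.
  by have /(ann_ev pF) := hann _ (ex_intro _ s (conj sr (conj sS erefl))); apply.
have [b' [D [bf hD hw']]] := nu_setup pF hn af.
pose Q M t := M = k /\ t = (k - r).+1.
have [|zs [hz e]] := nu_decomposition pF hroot bf hD hw' (Q := Q).
  move=> A A0; exists k, (k - r).+1; split=> //; rewrite ltnNge; apply/negP => cA.
  (* If at most k - r of the first k indices belong to A, at least r are missing. Wedging with the
     differentials of r missing basis elements gives 0 and exposes the coordinate at A. *)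
  case/eqP: A0; pose J := take r [seq i <- iota 0 k | i \notin elems A].
  have sJ : size J = r.
    rewrite size_takel //; have := count_complement k (elems_uniq A).
    by set c1 := size _; set c2 := count _ _ in cA *; move: cA rk; clear; lia.
  have Jk i : i \in J -> (i < k)%N /\ i \notin elems A.
    by move/mem_take; rewrite mem_filter mem_iota => /andP[].
  have kb : (k <= size (a ++ b'))%N by rewrite size_cat ak leq_addr.
  apply: (annihilated_coef bf hD (J := J)).
  - by apply/allP => i /Jk [ik _]; exact: leq_trans kb.
  - by rewrite take_uniq // filter_uniq // iota_uniq.
  - by move=> i /Jk [].
  move=> phi pa; apply: hS => //; first by rewrite size_map.
  move=> _ /mapP[i /Jk [ik _] ->]; apply: aS.
  by rewrite nth_cat ak ik mem_nth // ak.
apply: (wedge_logs_intro pF _ e) => z /hz [zn z0 [M [t [[-> ->] tn zb]]]].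
by split=> // y /zb; rewrite -ak take_size_cat.
Qed.

Lemma seq_split (T : eqType) (P Q : T -> Prop) (zs : seq T) :
  (forall z, z \in zs -> P z \/ Q z) ->
  exists zs1 zs2 : seq T, [/\ forall z, z \in zs1 -> P z, forall z, z \in zs2 -> Q z &
    forall f : T -> F, \sum_(z <- zs) f z = \sum_(z <- zs1) f z + \sum_(z <- zs2) f z].
Proof.
elim: zs => [|z zs IH] h.
  by exists [::], [::]; split=> // f; rewrite !big_nil addr0.
have [|zs1 [zs2 [h1 h2 h3]]] := IH; first by move=> y yz; apply: h; rewrite inE yz orbT.
have [hz|hz] := h z (mem_head _ _).
  exists (z :: zs1), zs2; split=> // [y|f]; first by rewrite inE => /orP[/eqP ->|/h1].
  by rewrite !big_cons h3 addrA.
exists zs1, (z :: zs2); split=> // [y|f]; first by rewrite inE => /orP[/eqP ->|/h2].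
by rewrite !big_cons h3 addrCA.
Qed.

(** Up to a nonzero factor, wedging with ds_1 /\ .. /\ ds_r is wedging with da_1 /\ .. /\ da_r. A
    set A carrying a nonzero coordinate then either contains an index of some a_i or contains the
    indices of all e_j; these two cases yield the two summands. *)
Lemma ann_product n r m (S : nat -> F -> Prop) (a e s0 : seq F) :
  size s0 = r.+1 -> (forall i, (i <= r)%N -> S i s0`_i) -> ~ o_ozero [:: (1, s0)] ->
  (r < m)%N -> size a = r -> size e = (m - r)%N -> uniq (a ++ e) ->
  o_pindep p (fun x => x \in a ++ e) ->
  (forall i, (i < r)%N -> forall x, o_FpC p (S i) x <-> o_FpC p (fun y => y = a`_i) x) ->
  (forall x, o_genfield (adjoin p a) (S r) x <-> o_genfield (adjoin p a) (fun y => y \in e) x) ->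
  forall w, o_hom n w ->
  (o_annnu p n (fun u => exists s : seq F, size s = r.+1 /\
                 (forall i, (i <= r)%N -> S i (nth 0 s i)) /\ u = [:: (1, s)]) w <->
   exists w1 w2 : o_form F,
     o_wedgeS (o_addgen (log_products p 1 a)) (o_nuZ p (n%:Z - 1%:Z)) w1 /\
     o_wedgeS (o_addgen (log_products p (m - r) (a ++ e))) (o_nuZ p (n%:Z - (m - r)%N%:Z)) w2 /\
     o_oeq w (w1 ++ w2)).
Proof.
move=> ss0 s0S s0n rm ar em ue ie Sa Se w hw; have bf0 := pindep_pfree pF ie ue.
have Sia i x : (i < r)%N -> S i x -> o_FpC p (fun y => y = a`_i) x.
  by move=> ir Sx; apply/(Sa _ ir); exact: FpC_gen.
have aS x : S r x -> adjoin p (a ++ e) x.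
  move=> Sx; have /(Se x) := genfield_gen Sx (K := adjoin p a).
  apply: (genfield_ind pF) => [y|y|y ye|y z|y z].
  - exact: FpC_pow.
  - by apply: adjoin_sub => u ua; rewrite mem_cat ua.
  - by apply: adjoin_mem; rewrite mem_cat ye orbT.
  - exact: (subfieldD (adjoin_subfield p _)).
  - exact: (subfieldM (adjoin_subfield p _)).
have firsts (s : seq F) : size s = r.+1 -> (forall i, (i <= r)%N -> S i s`_i) ->
    forall x, x \in take r s -> adjoin p a x.
  move=> sr sS x xs; have ir : (index x (take r s) < r)%N.
    by rewrite -[X in (_ < X)%N](@size_takel r _ s) ?index_mem // sr.
  rewrite -(nth_index 0 xs) nth_take //.
  have := Sia _ _ ir (sS _ (ltnW ir)); apply: FpC_sub => y ->.
  by apply: adjoin_mem; rewrite mem_nth // ar.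
have splitlast (s : seq F) : size s = r.+1 -> s = rcons (take r s) s`_r.
  by move=> sr; rewrite -(take_nth 0) ?sr // -sr take_size.
split=> [[hn hann]|[w1 [w2 [h1 [h2 /(oeqP pF) h3]]]]]; last first.
  split.
    apply: (nu_class_nu pF) => //; apply: (nu_class_eq (fun phi pa => esym (h3 phi pa))).
    by apply: (nu_class_cat pF); [exact: (wedge_logs_nu pF h1)|exact: (wedge_logs_nu pF h2)].
  move=> u [s [sr [sS ->]]]; apply/(ann_ev pF) => phi pa.
  rewrite (h3 (fun t => phi (t ++ s))) ?ev_cat; last exact: amd_append.
  rewrite (wedge_logs_ann pF pa h2) ?addr0.
  - have -> : ev (fun t => phi (t ++ s)) w1 = ev (fun t => phi ((t ++ take r s) ++ [:: s`_r])) w1.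
      by apply: eq_ev => v _; rewrite -catA cats1 -splitlast.
    apply: (wedge_logs_ann pF (amd_append [:: s`_r] pa) h1); first exact: firsts.
    by rewrite ar size_takel ?sr.
  - move=> x xs; move: xs; rewrite {1}(splitlast s sr) mem_rcons inE => /orP[/eqP ->|].
      by apply: aS; exact: sS.
    move/(firsts s sr sS); apply: adjoin_sub => y ya; by rewrite mem_cat ya.
  - by rewrite size_cat ar em sr; move: rm; clear; lia.
have [U hU] : exists U, forall phi, amd phi -> forall l q,
    phi (l ++ take r s0 ++ q) = U * phi (l ++ a ++ q).
  have str : size (take r s0) = size a by rewrite size_takel ?ss0 // ar.
  apply: (slot_subst pF str) => i; rewrite ar => ir; rewrite nth_take //.
  by apply: Sia => //; apply: s0S; exact: ltnW.
have U0 : U != 0.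
  apply/eqP => U0; apply: s0n; apply/(ozeroP pF) => phi pa.
  rewrite ev1 mul1r (splitlast s0 ss0) -cats1.
  by have := hU phi pa [::] [:: s0`_r]; rewrite /= => ->; rewrite U0 mul0r.
(* The elements x with w /\ da_1 /\ .. /\ da_r /\ dx = 0. They contain F^p(a) and S_{r+1} and are
   closed under sums and products, hence contain every e_j. *)
pose L x := forall phi, amd phi -> ev (fun t => phi (t ++ a ++ [:: x])) w = 0.
have dL (phi : seq F -> F) (pa : amd phi) := der_ev_slot w a [::] pa.
have Lp y : L (y ^+ p) by move=> phi pa; rewrite (derp pF (dL phi pa)).
have LD x y : L x -> L y -> L (x + y).
  by move=> hx hy phi pa; rewrite (derD (dL phi pa)) hx // hy // addr0.
have LM x y : L x -> L y -> L (x * y).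
  by move=> hx hy phi pa; rewrite (derM (dL phi pa)) hx // hy // !mulr0 addr0.
have La x : adjoin p a x -> L x.
  apply: (FpC_ind pF) => // y ya phi pa; rewrite /ev big1 // => u _.
  rewrite (_ : phi _ = 0) ?mulr0 //; have pa2 := amd_prepend u.2 pa.
  apply: (amd_perm0 pa2 (l := [::]) (t := y :: a)).
    by rewrite cats1 perm_sym perm_rcons.
  exact: (amd_mem_dup pa2).
have LS x : S r x -> L x.
  move=> Sx phi pa; apply: (mulfI U0); rewrite mulr0.
  have /(ann_ev pF) /(_ phi pa) : o_ozero (o_fwedge w [:: (1, rcons (take r s0) x)]).
    have st : size (take r s0) = r by rewrite size_takel // ss0.
    apply: hann; exists (rcons (take r s0) x); split; first by rewrite size_rcons st.
    split=> // i; rewrite nth_rcons st; case: ltngtP => // [ir _|-> //].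
    by rewrite nth_take //; apply: s0S; exact: ltnW.
  move=> <-; rewrite /ev mulr_sumr; apply: eq_bigr => u _.
  by rewrite -cats1 hU //; ring.
have Le x : x \in e -> L x.
  move=> xe; have /(Se x) := @genfield_gen F (adjoin p a) (fun y => y \in e) x xe.
  by apply: (genfield_ind pF).
have [b' [D [bf hD hw']]] := nu_setup pF hn bf0.
pose Q M t := (M = r /\ t = 1%N) \/ (M = m /\ t = (m - r)%N).
have sae : size (a ++ e) = m by rewrite size_cat ar em subnKC // ltnW.
have [|zs [hz ez]] := nu_decomposition pF hroot bf hD hw' (Q := Q).
  move=> A A0; have [c1|c1] := posnP (count (fun j => j < r)%N (elems A)); last first.
    by exists r, 1%N; split=> //; left.
  exists m, (m - r)%N; split; first by right.
  rewrite leqNgt; apply/negP => cA; case/eqP: A0.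
  (* A has no index below r and fewer than m - r below m, so it misses the index j of some element
     of e; the a_i together with this element annihilate w. *)
  have [j jm] : exists2 j, (r <= j < m)%N & j \notin elems A.
    apply: contrapT => no.
    have : (size [seq i <- iota 0 m | i \notin elems A] <= size (iota 0 r))%N.
      apply: uniq_leq_size; first by rewrite filter_uniq ?iota_uniq.
      move=> j; rewrite !mem_filter !mem_iota !add0n /= => /andP[jA jm].
      by rewrite ltnNge; apply/negP => rj; apply: no; exists j => //; rewrite rj jm.
    have := count_complement m (elems_uniq A); rewrite size_iota.
    by set c2 := size _; set c3 := count _ _ in cA *; move: cA rm; clear; lia.
  move=> jA; case/andP: jm => rj jm.
  have mb : (m <= size ((a ++ e) ++ b'))%N by rewrite size_cat sae leq_addr.
  apply: (annihilated_coef bf hD (J := rcons (iota 0 r) j)).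
  - rewrite all_rcons (leq_trans jm mb) /=; apply/allP => i; rewrite mem_iota => /= ir.
    by rewrite (leq_trans ir) // (leq_trans (ltnW rm)).
  - by rewrite rcons_uniq iota_uniq mem_iota /= add0n -leqNgt rj.
  - move=> i; rewrite mem_rcons inE => /orP[/eqP -> //|]; rewrite mem_iota add0n /= => ir.
    apply/negP => iA; have : has (fun j => j < r)%N (elems A) by apply/hasP; exists i.
    by rewrite has_count c1.
  move=> phi pa; rewrite map_rcons -cats1 -catA.
  rewrite (_ : [seq _ | i <- iota 0 r] = a); last by rewrite -ar nth_map_iota_prefix.
  apply: Le => //; rewrite nth_cat ar ltnNge rj /= nth_cat em.
  rewrite (_ : (j - r < m - r)%N); first by rewrite mem_nth // em; move: rj jm; clear; lia.
  by move: rj jm; clear; lia.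
pose good t (c z : seq F) := [/\ size z = n, forall y, y \in z -> y != 0, (t <= n)%N &
  forall y, y \in take t z -> adjoin p c y].
have [|zs1 [zs2 [hz1 hz2 hzs]]] := @seq_split _ (good 1%N a) (good (m - r)%N (a ++ e)) zs.
  move=> z /hz [zn z0 [M [t [[[-> ->]|[-> ->]] tn zb]]]]; [left|right]; split=> // y /zb.
    by rewrite -catA -ar take_size_cat.
  by rewrite -sae take_size_cat.
pose logs (zs : seq (seq F)) := flatten [seq o_dlogf (1 : F) z | z <- zs].
exists (logs zs1), (logs zs2); split; last split.
- by apply: (wedge_logs_intro pF hz1) => phi pa; rewrite ev_flatten.
- by apply: (wedge_logs_intro pF hz2) => phi pa; rewrite ev_flatten.
by apply/(oeqP pF) => phi pa; rewrite ez // hzs ev_cat !ev_flatten.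
Qed.

End Annihilators.

Theorem theorem4p3 (F : fieldType) (p : nat) :
  p \in [pchar F] ->
  (forall x : F, exists y : F, x = y ^+ p.-1) ->
  (* (a); S_1,...,S_{r+1} are S 0, ..., S r *)
  (forall (n r : nat) (S : nat -> F -> Prop),
    (forall i, (i <= r)%N -> exists x, S i x) ->
    (forall i, (i < r)%N -> o_pdeg p (S i) 1) ->
    (exists s : seq F, size s = r.+1 /\ (forall i, (i <= r)%N -> S i (nth 0 s i))
                       /\ ~ o_ozero [:: (1, s)]) ->
    forall m : nat, o_pdeg p (fun x => exists2 i, (i <= r)%N & S i x) m ->
    (r < m)%N /\
    forall a e : seq F,
      size a = r -> size e = (m - r)%N -> uniq (a ++ e) ->
      o_pindep p (fun x => x \in a ++ e) ->
      (forall i, (i < r)%N -> forall x, o_FpC p (S i) x <-> o_FpC p (fun y => y = nth 0 a i) x) ->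
      (forall x, o_genfield (o_FpC p (fun y => y \in a)) (S r) x <->
                 o_genfield (o_FpC p (fun y => y \in a)) (fun y => y \in e) x) ->
      forall w : o_form F, o_hom n w ->
        (o_annnu p n (fun u => exists s : seq F, size s = r.+1 /\
                     (forall i, (i <= r)%N -> S i (nth 0 s i)) /\ u = [:: (1, s)]) w <->
         exists w1 w2 : o_form F,
           o_wedgeS (o_addgen (fun v => exists x, o_FpC p (fun y => y \in a) x /\ x != 0 /\
                                             v = o_dlogf 1 [:: x]))
                  (o_nuZ p (n%:Z - 1)) w1 /\
           o_wedgeS (o_addgen (fun v => exists ys : seq F, size ys = (m - r)%N /\
                     (forall y, y \in ys -> o_FpC p (fun z => z \in a ++ e) y /\ y != 0) /\
                     v = o_dlogf 1 ys))
                  (o_nuZ p (n%:Z - (m - r)%N%:Z)) w2 /\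
           o_oeq w (w1 ++ w2)))
  /\
  (* (b) *)
  (forall (n k : nat) (S : F -> Prop) (a : seq F),
    (exists x, S x) -> o_pdeg p S k ->
    size a = k -> uniq a -> o_pindep p (fun x => x \in a) ->
    (forall x, x \in a -> o_FpC p S x) ->
    (forall x, o_FpC p (fun y => y \in a) x <-> o_FpC p S x) ->
    forall r : nat, (0 < r)%N ->
    forall w : o_form F, o_hom n w ->
      (o_annnu p n (fun u => exists s : seq F, size s = r /\
                   (forall x, x \in s -> S x) /\ u = [:: (1, s)]) w <->
       if (r <= k)%N then
         o_wedgeS (o_addgen (fun v => exists ys : seq F, size ys = (k - r).+1 /\
                   (forall y, y \in ys -> o_FpC p (fun z => z \in a) y /\ y != 0) /\
                   v = o_dlogf 1 ys))
                (o_nuZ p (n%:Z - (k - r).+1%:Z)) w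
       else o_nu p n w)).
Proof.
move=> pF hroot; split.
- move=> n r S _ _ [s0 [ss0 [s0S s0n]]] m hm.
  have rm : (r < m)%N.
    (* The r + 1 entries of a nonzero product are p-free, so their number is bounded by the p-degree
       m. *)
    rewrite -ss0; apply: (pfree_size_le pF hm (wedge_neq0_pfree pF s0n)) => x xs.
    have ir : (index x s0 < r.+1)%N by rewrite -ss0 index_mem.
    by apply: FpC_gen; exists (index x s0) => //; have := s0S _ ir; rewrite nth_index.
  split=> // a e ar em ue ie Sa Se w hw.
  rewrite (ann_product pF hroot ss0 s0S s0n rm ar em ue ie Sa Se hw).
  split=> -[w1 [w2 [h1 [h2 h3]]]]; exists w1, w2; split; try split=> //.
  + apply: wedgeS_mono h1 => v [[|x [|y ys]] [//= _ hx ->]].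
    by exists x; have [xa x0] := hx x (mem_head _ _).
  + by apply: wedgeS_mono h2 => v [ys [h4 h5 h6]]; exists ys.
  + apply: wedgeS_mono h1 => v [x [xa [x0 ->]]]; exists [:: x]; split=> // y.
    by rewrite inE => /eqP ->.
  + by apply: wedgeS_mono h2 => v [ys [h4 [h5 h6]]]; exists ys.
move=> n k S a _ _ ak ua ia aS Sa r _ w hw.
rewrite (ann_power pF hroot ak ua ia aS Sa r hw).
case: ifP => // _; split; apply: wedgeS_mono => v.
  by move=> [ys [h1 h2 h3]]; exists ys.
by move=> [ys [h1 [h2 h3]]]; exists ys.
Qed.
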